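(* For arbitrarily large $n$ there is a polytope $Q$ with $n$ vertices whose surface can be cut open along $2^{\Omega(n)}$ combinatorially distinct cut trees, each unfolding to a simple polygon, and these unfoldings include $2^{\Omega(n)}$ geometrically distinct (pairwise noncongruent) simple polygons.
   Context: A polytope is a convex polyhedron. A geometric cut tree $\mathcal{T}_C$ for $Q$ is a tree drawn on $\partial Q$, each arc a polygonal path, such that cutting $\partial Q$ along $\mathcal{T}_C$ and flattening $\partial Q\setminus\mathcal{T}_C$ into the plane yields a simple (nonoverlapping) polygon. The combinatorial cut tree $T_C$ of $\mathcal{T}_C$ is the labeled graph with a node for each point of $\mathcal{T}_C$ of degree not equal to 2 and a node for each point of $\mathcal{T}_C$ at a vertex of $Q$ (labeled by that vertex); arcs are the polygonal paths of $\mathcal{T}_C$ connecting these nodes. Cut trees are combinatorially distinct when their combinatorial cut trees differ as labeled trees. *)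

(* Defs.v *)
From HB Require Import structures.
From mathcomp Require Import all_boot all_order all_algebra.
From mathcomp Require Import classical_sets reals.
Set Implicit Arguments. Unset Strict Implicit. Unset Printing Implicit Defensive.
Import Order.TTheory GRing.Theory Num.Theory.
Local Open Scope ring_scope.
Local Open Scope classical_set_scope.

Section Geometry.
Variable R : realType.

Definition edist (d : nat) (x y : 'rV[R]_d) : R :=
  Num.sqrt (\sum_(i < d) (x 0 i - y 0 i) ^+ 2).

Definition seg (d : nat) (x y : 'rV[R]_d) : set 'rV[R]_d :=
  [set z | exists t : R, 0 <= t <= 1 /\ z = (1 - t) *: x + t *: y].

Definition polyset (d : nat) (s : seq 'rV[R]_d) : set 'rV[R]_d :=
  [set z | exists j, (j.+1 < size s)%N /\ seg (nth 0 s j) (nth 0 s j.+1) z].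

Definition plen (d : nat) (s : seq 'rV[R]_d) : R :=
  \sum_(j < (size s).-1) edist (nth 0 s j) (nth 0 s j.+1).

Definition simple_polyline (d : nat) (s : seq 'rV[R]_d) : Prop :=
  (forall j, (j.+1 < size s)%N -> nth 0 s j != nth 0 s j.+1) /\
  (forall j1 j2 z, (j1 < j2)%N -> (j2.+1 < size s)%N ->
     seg (nth 0 s j1) (nth 0 s j1.+1) z -> seg (nth 0 s j2) (nth 0 s j2.+1) z ->
     j2 = j1.+1 /\ z = nth 0 s j2).

Variable n : nat.
Implicit Type V : 'I_n -> 'rV[R]_3.

Definition inQ V (x : 'rV[R]_3) : Prop :=
  exists w : 'I_n -> R, (forall i, 0 <= w i) /\ \sum_i w i = 1 /\
                       x = \sum_i w i *: V i.

Definition is_polytope V : Prop :=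
  injective V /\
  (forall i, ~ exists w : 'I_n -> R, w i = 0 /\ (forall j, 0 <= w j) /\
        \sum_j w j = 1 /\ V i = \sum_j w j *: V j) /\
  (exists p e, 0 < e /\ forall y, edist p y < e -> inQ V y).

Definition surf V (x : 'rV[R]_3) : Prop :=
  inQ V x /\ forall e, 0 < e -> exists y, edist x y < e /\ ~ inQ V y.

Definition surf_path V (x y : 'rV[R]_3) (s : seq 'rV[R]_3) : Prop :=
  (0 < size s)%N /\ head 0 s = x /\ last 0 s = y /\ polyset s `<=` surf V.

Definition sdist V (x y : 'rV[R]_3) : R :=
  inf [set plen s | s in surf_path V x y].

(* a geometric cut tree: ct_k nodes (points of dQ) joined by ct_m arcs;
   arc e goes from node (ct_ends e).1 to node (ct_ends e).2 through the
   bend points ct_bend e (a polygonal path). *)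
Record cut_tree := CutTree {
  ct_k : nat;
  ct_m : nat;
  ct_node : 'I_ct_k -> 'rV[R]_3;
  ct_ends : 'I_ct_m -> 'I_ct_k * 'I_ct_k;
  ct_bend : 'I_ct_m -> seq 'rV[R]_3 }.

Definition arc_poly (T : cut_tree) (e : 'I_(ct_m T)) : seq 'rV[R]_3 :=
  ct_node (ct_ends e).1 :: rcons (ct_bend e) (ct_node (ct_ends e).2).

Arguments arc_poly : clear implicits.
Definition arcset (T : cut_tree) (e : 'I_(ct_m T)) := polyset (arc_poly T e).
Arguments arcset : clear implicits.

Definition treeset (T : cut_tree) : set 'rV[R]_3 :=
  [set z | exists e, arcset T e z].

Definition ct_deg (T : cut_tree) (i : 'I_(ct_k T)) : nat :=
  #|[set e : 'I_(ct_m T) | (ct_ends e).1 == i]| + #|[set e : 'I_(ct_m T) | (ct_ends e).2 == i]|.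

Definition ct_connected (T : cut_tree) : Prop :=
  forall S : {set 'I_(ct_k T)}, (exists i, i \in S) ->
    (forall e, ((ct_ends e).1 \in S) = ((ct_ends e).2 \in S)) ->
    forall i, i \in S.

Definition is_cut_tree V (T : cut_tree) : Prop :=
  (ct_m T).+1 = ct_k T /\
      ct_connected T /\
      injective (@ct_node T) /\
      (forall e, simple_polyline (arc_poly T e)) /\
      treeset T `<=` surf V /\
      (forall e e' z, e != e' -> arcset T e z -> arcset T e' z ->
                      exists i : 'I_(ct_k T), z = ct_node i) /\
      (forall e i, arcset T e (ct_node i) ->
                   i = (ct_ends e).1 \/ i = (ct_ends e).2) /\
  (* combinatorial canonicity: the nodes are exactly the points at vertices
     of Q and the points of degree <> 2 *)
  (forall i : 'I_(ct_k T), (exists v, ct_node i = V v) \/ ct_deg i != 2%N) /\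
  (forall v, treeset T (V v) -> exists i : 'I_(ct_k T), ct_node i = V v).

Definition ct_label V (T : cut_tree) (i : 'I_(ct_k T)) : option 'I_n :=
  [pick v | V v == ct_node i].

Definition comb_iso V (T1 T2 : cut_tree) : Prop :=
  exists phi : 'I_(ct_k T1) -> 'I_(ct_k T2), bijective phi /\
  exists psi : 'I_(ct_m T1) -> 'I_(ct_m T2), bijective psi /\
  (forall e, ct_ends (psi e) = (phi (ct_ends e).1, phi (ct_ends e).2) \/
             ct_ends (psi e) = (phi (ct_ends e).2, phi (ct_ends e).1)) /\
  (forall i, ct_label V (phi i) = ct_label V i).

Definition poly_edge (r : nat) (p : 'I_r -> 'rV[R]_2) (i : 'I_r) :=
  seg (p i) (p (ordS i)).

Definition simple_polygon (r : nat) (p : 'I_r -> 'rV[R]_2) : Prop :=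
  (3 <= r)%N /\ (forall i, p i != p (ordS i)) /\
  (forall i j z, i != j -> poly_edge p i z -> poly_edge p j z ->
     (j = ordS i /\ z = p j) \/ (i = ordS j /\ z = p i)).

Definition poly_boundary (r : nat) (p : 'I_r -> 'rV[R]_2) : set 'rV[R]_2 :=
  [set z | exists i, poly_edge p i z].

(* interior = points off the boundary lying in a bounded component of the
   complement of the boundary (components via polygonal paths) *)
Definition poly_interior (r : nat) (p : 'I_r -> 'rV[R]_2) : set 'rV[R]_2 :=
  [set x | ~ poly_boundary p x /\ exists M : R, forall s : seq 'rV[R]_2,
     polyset (x :: s) `&` poly_boundary p = set0 -> edist 0 (last x s) < M].

Definition is_unfolding V (T : cut_tree) (f : 'rV[R]_3 -> 'rV[R]_2)
    (P : set 'rV[R]_2) : Prop :=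
  let D := [set x | surf V x /\ ~ treeset T x] in
  (forall x y, D x -> D y -> f x = f y -> x = y) /\
  (forall q, D q -> exists e, 0 < e /\ forall x y, D x -> D y ->
      edist q x < e -> edist q y < e -> edist (f x) (f y) = sdist V x y) /\
  f @` D = P /\
  exists r (p : 'I_r -> 'rV[R]_2), simple_polygon p /\ P = poly_interior p.

End Geometry.

Definition congruent (R : realType) (A B : set 'rV[R]_2) : Prop :=
  exists g : 'rV[R]_2 -> 'rV[R]_2,
    (forall x y, edist (g x) (g y) = edist x y) /\ g @` A = B.

(* Main.v *)
(* Q is a prism over the convex polygon B spanned by points of a flat parabolic arc. Cutting
   both bases along the arc, and one vertical edge, unrolls the side facets into a strip that
   ends with the facet of the chord of the arc, to which both bases stay attached. For each
   odd vertex j independently, the cut along j - 1, j, j + 1 may be replaced by the diagonal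
   from j - 1 to j + 1 and the altitude dropped to it from j. The two small right triangles
   cut off this way stay hinged to the strip, and since they are acute along their hinges
   they project into it. So each of these 2^g unfoldings is a region |y| < H(x) with H
   piecewise linear, in particular a simple polygon.
   The trees differ as labeled graphs because j - 1 and j are adjacent exactly if the corner
   at j is left alone. A congruence between two of the unfoldings permutes the four corners
   of the strip, since only opposite corners are as far apart, so it is one of the four
   symmetries of a rectangle. The strip is too low at one end to be exchanged with the other
   end, hence H, and with it the choice made at each odd vertex, is determined. *)

Require Import Defs.
From HB Require Import structures.
From mathcomp Require Import all_boot all_order all_algebra.
From mathcomp Require Import classical_sets reals.
From mathcomp Require Import ring lra zify.
Set Implicit Arguments. Unset Strict Implicit. Unset Printing Implicit Defensive.
Import Order.TTheory GRing.Theory Num.Theory.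
Local Open Scope ring_scope.
Local Open Scope classical_set_scope.

(** A corner of the base is nearly straight, so its ear, hinged as a whole to one of its two edges,
    would overhang the neighboring facet; this is why the altitude splits the ear. The arc is a
    parabola because points with consecutive integer abscissas then all lie at the same height
    [curv] above the chord of their neighbors, and differences of edge lines and chords factor into
    linear terms. The prism reaches from -1 to 1 in the third coordinate, so the side facets unroll
    to [|y| < 1] and the bases only add to that.

    An unfolding has to preserve the intrinsic distance locally, and this distance is an infimum
    over all paths on the surface. Convexity makes it tractable: a segment on the surface stays in
    one facet, and near a given point only the facets through that point occur. So a map that is
    isometric on each of these facets bounds all path lengths from below, and folding the straight
    segment between two images back to the surface gives a path that attains the bound. *)

(** * Euclidean distance and segments *)

Section Distance.
Variable R : realType.

Lemma cauchy_schwarz d (a b : 'I_d -> R) :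
  (\sum_i a i * b i) ^+ 2 <= (\sum_i a i ^+ 2) * (\sum_i b i ^+ 2).
Proof.
set A := \sum_i a i ^+ 2; set B := \sum_i b i ^+ 2; set C := \sum_i a i * b i.
have B0 : 0 <= B by apply: sumr_ge0 => i _; apply: sqr_ge0.
have [B_gt0|] := ltP 0 B; last first.
  move=> Ble0; have Beq0 : B = 0 by apply/le_anti; rewrite Ble0 B0.
  have bz i : b i = 0.
    move/eqP: Beq0; rewrite psumr_eq0; last by move=> j _; apply: sqr_ge0.
    by move/allP/(_ i (mem_index_enum _)) => /=; rewrite sqrf_eq0 => /eqP.
  have -> : C = 0 by apply: big1 => i _; rewrite bz mulr0.
  by rewrite expr0n /= Beq0 mulr0.
(* [C / B] is the coefficient of the projection of [a] to [b]; scaling by [B] avoids the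
   division. *)
have : 0 <= \sum_i (B * a i - C * b i) ^+ 2.
  by apply: sumr_ge0 => i _; apply: sqr_ge0.
have -> : \sum_i (B * a i - C * b i) ^+ 2 = B * (A * B - C ^+ 2).
  rewrite (eq_bigr (fun i => B ^+ 2 * a i ^+ 2 - (2 * B * C) * (a i * b i)
                             + C ^+ 2 * b i ^+ 2)); last by move=> i _; ring.
  rewrite big_split sumrB /= -!mulr_sumr -/A -/B -/C; ring.
by rewrite pmulr_rge0 // subr_ge0.
Qed.

Lemma edist_ge0 d (x y : 'rV[R]_d) : 0 <= edist x y.
Proof. exact: sqrtr_ge0. Qed.

Lemma edist_sqrE d (x y : 'rV[R]_d) :
  edist x y ^+ 2 = \sum_(i < d) (x 0 i - y 0 i) ^+ 2.
Proof. by rewrite sqr_sqrtr // sumr_ge0 // => i _; apply: sqr_ge0. Qed.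

Lemma edistC d (x y : 'rV[R]_d) : edist x y = edist y x.
Proof.
by rewrite /edist; congr Num.sqrt; apply: eq_bigr => i _; rewrite -sqrrN opprB.
Qed.

Lemma edistxx d (x : 'rV[R]_d) : edist x x = 0.
Proof. by rewrite /edist big1 ?sqrtr0 // => i _; rewrite subrr expr0n. Qed.

Lemma edist_triangle d (y x z : 'rV[R]_d) : edist x z <= edist x y + edist y z.
Proof.
have xy0 := edist_ge0 x y; have yz0 := edist_ge0 y z.
rewrite -ler_sqr ?nnegrE ?edist_ge0 ?addr_ge0 // sqrrD !edist_sqrE.
pose a i := x 0 i - y 0 i; pose b i := y 0 i - z 0 i.
have -> : \sum_i (x 0 i - z 0 i) ^+ 2 =
    \sum_i a i ^+ 2 + (\sum_i a i * b i) *+ 2 + \sum_i b i ^+ 2.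
  rewrite -sumrMnl -!big_split /=; apply: eq_bigr => i _; rewrite /a /b; ring.
rewrite lerD2r lerD2l lerMn2r /=.
apply: le_trans (ler_norm _) _.
rewrite -ler_sqr ?nnegrE ?mulr_ge0 // real_normK ?num_real // exprMn !edist_sqrE.
exact: cauchy_schwarz.
Qed.

Lemma edist_segE d (x y : 'rV[R]_d) t :
  0 <= t <= 1 -> edist x ((1 - t) *: x + t *: y) = t * edist x y.
Proof.
move=> /andP[t0 t1]; rewrite /edist.
have -> : \sum_(i < d) (x 0 i - ((1 - t) *: x + t *: y) 0 i) ^+ 2 =
   t ^+ 2 * \sum_(i < d) (x 0 i - y 0 i) ^+ 2.
  by rewrite mulr_sumr; apply: eq_bigr => i _; rewrite !mxE; ring.
by rewrite sqrtrM ?sqr_ge0 // sqrtr_sqr ger0_norm.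
Qed.

Lemma segC d (x y : 'rV[R]_d) : seg x y = seg y x.
Proof.
suff sub (a b : 'rV[R]_d) : seg a b `<=` seg b a by apply/seteqP; split; apply: sub.
move=> z [t [/andP[t0 t1] ->]]; exists (1 - t); split; first by lra.
by rewrite addrC; congr (_ *: _ + _); lra.
Qed.

Lemma seg_edist d (x y z : 'rV[R]_d) :
  seg x y z -> edist x z + edist z y = edist x y.
Proof.
move=> [t [/andP[t0 t1] zE]].
have zE' : z = (1 - (1 - t)) *: y + (1 - t) *: x.
  by rewrite zE addrC; congr (_ *: _ + _); ring.
rewrite {1}zE edist_segE ?t0 // [edist z y]edistC zE' edist_segE; last by lra.
rewrite [edist y x]edistC; ring.
Qed.

End Distance.

(** Facts about natural numbers are stated with [leq], so clearing the hypotheses in which the order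
    of [R] occurs keeps them for [lia]. *)
Ltac nlia :=
  repeat match goal with
    | H : context [@Order.le] |- _ => clear H
    | H : context [@Order.lt] |- _ => clear H
    | H : context [@ordS] |- _ => clear H
  end; lia.

(** * Polygons bounded by a graph and its mirror image *)

Section Plane.
Variable R : realType.
Implicit Types (a b c d x y t : R) (z : 'rV[R]_2).

Definition pt2 x y : 'rV[R]_2 := \row_(i < 2) (if i == ord0 then x else y).
Definition xc z := z 0 ord0.
Definition yc z := z 0 ord_max.

Lemma xc_pt2 x y : xc (pt2 x y) = x. Proof. by rewrite /xc mxE. Qed.
Lemma yc_pt2 x y : yc (pt2 x y) = y. Proof. by rewrite /yc mxE. Qed.
Definition pt2E := (xc_pt2, yc_pt2).

Lemma eq_pt2 z1 z2 : xc z1 = xc z2 -> yc z1 = yc z2 -> z1 = z2.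
Proof.
move=> ex ey; apply/rowP => -[[|[|//]] lt2].
  by move: ex; rewrite /xc; congr (z1 _ _ = z2 _ _); apply: val_inj.
by move: ey; rewrite /yc; congr (z1 _ _ = z2 _ _); apply: val_inj.
Qed.

Lemma edist2_sqrE z1 z2 :
  edist z1 z2 ^+ 2 = (xc z1 - xc z2) ^+ 2 + (yc z1 - yc z2) ^+ 2.
Proof.
rewrite edist_sqrE big_ord_recl big_ord1 /xc /yc.
by congr (_ + (z1 _ _ - z2 _ _) ^+ 2); apply: val_inj.
Qed.

Lemma seg2P z1 z2 z :
  seg z1 z2 z <-> exists t, 0 <= t <= 1 /\
    xc z = (1 - t) * xc z1 + t * xc z2 /\ yc z = (1 - t) * yc z1 + t * yc z2.
Proof.
split=> [[t [t01 ->]]|[t [t01 [ex ey]]]]; exists t; split=> //.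
  by rewrite /xc /yc !mxE.
by apply: eq_pt2; rewrite ?ex ?ey /xc /yc !mxE.
Qed.

(** The line is given by a cross-multiplied equation, the form in which [H_affine] below describes
    the pieces of a graph. *)
Lemma seg_graph a b c d z : a < c ->
  seg (pt2 a b) (pt2 c d) z <->
  (a <= xc z <= c) /\ (yc z - b) * (c - a) = (d - b) * (xc z - a).
Proof.
move=> ac; have ca0 : c - a != 0 by rewrite subr_eq0 gt_eqF.
rewrite seg2P !pt2E; split=> [[t [t01 [-> ->]]]|[xac e]].
  by split; [apply/andP; split; nra | ring].
exists ((xc z - a) / (c - a)); split; last split.
- by rewrite ler_pdivlMr ?ler_pdivrMr ?subr_gt0 //; lra.
- by field.
have E : yc z - b = (d - b) * ((xc z - a) / (c - a)) by rewrite mulrA -e mulfK.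
by rewrite -[yc z](subrK b) E; ring.
Qed.

Lemma seg_vert a b d z : b <= d ->
  seg (pt2 a b) (pt2 a d) z <-> xc z = a /\ b <= yc z <= d.
Proof.
rewrite seg2P !pt2E => bd; split=> [[t [t01 [-> ->]]]|[-> ybd]].
  by split; [ring | apply/andP; split; nra].
have [ebd|nbd] := eqVneq b d.
  by exists 0; split; [lra | split; [ring | rewrite -ebd in ybd *; lra]].
have bd' : 0 < d - b by rewrite subr_gt0 lt_neqAle nbd.
exists ((yc z - b) / (d - b)); split; last by split; field; rewrite gt_eqF.
by rewrite ler_pdivlMr ?ler_pdivrMr //; lra.
Qed.

End Plane.

Lemma breakpoint_piece (R : realType) M (bx : nat -> R) x : (0 < M)%N ->
  bx 0%N <= x <= bx M -> exists2 a, (a < M)%N & bx a <= x <= bx a.+1.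
Proof.
move=> M_gt0 /andP[x0 xM].
suff key b : (b < M)%N -> x <= bx b.+1 -> exists2 a, (a < M)%N & bx a <= x <= bx a.+1.
  by apply: (key M.-1); rewrite prednK.
elim: b => [|b IH] bM xb; first by exists 0%N; rewrite ?x0.
have [/IH|/ltW bx'] := leP x (bx b.+1); first by apply; nlia.
by exists b.+1; rewrite ?bx'.
Qed.

Section GraphPolygon.
Variable R : realType.
Variables (M : nat) (bx : nat -> R) (H : R -> R) (K W : R).
Hypothesis M_gt0 : (0 < M)%N.
Hypothesis bx_mono : forall a, (a < M)%N -> bx a < bx a.+1.
Hypothesis bx0 : bx 0%N = 0.
Hypothesis bxM : bx M = W.
Hypothesis H_lip : forall x x' : R, `|H x - H x'| <= K * `|x - x'|.
Hypothesis H_gt0 : forall x : R, 0 <= x <= W -> 0 < H x.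
Hypothesis H_affine : forall a x, (a < M)%N -> bx a <= x <= bx a.+1 ->
  (H x - H (bx a)) * (bx a.+1 - bx a) = (H (bx a.+1) - H (bx a)) * (x - bx a).

Definition under_graph : set 'rV[R]_2 :=
  [set z | 0 < xc z < W /\ `|yc z| < H (xc z)].

(** Counterclockwise: the lower boundary from left to right, then the upper one from right to left.
    Thus edges [M] and [2M + 1] are the vertical sides. *)
Definition graph_vertex (t : nat) : 'rV[R]_2 :=
  if (t <= M)%N then pt2 (bx t) (- H (bx t))
  else pt2 (bx (M.*2.+1 - t)) (H (bx (M.*2.+1 - t))).

Definition graph_polygon (i : 'I_(M.+1.*2)) := graph_vertex i.

Lemma breakpoint_le a b : (a <= b <= M)%N -> bx a <= bx b.
Proof.
case/andP => ab bM; elim: b ab bM => [|b IH] ab bM; first by move: ab; case: a.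
move: ab; rewrite leq_eqVlt => /orP[/eqP -> //|ab].
by apply: le_trans (IH ab (ltnW bM)) _; apply/ltW/bx_mono.
Qed.

Lemma breakpoint_lt a b : (a < b <= M)%N -> bx a < bx b.
Proof.
case/andP => ab bM; apply: lt_le_trans (bx_mono _) (breakpoint_le _); first by nlia.
by apply/andP; split.
Qed.

Lemma breakpoint_range a : (a <= M)%N -> 0 <= bx a <= W.
Proof. by move=> aM; rewrite -bx0 -bxM !breakpoint_le //; nlia. Qed.

Lemma width_gt0 : 0 < W.
Proof. by rewrite -bx0 -bxM breakpoint_lt //; nlia. Qed.

Lemma piece_of x : 0 <= x <= W -> exists2 a, (a < M)%N & bx a <= x <= bx a.+1.
Proof. by rewrite -bx0 -bxM; apply: breakpoint_piece. Qed.

(** The cases are the lower boundary, the right side, the upper boundary and the left side;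
    simplicity becomes a comparison of these four kinds. *)
Definition edge_spec (i : nat) z :=
  if (i < M)%N then (bx i <= xc z <= bx i.+1) /\ yc z = - H (xc z)
  else if i == M then xc z = W /\ `|yc z| <= H W
  else if (i < M.*2.+1)%N then
    (bx (M.*2 - i) <= xc z <= bx (M.*2 - i).+1) /\ yc z = H (xc z)
  else xc z = 0 /\ `|yc z| <= H 0.

Lemma edge_specP (i : 'I_(M.+1.*2)) z : poly_edge graph_polygon i z <-> edge_spec i z.
Proof.
rewrite /poly_edge /graph_polygon /graph_vertex /edge_spec /=.
have iM := ltn_ord i.
case: (ltnP i M) => [lt_iM|le_Mi].
  have -> : (i.+1 %% M.+1.*2 = i.+1)%N by rewrite modn_small; nlia.
  rewrite (ltnW lt_iM) lt_iM seg_graph ?bx_mono //.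
  split=> -[xi e]; split=> //; have := H_affine lt_iM xi; last by rewrite e; lra.
  move=> e'; apply: (@mulIf _ (bx i.+1 - bx i)); last by lra.
  by rewrite subr_eq0 gt_eqF ?bx_mono.
case: eqP => [->|/eqP neq_iM].
  have -> : (M.+1 %% M.+1.*2 = M.+1)%N by rewrite modn_small; nlia.
  rewrite leqnn ltnn (_ : M.*2.+1 - M.+1 = M)%N ?bxM; last by nlia.
  rewrite seg_vert ?ler_norml //.
  by have := @H_gt0 W; rewrite lexx (ltW width_gt0) => /(_ isT); lra.
have -> : (i <= M)%N = false by apply/negbTE; nlia.
case: (ltnP i M.*2.+1) => lt_i.
  have -> : (i.+1 %% M.+1.*2 = i.+1)%N by rewrite modn_small; nlia.
  have -> : (i.+1 <= M)%N = false by apply/negbTE; nlia.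
  have -> : (M.*2.+1 - i.+1 = M.*2 - i)%N by nlia.
  have -> : (M.*2.+1 - i = (M.*2 - i).+1)%N by nlia.
  have lt' : (M.*2 - i < M)%N by nlia.
  rewrite segC seg_graph ?bx_mono //.
  split=> -[xi e]; split=> //; have := H_affine lt' xi; last by rewrite e; lra.
  move=> e'; apply: (@mulIf _ (bx (M.*2 - i).+1 - bx (M.*2 - i))); last by lra.
  by rewrite subr_eq0 gt_eqF ?bx_mono.
have -> : nat_of_ord i = M.*2.+1 by nlia.
rewrite (_ : M.*2.+2 = M.+1.*2)%N; last by nlia.
rewrite modnn leq0n subnn bx0 segC seg_vert ?ler_norml //.
by have := @H_gt0 0; rewrite lexx (ltW width_gt0) => /(_ isT); lra.
Qed.

Lemma graph_boundaryP z : poly_boundary graph_polygon z <->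
  (0 <= xc z <= W) /\
  (`|yc z| = H (xc z) \/ (xc z = 0 \/ xc z = W) /\ `|yc z| <= H (xc z)).
Proof.
split.
  move=> [i /edge_specP]; rewrite /edge_spec; have iM := ltn_ord i.
  case: (ltnP i M) => [lt_iM [xi ->]|le_Mi]; last case: eqP.
  - have x0 : 0 <= xc z <= W.
      case/andP: xi => xi1 xi2; apply/andP; split.
        by apply: le_trans xi1; rewrite -bx0 breakpoint_le //; nlia.
      by apply: le_trans xi2 _; rewrite -bxM breakpoint_le //; nlia.
    by split=> //; left; rewrite normrN gtr0_norm // H_gt0.
  - by move=> _ [-> yH]; split; [rewrite lexx (ltW width_gt0) | right; split; [right|]].
  - move=> neq_iM; case: ifPn => lt_i [xi yH].
      have x0 : 0 <= xc z <= W.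
        case/andP: xi => xi1 xi2; apply/andP; split.
          by apply: le_trans xi1; rewrite -bx0 breakpoint_le //; nlia.
        by apply: le_trans xi2 _; rewrite -bxM breakpoint_le //; nlia.
      by split=> //; left; rewrite yH gtr0_norm // H_gt0.
    by rewrite xi; split; [rewrite lexx (ltW width_gt0) | right; split; [left|]].
have ord k : (k < M.+1.*2)%N -> edge_spec k z -> poly_boundary graph_polygon z.
  by move=> lt_k spec; exists (Ordinal lt_k); apply/edge_specP.
move=> [x0W [yH|[[x0|xW] yH]]].
- have [a aM xa] := piece_of x0W.
  have [y0|y0] := leP 0 (yc z).
    apply: (@ord (M.*2 - a)%N); first by nlia.
    rewrite /edge_spec ifF; last by apply/negbTE; nlia.
    rewrite ifF; last by apply/negbTE; nlia.
    rewrite ifT; last by nlia.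
    rewrite (_ : M.*2 - (M.*2 - a) = a)%N; last by nlia.
    by rewrite -yH ger0_norm.
  apply: (@ord a); first by nlia.
  by rewrite /edge_spec aM -yH ltr0_norm // opprK.
- apply: (@ord M.*2.+1); first by nlia.
  rewrite /edge_spec ifF; last by apply/negbTE; nlia.
  rewrite ifF; last by apply/negbTE; nlia.
  by rewrite ltnn -x0.
- apply: (@ord M); first by nlia.
  by rewrite /edge_spec ltnn eqxx -xW.
Qed.

(** Two pieces of the same boundary share at most a breakpoint, [H_gt0] separates the upper from the
    lower boundary, and a vertical side is reached only by the outermost pieces. By symmetry [i < j]
    is enough. *)
Lemma graph_polygon_simple : simple_polygon graph_polygon.
Proof.
split; first by nlia.
have yH (x : R) : 0 <= x <= W -> 0 < H x by apply: H_gt0.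
have meet (i j : 'I_(M.+1.*2)) z : (i < j)%N -> poly_edge graph_polygon i z ->
    poly_edge graph_polygon j z ->
    j = ordS i /\ z = graph_polygon j \/ i = ordS j /\ z = graph_polygon i.
  move=> lt_ij /edge_specP ei /edge_specP ej.
  have lt_i := ltn_ord i; have lt_j := ltn_ord j.
  have x0W : 0 <= xc z <= W.
    by have /graph_boundaryP[] : poly_boundary graph_polygon z by exists i; apply/edge_specP.
  have H0 := yH _ x0W.
  have W0 := width_gt0.
  have next (k l : 'I_M.+1.*2) : nat_of_ord l = k.+1 -> l = ordS k.
    by move=> e; apply: val_inj; rewrite /= -e modn_small.
  have wrap (k l : 'I_M.+1.*2) : nat_of_ord k = M.*2.+1 -> nat_of_ord l = 0%N ->
      l = ordS k.
    move=> e e0; apply: val_inj; rewrite /= e e0.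
    by rewrite (_ : M.*2.+2 = M.+1.*2)%N ?modnn //; nlia.
  have bdy a : (a < M)%N -> bx a < bx a.+1 by apply: bx_mono.
  move: ei ej; rewrite /edge_spec.
  case: (ltnP i M) => [iM [xi yi]|Mi].
    case: (ltnP j M) => [jM [xj yj]|Mj].
      have ij : nat_of_ord j = i.+1.
        apply/eqP; rewrite eqn_leq lt_ij andbT leqNgt; apply/negP => lt'.
        by have := @breakpoint_lt i.+1 j; rewrite lt' (ltnW jM) => /(_ isT); lra.
      left; split; first exact: next.
      apply: eq_pt2; rewrite /graph_polygon /graph_vertex (ltnW jM) pt2E.
        by rewrite -ij in xi; lra.
      by rewrite yj; congr (- H _); rewrite -ij in xi; lra.
    case: eqP => [jM [xz yz]|njM].
      have ij : nat_of_ord j = i.+1.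
        apply/eqP; rewrite eqn_leq lt_ij andbT leqNgt; apply/negP => lt'.
        by have := @breakpoint_lt i.+1 j; rewrite lt' jM leqnn bxM => /(_ isT); lra.
      left; split; first exact: next.
      apply: eq_pt2; rewrite /graph_polygon /graph_vertex jM leqnn pt2E bxM //.
      by rewrite yi xz.
    case: ifPn => [ltj [xj yj]|ltj [xz yz]]; first by exfalso; lra.
    have i0 : nat_of_ord i = 0%N.
      apply/eqP; rewrite -leqn0 leqNgt; apply/negP => lt'.
      by have := @breakpoint_lt 0 i; rewrite lt' (ltnW iM) bx0 => /(_ isT); lra.
    right; split; first by apply: wrap => //; nlia.
    apply: eq_pt2; rewrite /graph_polygon /graph_vertex i0 leq0n pt2E bx0 //.
    by rewrite yi xz.
  case: eqP => [iM [xz yz]|niM].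
    rewrite ifF; last by apply/negbTE; nlia.
    rewrite ifF; last by apply/negbTE; nlia.
    case: ifPn => [ltj [xj yj]|ltj [xz' _]]; last by exfalso; lra.
    have jM : nat_of_ord j = M.+1.
      apply/eqP; rewrite eqn_leq; apply/andP; split; last by nlia.
      rewrite leqNgt; apply/negP => lt'.
      have := @breakpoint_lt (M.*2 - j).+1 M; rewrite leqnn bxM andbT.
      by move=> lt; have := lt ltac:(nlia); lra.
    left; split; first by apply: next; nlia.
    apply: eq_pt2; rewrite /graph_polygon /graph_vertex jM ltnn;
      by rewrite (_ : M.*2.+1 - M.+1 = M)%N ?pt2E ?bxM ?yj ?xz //; nlia.
  have {niM Mi}Mi : (M < i)%N by rewrite ltn_neqAle Mi andbT; apply/eqP => /esym.
  rewrite ifT; last by nlia.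
  rewrite ifF; last by apply/negbTE; nlia.
  rewrite ifF; last by apply/negbTE; nlia.
  move=> [xi yi]; case: ifPn => [ltj [xj yj]|ltj [xz yz]].
    have ij : nat_of_ord j = i.+1.
      apply/eqP; rewrite eqn_leq lt_ij andbT leqNgt; apply/negP => lt'.
      have := @breakpoint_lt (M.*2 - j).+1 (M.*2 - i).
      by move=> lt; have := lt ltac:(nlia); lra.
    have E : ((M.*2 - j).+1 = M.*2 - i)%N by nlia.
    left; split; first exact: next.
    rewrite E in xj.
    apply: eq_pt2; rewrite /graph_polygon /graph_vertex ifF ?pt2E;
      try (by apply/negbTE; nlia).
      by rewrite (_ : M.*2.+1 - j = M.*2 - i)%N; [lra | nlia].
    rewrite (_ : M.*2.+1 - j = M.*2 - i)%N; last by nlia.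
    by rewrite yj; congr (H _); lra.
  have iM : nat_of_ord i = M.*2.
    apply/eqP; rewrite eqn_leq; apply/andP; split; first by nlia.
    rewrite leqNgt; apply/negP => lt'.
    have := @breakpoint_lt 0 (M.*2 - i)%N; rewrite bx0.
    by move=> lt; have := lt ltac:(nlia); lra.
  have jM : nat_of_ord j = M.*2.+1 by nlia.
  left; split; first by apply: next; nlia.
  apply: eq_pt2; rewrite /graph_polygon /graph_vertex jM ifF ?subnn ?pt2E ?bx0 //;
    try (by apply/negbTE; nlia).
  by rewrite yi xz.
split.
  move=> i; apply/eqP => e.
  have iM := ltn_ord i.
  move: e; rewrite /graph_polygon /graph_vertex /=.
  have [lt_i|ge_i] := ltnP i.+1 (M.+1.*2); last first.
    rewrite (_ : i.+1 = M.+1.*2)%N ?modnn ?leq0n; last by nlia.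
    rewrite ifF; last by apply/negbTE; nlia.
    rewrite (_ : M.*2.+1 - i = 0)%N; last by nlia.
    move=> /(congr1 (@yc R)); rewrite !pt2E.
    by have := @yH (bx 0) (breakpoint_range (leq0n _)); lra.
  rewrite modn_small //.
  case: (ltnP i M) => [lt_iM|Mi].
    rewrite (ltnW lt_iM) => /(congr1 (@xc R)); rewrite !pt2E.
    by have := bx_mono lt_iM; lra.
  case: ifPn => iM'.
    have -> : nat_of_ord i = M by nlia.
    rewrite (_ : M.*2.+1 - M.+1 = M)%N; last by nlia.
    move=> /(congr1 (@yc R)); rewrite !pt2E.
    by have := @yH (bx M) (breakpoint_range (leqnn _)); lra.
  rewrite (_ : M.*2.+1 - i = (M.*2.+1 - i.+1).+1)%N; last by nlia.
  move=> /(congr1 (@xc R)); rewrite !pt2E.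
  have lt' : (M.*2.+1 - i.+1 < M)%N by nlia.
  by have := bx_mono lt'; lra.
move=> i j z neq_ij ei ej; have [lt_ij|lt_ji|eq_ij] := ltngtP i j.
- exact: meet.
- by have [|] := meet _ _ _ lt_ji ej ei; [right|left].
- by move/eqP: neq_ij; case; apply: val_inj.
Qed.

Lemma breakpoint_width_bound x : 0 <= x <= W -> H x <= H 0 + K * W.
Proof.
move=> /andP[x0 xW]; have := H_lip x 0.
rewrite subr0 (ger0_norm x0) ler_norml => /andP[_ h].
have K0 : 0 <= K by have := H_lip 1 0; have := normr_ge0 (H 1 - H 0); rewrite subr0 normr1; lra.
nra.
Qed.

(** The zero is the supremum of the points where [phi] is positive: a negative value there
    contradicts the points of the set just before it, a positive value produces points of the set
    beyond it. *)
Lemma lipschitz_ivt (phi : R -> R) C :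
  (forall t t' : R, 0 <= t <= 1 -> 0 <= t' <= 1 -> `|phi t - phi t'| <= C * `|t - t'|) ->
  0 < phi 0 -> phi 1 <= 0 -> exists2 t, 0 <= t <= 1 & phi t = 0.
Proof.
move=> lip phi0 phi1; pose S := [set t : R | 0 <= t <= 1 /\ 0 < phi t].
have S0 : S 0 by split=> //; lra.
have ubS : ubound S 1 by move=> t [/andP[]].
have supS : has_sup S by split; [exists 0 | exists 1].
have t0_ge0 : 0 <= sup S by apply: ub_le_sup S0; exists 1.
have t0_le1 : sup S <= 1 by apply: ge_sup => //; exists 0.
have C_ge0 : 0 <= C.
  have := lip 1 0; rewrite subr0 normr1 mulr1 => /(_ ltac:(lra) ltac:(lra)).
  by have := normr_ge0 (phi 1 - phi 0); lra.
exists (sup S); first by rewrite t0_ge0.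
have [neg|pos|//] := ltgtP (phi (sup S)) 0.
  (* [C] may be 0, [C + 1] is positive. *)
  pose e := - phi (sup S) / (C + 1).
  have eE : e * (C + 1) = - phi (sup S) by rewrite mulfVK //; lra.
  have e_gt0 : 0 < e by rewrite divr_gt0; lra.
  have [t [t01 phit] lt_t] := sup_adherent e_gt0 supS.
  have t_le : t <= sup S by apply: ub_le_sup; [exists 1 | split].
  have := lip t (sup S) t01; rewrite t0_ge0 t0_le1 => /(_ isT).
  have le0 : t - sup S <= 0 by lra.
  rewrite (ler0_norm le0) ler_norml => /andP[_ h].
  by nra.
have t0_lt1 : sup S < 1.
  by rewrite lt_neqAle t0_le1 andbT; apply/eqP => e; rewrite e in pos; lra.
(* A step of this size stays in the unit interval and loses at most half of the value of [phi]. *)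
pose e := Num.min (1 - sup S) (phi (sup S) / (C + 1) / 2).
have e_gt0 : 0 < e.
  by rewrite lt_min subr_gt0 t0_lt1 !divr_gt0 //; lra.
have e_le1 : e <= 1 - sup S by rewrite ge_min lexx.
have e_le : e * (C + 1) * 2 <= phi (sup S).
  have : e <= phi (sup S) / (C + 1) / 2 by rewrite ge_min lexx orbT.
  by rewrite ler_pdivlMr // ler_pdivlMr; lra.
have t01 : 0 <= sup S + e <= 1 by lra.
have : sup S + e <= sup S.
  apply: ub_le_sup; [by exists 1 | split=> //].
  have := lip (sup S + e) (sup S) t01; rewrite t0_ge0 t0_le1 => /(_ isT).
  rewrite addrAC subrr add0r (gtr0_norm e_gt0) ler_norml => /andP[h _].
  by nra.
lra.
Qed.

(** A function that is Lipschitz along segments, positive exactly on the region, and zero only on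
    its boundary. Hence a segment that leaves the region meets the boundary. *)
Definition depth z := Num.min (Num.min (xc z) (W - xc z)) (H (xc z) - `|yc z|).

Lemma depth_gt0 z : (0 < depth z) <-> under_graph z.
Proof.
rewrite /depth /under_graph !lt_min /= !subr_gt0.
by split=> [/andP[/andP[-> ->] ->]//|[/andP[-> ->] ->]].
Qed.

Lemma depth_eq0 z : depth z = 0 -> poly_boundary graph_polygon z.
Proof.
rewrite graph_boundaryP /depth; have W0 := width_gt0.
have [h1|h1] := leP (xc z) (W - xc z).
  have [h2|h2] := leP (xc z) (H (xc z) - `|yc z|) => e.
    by split; [apply/andP; split | right; split; [left|]]; lra.
  by split; [apply/andP; split | left]; lra.
have [h2|h2] := leP (W - xc z) (H (xc z) - `|yc z|) => e.
  by split; [apply/andP; split | right; split; [right|]]; lra.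
by split; [apply/andP; split | left]; lra.
Qed.

Lemma under_graph_seg z1 z2 : under_graph z1 ->
  seg z1 z2 `&` poly_boundary graph_polygon = set0 -> under_graph z2.
Proof.
move=> u1 empt; apply/depth_gt0; rewrite ltNge; apply/negP => le0.
pose phi t := depth ((1 - t) *: z1 + t *: z2).
set dx := `|xc z2 - xc z1|; set dy := `|yc z2 - yc z1|.
have min_lip (a b a' b' : R) : `|Num.min a b - Num.min a' b'| <= `|a - a'| + `|b - b'|.
  have := ler_norm (a - a'); have := ler_norm (b - b').
  have := ler_norm (a' - a); have := ler_norm (b' - b).
  rewrite (distrC a' a) (distrC b' b) => h1 h2 h3 h4.
  by rewrite !minEle; case: ifP; case: ifP => h5 h6; rewrite ler_norml; lra.
have xE t : xc ((1 - t) *: z1 + t *: z2) = xc z1 + t * (xc z2 - xc z1).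
  by rewrite /xc !mxE; ring.
have yE t : yc ((1 - t) *: z1 + t *: z2) = yc z1 + t * (yc z2 - yc z1).
  by rewrite /yc !mxE; ring.
have lip (t t' : R) : 0 <= t <= 1 -> 0 <= t' <= 1 ->
    `|phi t - phi t'| <= ((2 + K) * dx + dy) * `|t - t'|.
  move=> _ _; rewrite /phi /depth !xE !yE.
  have E1 : `|xc z1 + t * (xc z2 - xc z1) - (xc z1 + t' * (xc z2 - xc z1))| = `|t - t'| * dx.
    by rewrite -normrM; congr `|_|; ring.
  have E2 : `|yc z1 + t * (yc z2 - yc z1) - (yc z1 + t' * (yc z2 - yc z1))| = `|t - t'| * dy.
    by rewrite -normrM; congr `|_|; ring.
  set x := xc z1 + _; set x' := (_ + t' * _) in E1 *.
  set y := yc z1 + _; set y' := (_ + t' * _) in E2 *.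
  rewrite -/x in E1; rewrite -/y in E2.
  apply: le_trans (min_lip _ _ _ _) _.
  have h1 := min_lip x (W - x) x' (W - x').
  have E3 : `|W - x - (W - x')| = `|t - t'| * dx.
    by rewrite -E1 -normrN; congr `|_|; ring.
  have h2 : `|H x - `|y| - (H x' - `|y'|)| <= K * (`|t - t'| * dx) + `|t - t'| * dy.
    have -> : H x - `|y| - (H x' - `|y'|) = (H x - H x') - (`|y| - `|y'|) by ring.
    apply: le_trans (ler_normB _ _) _; rewrite lerD //; first by rewrite -E1.
    by rewrite -E2; apply: ler_dist_dist.
  rewrite E1 E3 in h1; nra.
have [t t01 phit] := lipschitz_ivt lip
  (ltac:(rewrite /phi subr0 scale1r scale0r addr0; apply/depth_gt0; exact: u1))
  (ltac:(rewrite /phi subrr scale0r scale1r add0r; exact: le0)).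
have : (seg z1 z2 `&` poly_boundary graph_polygon) ((1 - t) *: z1 + t *: z2).
  by split; [exists t | apply: depth_eq0].
by rewrite empt.
Qed.

Lemma under_graph_path s z : under_graph z ->
  polyset (z :: s) `&` poly_boundary graph_polygon = set0 -> under_graph (last z s).
Proof.
elim: s z => [//|z' s IH] z uz empt /=; apply: IH.
  apply: under_graph_seg uz _; rewrite -subset0 -empt => w [sw bw]; split=> //.
  by exists 0%N.
rewrite -subset0 -empt => w [[j [lt_j sj]] bw]; split=> //.
by exists j.+1.
Qed.

(** A polygonal path that avoids the boundary cannot leave the bounded region under the graph. A
    point that is neither there nor on the boundary escapes vertically, away from the axis. *)
Lemma graph_polygon_interior : poly_interior graph_polygon = under_graph.
Proof.
have W0 := width_gt0; apply/seteqP; split=> z.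
  move=> [nb [B bound]]; apply: boolp.contrapT => nu.
  have [e [eyE [e2 eN]]] : exists e : R, e * yc z = `|yc z| /\ e * e = 1 /\ `|e| = 1.
    have [y0|y0] := leP 0 (yc z).
      by exists 1; rewrite normr1 !mul1r ger0_norm.
    by exists (- 1); rewrite normrN normr1 mulrNN mulr1 mulN1r ltr0_norm.
  (* [T] is at least the height of [z], so the segment leads away from the axis, and at least [B],
     so it ends too far out. *)
  have [T TE] : exists T, T = `|B| + `|yc z| by exists (`|B| + `|yc z|).
  have : edist 0 (pt2 (xc z) (e * T)) < B.
    apply: (bound [:: pt2 (xc z) (e * T)]); rewrite -subset0 => w [[j [jlt sw]] bw].
    have {jlt}j0 : j = 0%N by move: jlt => /=; lia.
    move: sw; rewrite {}j0 /= seg2P !pt2E => -[t [/andP[t0 t1] [xw yw]]].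
    have xwz : xc w = xc z by rewrite xw; ring.
    have T_ge : `|yc z| <= T by rewrite TE lerDr normr_ge0.
    have yw' : e * yc w = (1 - t) * `|yc z| + t * T.
      by rewrite yw -eyE; transitivity ((1 - t) * (e * yc z) + t * ((e * e) * T)); [ring | rewrite e2; ring].
    have yzw : `|yc z| <= `|yc w|.
      have : e * yc w <= `|yc w|.
        by apply: le_trans (ler_norm _) _; rewrite normrM eN mul1r.
      by nra.
    apply: nb; apply/graph_boundaryP.
    have /graph_boundaryP[xW bw'] := bw; rewrite xwz in xW bw'.
    have yH : `|yc z| <= H (xc z) by case: bw' => [<-|[_]] //; apply: le_trans.
    split=> //; have [e'|ne] := eqVneq `|yc z| (H (xc z)); first by left.
    right; split=> //.
    have [->|nx0] := eqVneq (xc z) 0; first by left.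
    have [->|nxW] := eqVneq (xc z) W; first by right.
    case: nu; split; last by rewrite lt_neqAle ne.
    by case/andP: xW => ? ?; rewrite !lt_neqAle nxW eq_sym nx0; apply/andP.
  have : `|e * T| <= edist 0 (pt2 (xc z) (e * T)).
    rewrite -ler_sqr ?nnegrE ?edist_ge0 // edist2_sqrE !pt2E real_normK ?num_real //.
    by rewrite /yc mxE sub0r sqrrN lerDr sqr_ge0.
  have T0 : 0 <= T by rewrite TE addr_ge0 ?normr_ge0.
  rewrite normrM eN mul1r (ger0_norm T0) TE.
  by have := ler_norm B; have := normr_ge0 (yc z); lra.
move=> uz; split.
  move=> /graph_boundaryP[_]; case: uz => xW yH [|[]]; first by lra.
  by case=> h; lra.
exists (W + (H 0 + K * W) + 1) => s empt.
have [xW yH] := under_graph_path uz empt.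
set w := last z s in xW yH *.
have hH : H (xc w) <= H 0 + K * W by apply: breakpoint_width_bound; lra.
have := normr_ge0 (yc w); set m := `|yc w| in yH * => m0.
suff : edist 0 w <= xc w + m by lra.
rewrite -ler_sqr ?nnegrE ?edist_ge0 //; last by lra.
have x0 : xc (0 : 'rV[R]_2) = 0 by rewrite /xc mxE.
have y0 : yc (0 : 'rV[R]_2) = 0 by rewrite /yc mxE.
have mE : m ^+ 2 = yc w ^+ 2 by rewrite /m real_normK ?num_real.
rewrite edist2_sqrE x0 y0; nra.
Qed.

End GraphPolygon.

(** * Piecewise linear interpolation *)

Section PiecewiseLinear.
Variable R : realType.
Variables (bx bh : nat -> R).

Definition slope a := (bh a.+1 - bh a) / (bx a.+1 - bx a).
Definition clamp a x := Num.min (Num.max x (bx a)) (bx a.+1) - bx a.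
(** A sum of ramps, each constant outside its own piece: it is defined and Lipschitz on the whole
    line, without any choice of the piece that contains [x]. *)
Definition pl m x := bh 0%N + \sum_(a < m) slope a * clamp a x.

Lemma pl_lip m (x x' : R) : `|pl m x - pl m x'| <= (\sum_(a < m) `|slope a|) * `|x - x'|.
Proof.
have clamp_lip a : `|clamp a x - clamp a x'| <= `|x - x'|.
  have h1 := ler_norm (x - x'); have h2 := ler_norm (x' - x).
  rewrite distrC in h2; have h0 := normr_ge0 (x - x').
  have opp : clamp a x - clamp a x' = Num.min (Num.max x (bx a)) (bx a.+1)
     - Num.min (Num.max x' (bx a)) (bx a.+1) by rewrite /clamp; ring.
  rewrite opp ler_norml.
  have [p1|p1] := leP x (bx a); have [p2|p2] := leP x' (bx a);
   [have [p3|p3] := leP (bx a) (bx a.+1)|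
    have [p3|p3] := leP (bx a) (bx a.+1); have [p4|p4] := leP x' (bx a.+1)|
    have [p3|p3] := leP (bx a) (bx a.+1); have [p4|p4] := leP x (bx a.+1)|
    have [p3|p3] := leP x (bx a.+1); have [p4|p4] := leP x' (bx a.+1)]; lra.
have -> : pl m x - pl m x' = \sum_(a < m) slope a * (clamp a x - clamp a x').
  rewrite /pl opprD addrACA subrr add0r -sumrB; apply: eq_bigr => a _; ring.
apply: le_trans (ler_norm_sum _ _ _) _; rewrite mulr_suml.
apply: ler_sum => a _; rewrite normrM; apply: ler_wpM2l => //; exact: normr_ge0.
Qed.

Variable M : nat.
Hypothesis bx_mono : forall a, (a < M)%N -> bx a < bx a.+1.

(** The constancy to the right of the last breakpoint carries the induction: the next ramp starts
    there and contributes nothing to its left. *)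
Lemma pl_spec m : (m <= M)%N ->
  (forall x, bx m <= x -> pl m x = bh m) /\
  (forall a x, (a < m)%N -> bx a <= x <= bx a.+1 -> pl m x = bh a + slope a * (x - bx a)).
Proof.
elim: m => [|m IH] mM; first by split=> [x _|//]; rewrite /pl big_ord0 addr0.
have [IH1 IH2] := IH (ltnW mM); have lt_m := bx_mono mM.
have ple x : pl m.+1 x = pl m x + slope m * clamp m x by rewrite /pl big_ord_recr addrA.
have clamp0 x : x <= bx m -> clamp m x = 0.
  by move=> xm; rewrite /clamp max_r // min_l ?subrr // ltW.
have bx_ub b a : (a < b)%N -> (b <= m)%N -> bx a.+1 <= bx b.
  elim: b => [//|b IHb] ab bM.
  move: ab; rewrite ltnS leq_eqVlt => /orP[/eqP -> //|ab].
  by apply: le_trans (IHb ab (ltnW bM)) _; apply/ltW/bx_mono; lia.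
split=> [x xm|a x].
  rewrite ple IH1; last by lra.
  rewrite /clamp max_l; last by lra.
  by rewrite min_r // /slope divfK ?subr_eq0 ?gt_eqF // addrC subrK.
rewrite ltnS leq_eqVlt => /orP[/eqP -> /andP[x1 x2]|am xa].
  by rewrite ple IH1 // /clamp max_l // min_l.
rewrite ple clamp0 ?mulr0 ?addr0; first exact: IH2.
by case/andP: xa => _ /le_trans; apply; apply: bx_ub (leqnn m).
Qed.

Lemma pl_piece a x : (a < M)%N -> bx a <= x <= bx a.+1 ->
  pl M x = bh a + slope a * (x - bx a).
Proof. by move=> aM; apply: (pl_spec (leqnn M)).2. Qed.

Lemma pl_vertex a : (a <= M)%N -> pl M (bx a) = bh a.
Proof.
rewrite leq_eqVlt => /orP[/eqP -> |aM]; first by rewrite (pl_spec (leqnn M)).1.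
by rewrite (pl_piece aM) ?subrr ?mulr0 ?addr0 // lexx ltW ?bx_mono.
Qed.

Lemma pl_interp a x : (a < M)%N -> bx a <= x <= bx a.+1 ->
  pl M x * (bx a.+1 - bx a) = bh a * (bx a.+1 - x) + bh a.+1 * (x - bx a).
Proof.
move=> aM xa; rewrite (pl_piece aM xa).
have d0 : bx a.+1 - bx a != 0 by rewrite subr_eq0 gt_eqF ?bx_mono.
by rewrite /slope; field.
Qed.

Hypothesis M_gt0 : (0 < M)%N.

Lemma pl_ub u v x : (forall a, (a <= M)%N -> bh a <= u * bx a + v) ->
  bx 0%N <= x <= bx M -> pl M x <= u * x + v.
Proof.
move=> ub xM; have [a aM xa] := breakpoint_piece M_gt0 xM.
have lt_a := bx_mono aM; have E := pl_interp aM xa.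
have h1 := ub _ (ltnW aM); have h2 := ub _ aM.
rewrite -(ler_pM2r (_ : 0 < bx a.+1 - bx a)); last by lra.
rewrite E; case/andP: xa => xa1 xa2; nra.
Qed.

Lemma pl_lb v x : (forall a, (a <= M)%N -> v <= bh a) ->
  bx 0%N <= x <= bx M -> v <= pl M x.
Proof.
move=> lb xM; have [a aM xa] := breakpoint_piece M_gt0 xM.
have lt_a := bx_mono aM; have E := pl_interp aM xa.
have h1 := lb _ (ltnW aM); have h2 := lb _ aM.
rewrite -(ler_pM2r (_ : 0 < bx a.+1 - bx a)); last by lra.
rewrite E; case/andP: xa => xa1 xa2; nra.
Qed.

End PiecewiseLinear.

(** * Surfaces of convex polytopes *)

Section PolylineLength.
Variables (R : realType) (d : nat).
Implicit Types (x y : 'rV[R]_d) (s : seq 'rV[R]_d).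

Lemma plen_cons x y s : plen [:: x, y & s] = edist x y + plen (y :: s).
Proof. by rewrite /plen /= big_ord_recl. Qed.

Lemma plen1 x : plen [:: x] = 0.
Proof. by rewrite /plen big_ord0. Qed.

Lemma polyset_cons x y s z : polyset [:: x, y & s] z <-> seg x y z \/ polyset (y :: s) z.
Proof.
split=> [[[|j] [lt_j zj]]|[zxy|[j [lt_j zj]]]]; first by left.
- by right; exists j.
- by exists 0%N.
- by exists j.+1.
Qed.

Lemma seg_left x y : seg x y x.
Proof. by exists 0; rewrite subr0 scale1r scale0r addr0; split; [lra|]. Qed.

Lemma seg_right x y : seg x y y.
Proof. by rewrite segC; apply: seg_left. Qed.

(** The condition concerns only segments inside the path, because the maps it is applied to are
    controlled on single facets only. *)
Lemma edist_path_le (e : nat) (phi : 'rV[R]_d -> 'rV[R]_e) x s :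
  (forall y z, seg y z `<=` polyset (x :: s) -> edist (phi y) (phi z) <= edist y z) ->
  edist (phi x) (phi (last x s)) <= plen (x :: s).
Proof.
elim: s x => [|y s IH] x iso; first by rewrite plen1 edistxx.
rewrite plen_cons; apply: le_trans (edist_triangle (phi y) _ _) _; rewrite lerD //.
  by apply: iso => w ?; apply/polyset_cons; left.
by apply: IH => a b sub; apply: iso => w /sub ?; apply/polyset_cons; right.
Qed.

Lemma edist_le_plen x s : edist x (last x s) <= plen (x :: s).
Proof. exact: (@edist_path_le _ id). Qed.

Lemma plen_through x s w : polyset (x :: s) w ->
  edist x w + edist w (last x s) <= plen (x :: s).
Proof.
elim: s x => [|y s IH] x; first by case=> j [].
rewrite plen_cons => /polyset_cons[/seg_edist <-|/IH h] /=.
  rewrite -addrA lerD2l; apply: le_trans (edist_triangle y _ _) _.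
  by rewrite lerD2l edist_le_plen.
have := edist_triangle y x w; lra.
Qed.

End PolylineLength.

Section AffineFunctionals.
Variables (R : realType) (d : nat).
Implicit Types (n x y : 'rV[R]_d).

Definition affine n (o : R) x := (\sum_i n 0 i * x 0 i) + o.

Lemma affine_seg n o x y t :
  affine n o ((1 - t) *: x + t *: y) = (1 - t) * affine n o x + t * affine n o y.
Proof.
rewrite /affine !mulrDr !mulr_sumr.
rewrite (eq_bigr (fun i => (1 - t) * (n 0 i * x 0 i) + t * (n 0 i * y 0 i))).
  by rewrite big_split /=; ring.
by move=> i _; rewrite !mxE; ring.
Qed.

Lemma affine_lip n o x y : \sum_i n 0 i ^+ 2 = 1 ->
  `|affine n o x - affine n o y| <= edist x y.
Proof.
move=> n1; rewrite -ler_sqr ?nnegrE ?normr_ge0 ?edist_ge0 //.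
rewrite real_normK ?num_real // edist_sqrE -[leRHS]mul1r -n1.
apply: le_trans (cauchy_schwarz _ _); rewrite le_eqVlt; apply/orP; left; apply/eqP.
congr (_ ^+ 2); rewrite /affine opprD addrACA subrr addr0 -sumrB.
by apply: eq_bigr => i _; ring.
Qed.

Lemma affine_shift n o x e : \sum_i n 0 i ^+ 2 = 1 ->
  affine n o (x - e *: n) = affine n o x - e.
Proof.
move=> n1; rewrite /affine -[in RHS](mulr1 e) -n1 mulr_sumr addrAC -sumrB.
by congr (_ + _); apply: eq_bigr => i _; rewrite !mxE; ring.
Qed.

Lemma edist_shift n x e : \sum_i n 0 i ^+ 2 = 1 -> 0 <= e ->
  edist x (x - e *: n) = e.
Proof.
move=> n1 e0; rewrite /edist.
have -> : \sum_(i < d) (x 0 i - (x - e *: n) 0 i) ^+ 2 = e ^+ 2.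
  rewrite -[RHS]mulr1 -n1 mulr_sumr; apply: eq_bigr => i _; rewrite !mxE; ring.
by rewrite sqrtr_sqr ger0_norm.
Qed.

End AffineFunctionals.

(** Applied to the distances of a point from the facet planes: the zeros belong to the facets
    through the point, and the others stay away from it by a common amount. *)
Lemma finite_lower_bound (R : realType) (F : finType) (f : F -> R) :
  exists2 e, 0 < e & forall a, 0 < f a -> e <= f a.
Proof.
suff [e e0 he] : exists2 e, 0 < e & forall a, a \in enum F -> 0 < f a -> e <= f a.
  by exists e => // a; apply: he; rewrite mem_enum.
elim: (enum F) => [|b s [e e0 IH]]; first by exists 1.
have [fb|fb] := ltP 0 (f b); last first.
  by exists e => // a; rewrite inE => /orP[/eqP ->|/IH //]; rewrite ltNge fb.
exists (Num.min e (f b)); first by rewrite lt_min e0 fb.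
move=> a; rewrite inE => /orP[/eqP -> _|/IH h /h le_e]; first by rewrite ge_min lexx orbT.
by rewrite ge_min le_e.
Qed.

Section ConvexHull.
Variables (R : realType) (n : nat) (V : 'I_n -> 'rV[R]_3).

Lemma inQ_vertex i : inQ V (V i).
Proof.
exists (fun j => (j == i)%:R); split; first by move=> j; rewrite ler0n.
split; first by rewrite (bigD1 i) //= eqxx big1 ?addr0 // => j /negbTE ->.
by rewrite (bigD1 i) //= eqxx scale1r big1 ?addr0 // => j /negbTE ->; rewrite scale0r.
Qed.

Lemma inQ_seg x y z : inQ V x -> inQ V y -> seg x y z -> inQ V z.
Proof.
move=> [w [w0 [w1 ->]]] [w' [w0' [w1' ->]]] [t [/andP[t0 t1] ->]].
exists (fun i => (1 - t) * w i + t * w' i); split.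
  by move=> i; rewrite addr_ge0 ?mulr_ge0 ?subr_ge0.
split; first by rewrite big_split /= -!mulr_sumr w1 w1'; ring.
rewrite !scaler_sumr -big_split /=; apply: eq_bigr => i _.
by rewrite [in RHS]scalerDl !scalerA.
Qed.

Lemma affine_hull nv o (w : 'I_n -> R) : \sum_i w i = 1 ->
  affine nv o (\sum_i w i *: V i) = \sum_i w i * affine nv o (V i).
Proof.
move=> w1; rewrite /affine.
under [RHS]eq_bigr => i _ do rewrite mulrDr.
rewrite big_split /= -mulr_suml w1 mul1r; congr (_ + _).
under eq_bigr => j _ do rewrite summxE mulr_sumr.
rewrite exchange_big /=; apply: eq_bigr => i _; rewrite mulr_sumr.
by apply: eq_bigr => j _; rewrite !mxE; ring.
Qed.

Lemma inQ_affine_ge0 nv o x : (forall i, 0 <= affine nv o (V i)) -> inQ V x ->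
  0 <= affine nv o x.
Proof.
move=> pos [w [w0 [w1 ->]]]; rewrite affine_hull //.
by apply: sumr_ge0 => i _; rewrite mulr_ge0.
Qed.

(** Evaluating the functional at a convex combination without [V i] makes every term vanish, so all
    weights are 0, although their sum is 1. *)
Lemma extreme_vertex nv o i : affine nv o (V i) = 0 ->
  (forall j, j != i -> 0 < affine nv o (V j)) ->
  ~ exists w : 'I_n -> R, w i = 0 /\ (forall j, 0 <= w j) /\
        \sum_j w j = 1 /\ V i = \sum_j w j *: V j.
Proof.
move=> Vi0 pos [w [wi0 [w0 [w1 Vi]]]].
have : affine nv o (V i) = 0 by [].
rewrite {1}Vi affine_hull // => /eqP.
have A0 j : 0 <= affine nv o (V j).
  by have [->|/pos/ltW //] := eqVneq j i; rewrite Vi0.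
rewrite psumr_eq0; last by move=> j _; rewrite mulr_ge0.
move=> /allP all0.
have wz j : w j = 0.
  have [->//|ne] := eqVneq j i.
  have := all0 j (mem_index_enum _); rewrite /= mulf_eq0 [_ == 0 :> R in X in _ || X]gt_eqF ?pos //.
  by rewrite orbF => /eqP.
move: w1; rewrite big1 => [/eqP|j _]; last exact: wz.
by rewrite eq_sym oner_eq0.
Qed.

Variables (F : finType) (nv : F -> 'rV[R]_3) (off : F -> R).
Hypothesis nv_unit : forall a, \sum_i nv a 0 i ^+ 2 = 1.
Let A a := affine (nv a) (off a).
Hypothesis inQP : forall x, inQ V x <-> forall a, 0 <= A a x.

Lemma interior_ball p : (forall a, 0 < A a p) ->
  exists e, 0 < e /\ forall y, edist p y < e -> inQ V y.
Proof.
move=> pos; have [e e0 le_e] := finite_lower_bound (fun a => A a p).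
exists e; split=> // y ye; apply/inQP => a; have := le_e a (pos a).
have := affine_lip (off a) p y (nv_unit a); rewrite -/(A a) ler_norml.
by move=> /andP[_]; lra.
Qed.

Lemma surfP x : surf V x <-> (forall a, 0 <= A a x) /\ exists a, A a x = 0.
Proof.
split=> [[/inQP Qx out]|[Qx [a Aa]]]; split=> //.
- apply: boolp.contrapT => none.
  have [a|e [e0 ball]] := @interior_ball x.
    by rewrite lt_neqAle Qx andbT; apply/eqP => /esym Aa; apply: none; exists a.
  by have [y [/ball]] := out e e0.
- exact/inQP.
move=> e e0; exists (x - (e / 2) *: nv a); split; first by rewrite edist_shift //; lra.
by move/inQP/(_ a); rewrite /A affine_shift // -/(A a) Aa; lra.
Qed.

Lemma surf_seg a x y : surf V x -> surf V y -> A a x = 0 -> A a y = 0 ->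
  seg x y `<=` surf V.
Proof.
move=> /surfP[Qx _] /surfP[Qy _] ax ay z zxy; apply/surfP; split.
  by apply/inQP; apply: inQ_seg zxy; apply/inQP.
by case: zxy => t [_ ->]; exists a; rewrite /A affine_seg -/(A a) ax ay; ring.
Qed.

(* A segment in the surface whose midpoint lies on a facet lies in that facet, so a
   short path through q is cut by its vertices into pieces on which phi is isometric. *)
Lemma sdist_local (D : set 'rV[R]_3) (q : 'rV[R]_3) (phi : 'rV[R]_3 -> 'rV[R]_2) (e0 : R) :
  0 < e0 -> D `<=` surf V -> surf V q ->
  (forall a x y, A a q = 0 -> surf V x -> surf V y -> A a x = 0 -> A a y = 0 ->
     edist (phi x) (phi y) = edist x y) ->
  (forall x y, D x -> D y -> edist q x < e0 -> edist q y < e0 ->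
     exists s, surf_path V x y s /\ plen s = edist (phi x) (phi y)) ->
  exists e, 0 < e /\ forall x y, D x -> D y -> edist q x < e -> edist q y < e ->
    edist (phi x) (phi y) = sdist V x y.
Proof.
move=> e0_gt0 DS Sq iso join.
(* All facets that do not contain [q] are at distance at least [rho] from it. *)
have [rho rho0 le_rho] := finite_lower_bound (fun a => A a q).
have near x : surf V x -> edist q x < rho -> exists2 a, A a x = 0 & A a q = 0.
  move=> /surfP[_ [a Aa]] xr; exists a => //; apply: le_anti.
  rewrite ((surfP q).1 Sq).1 andbT leNgt; apply/negP => /le_rho.
  have := affine_lip (off a) q x (nv_unit a); rewrite -/(A a) Aa subr0.
  by have := ler_norm (A a q); lra.
exists (Num.min e0 (rho / 2)); split; first by rewrite lt_min e0_gt0 divr_gt0.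
move=> x y Dx Dy; rewrite !lt_min => /andP[qx0 qxr] /andP[qy0 qyr].
have Sx := DS _ Dx; have Sy := DS _ Dy.
have [s0 [path0 len0]] := join x y Dx Dy qx0 qy0.
have isoq z : surf V z -> edist q z < rho -> edist (phi q) (phi z) = edist q z.
  by move=> Sz /(near _ Sz)[a az aq]; apply: (iso a).
have close : edist (phi x) (phi y) <= edist q x + edist q y.
  apply: le_trans (edist_triangle (phi q) _ _) _.
  by rewrite [edist (phi x) _]edistC !isoq //; lra.
have lb : lbound [set plen s | s in surf_path V x y] (edist (phi x) (phi y)).
  move=> _ [[|x' s] [// _ [/= ex [ey sub]]] <-]; subst x' y.
  (* A path that reaches distance [rho] from [q] is longer than the detour from [x] over [q] to [y],
     both of which are within [rho / 2] of [q]. *)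
  have [far|nofar] := boolp.pselect (exists2 w, polyset (x :: s) w & rho <= edist q w).
    case: far => w ws wfar; apply: le_trans close _.
    apply: le_trans _ (plen_through ws).
    have := edist_triangle x q w; have := edist_triangle (last x s) q w.
    by rewrite [edist (last x s) w]edistC; move: qxr qyr; lra.
  apply: edist_path_le => p p' psub.
  have Sp z : seg p p' z -> surf V z by move=> /psub/sub.
  pose m := (1 - 2^-1) *: p + 2^-1 *: p'.
  have mp : seg p p' m by exists 2^-1; split=> //; lra.
  have m_near : edist q m < rho.
    by rewrite ltNge; apply/negP => h; apply: nofar; exists m => //; apply: psub.
  have [a am aq] := near _ (Sp _ mp) m_near.
  have S1 := Sp _ (seg_left _ _); have S2 := Sp _ (seg_right _ _).
  have ge1 := ((surfP p).1 S1).1 a; have ge2 := ((surfP p').1 S2).1 a.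
  move: am; rewrite /A affine_seg -!/(A a _) => am.
  by rewrite (iso a) //; lra.
apply/le_anti/andP; split.
  apply: lb_le_inf => //; by exists (plen s0), s0.
rewrite -len0; apply: ge_inf; last by exists s0.
by exists (edist (phi x) (phi y)).
Qed.

End ConvexHull.

(** * The base polygon and its pieces *)

Section Parabola.
Variables (R : realType) (g : nat).
Hypothesis g_gt1 : (1 < g)%N.
Implicit Types (x y : R) (i j l : nat).

Definition nsides := g.*2.
Definition nsidesR : R := nsides%:R.
(* Small enough for all slopes below to be at most 1/4 in absolute value. *)
Definition curv : R := (4 * nsidesR)^-1.

Lemma kr_ge4 : 4 <= nsidesR.
Proof. by rewrite /nsidesR /nsides (ler_nat R 4); lia. Qed.

Lemma cc_gt0 : 0 < curv.
Proof. by rewrite invr_gt0; have := kr_ge4; lra. Qed.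

Lemma cc_ge0 : 0 <= curv. Proof. exact: ltW cc_gt0. Qed.

Lemma cc_kr : curv * nsidesR = 4^-1.
Proof. by have := kr_ge4; rewrite /curv => h; field; lra. Qed.

Lemma cc_le : curv <= 16^-1.
Proof. by have := kr_ge4; have := cc_kr; have := cc_gt0; nra. Qed.

(* Edge i joins the vertices i and i + 1; the edges 2b and 2b + 1 meet at the vertex 2b + 1,
   below which diag is the chord between the two neighboring vertices and nrm = 0 the
   perpendicular to that chord. *)
Definition midv i := (i./2).*2.+1.
Definition vertex_y i : R := curv * (i%:R * (nsidesR - i%:R)).
Definition edge_slope i : R := curv * (nsidesR - 1 - 2 * i%:R).
Definition diag_slope j : R := curv * (nsidesR - 2 * j%:R).
Definition line i x : R := curv * ((nsidesR - 1 - 2 * i%:R) * x + i%:R * (i%:R + 1)).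
Definition diag j x : R := curv * ((nsidesR - 2 * j%:R) * x + j%:R ^+ 2 - 1).
Definition nrm j x y : R := (x - j%:R) + diag_slope j * (y - vertex_y j).

Definition inB x y := 0 <= y /\ forall i, (i < nsides)%N -> y <= line i x.

(* bet b tells whether the corner at the vertex 2b + 1 is cut off. Piece i < nsides of the base
   stays hinged to the side facet of edge i (it is just that edge if the corner is not cut
   off), and piece nsides to the facet of the chord. *)
Variable bet : nat -> bool.
Definition cut i x : R := if bet i./2 then diag (midv i) x else line i x.
(** The altitude at the corner separates its even edge, on the left, from its odd edge, on the
    right. *)
Definition side i x y : Prop := if odd i then 0 <= nrm (midv i) x y else nrm (midv i) x y <= 0.
Definition sside i x y : Prop := if odd i then 0 < nrm (midv i) x y else nrm (midv i) x y < 0.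

Definition piece i x y : Prop :=
  inB x y /\ if (i < nsides)%N then cut i x <= y /\ side i x y
             else forall l, (l < nsides)%N -> y <= cut l x.
(** Strict at the cuts but not at the hinge: these are the points of the piece off the cut tree. At
    a corner that is not cut off no point is strictly above [cut], so the piece has none. *)
Definition spiece i x y : Prop :=
  inB x y /\ if (i < nsides)%N then cut i x < y /\ sside i x y
             else forall l, (l < nsides)%N -> y < cut l x.
Definition cutarc i x y : Prop :=
  inB x y /\ (i < nsides)%N /\ y = cut i x /\ side i x y.
Definition stem b x y : Prop :=
  inB x y /\ (b < g)%N /\ bet b /\ nrm b.*2.+1 x y = 0 /\ diag b.*2.+1 x <= y.

Lemma natr_lt i l : (i < l)%N -> i%:R + 1 <= l%:R :> R.
Proof. by rewrite natr1 ler_nat. Qed.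

Lemma natr_kn i : (i < nsides)%N -> i%:R + 1 <= nsidesR. Proof. exact: natr_lt. Qed.

Lemma natr_bump b : (b.*2.+1)%:R = 2 * b%:R + 1 :> R.
Proof. by rewrite -natr1 -mul2n natrM. Qed.

Lemma natr_bumpS b : (b.*2.+2)%:R = 2 * b%:R + 2 :> R.
Proof. by rewrite -natr1 natr_bump; ring. Qed.

Lemma natr_dbl b : (b.*2)%:R = 2 * b%:R :> R.
Proof. by rewrite -mul2n natrM. Qed.

Lemma lineB i l x : line l x - line i x =
  curv * ((l%:R - i%:R) * (l%:R + i%:R + 1 - 2 * x)).
Proof. by rewrite /line; ring. Qed.

Lemma line_vertex i l : line i l%:R - vertex_y l = curv * ((l%:R - i%:R) * (l%:R - i%:R - 1)).
Proof. by rewrite /line /vertex_y; ring. Qed.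

Lemma line_diag_left b x : line b.*2 x - diag b.*2.+1 x = curv * (x - 2 * b%:R).
Proof. rewrite /line /diag natr_bump -mul2n natrM; ring. Qed.

Lemma line_diag_right b x : line b.*2.+1 x - diag b.*2.+1 x = curv * (2 * b%:R + 2 - x).
Proof. rewrite /line /diag natr_bump; ring. Qed.

(** Two consecutive integers never have opposite signs. *)
Lemma nat_diff i l : l != i -> 0 <= (l%:R - i%:R) * (l%:R - i%:R - 1) :> R.
Proof.
case: ltngtP => // [/natr_lt h|/natr_lt h] _; last by nra.
by rewrite -mulrNN; nra.
Qed.

Lemma inB_vertex l : (l <= nsides)%N -> inB l%:R (vertex_y l).
Proof.
move=> lk; split=> [|i ik].
  by rewrite /vertex_y mulr_ge0 ?cc_ge0 // mulr_ge0 ?ler0n // subr_ge0 /nsidesR ler_nat.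
rewrite -subr_ge0 line_vertex mulr_ge0 ?cc_ge0 //.
by have [->|/nat_diff//] := eqVneq l i; rewrite subrr mul0r.
Qed.

Lemma inB_x x y : inB x y -> 0 <= x <= nsidesR.
Proof.
move=> [y0 yl]; have h0 := yl 0%N ltac:(rewrite /nsides; lia).
have h1 := yl nsides.-1 ltac:(rewrite /nsides; lia).
have kE : nsides.-1%:R = nsidesR - 1 :> R by apply/(canRL (addrK _)); rewrite natr1 prednK // /nsides; lia.
have := cc_gt0; have := kr_ge4; move: h0 h1; rewrite /line kE mulr0n => h0 h1 k4 c0.
have e0 : 0 <= (nsidesR - 1 - 2 * 0) * x + 0 * (0 + 1) by rewrite -(pmulr_rge0 _ c0); lra.
have e1 : 0 <= (nsidesR - 1 - 2 * (nsidesR - 1)) * x + (nsidesR - 1) * (nsidesR - 1 + 1)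
  by rewrite -(pmulr_rge0 _ c0); lra.
by apply/andP; split; nra.
Qed.

(** Only the neighboring lines matter: [line i.+1 - line i] changes sign at [i + 1], so outside this
    interval a neighbor is lower than line [i]. *)
Lemma line_range i x y : inB x y -> (i < nsides)%N -> line i x <= y -> i%:R <= x <= i%:R + 1.
Proof.
move=> Bxy ik ly; have [y0 yl] := Bxy; have /andP[x0 xk] := inB_x Bxy; have c0 := cc_gt0.
apply/andP; split.
  case: i ik ly => [|i] ik ly; first by rewrite mulr0n.
  have := yl i (ltnW ik); rewrite -subr_ge0 => h.
  have : 0 <= line i x - line i.+1 x by lra.
  by rewrite lineB (pmulr_rge0 _ c0) -natr1; lra.
have [ik'|ik'] := ltnP i.+1 nsides; last first.
  have : nsides%:R <= i.+1%:R :> R by rewrite ler_nat.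
  by rewrite -/nsidesR -natr1; lra.
have := yl i.+1 ik'; rewrite -subr_ge0 => h.
have : 0 <= line i.+1 x - line i x by lra.
by rewrite lineB (pmulr_rge0 _ c0) -natr1; lra.
Qed.

Lemma half_lt i : (i < nsides)%N -> (i./2 < g)%N.
Proof. by rewrite /nsides; lia. Qed.

Lemma natr_half i : i%:R = (odd i)%:R + 2 * (i./2)%:R :> R.
Proof. by rewrite -{1}(odd_double_half i) natrD -mul2n natrM. Qed.

Lemma midv_le i : (i < nsides)%N -> (midv i <= nsides)%N.
Proof. by rewrite /midv /nsides; lia. Qed.

Lemma line_diag i x : line i x - diag (midv i) x =
  curv * (if odd i then 2 * (i./2)%:R + 2 - x else x - 2 * (i./2)%:R).
Proof.
rewrite /midv; have := odd_double_half i; case: (odd i) => /= e.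
  by rewrite -{1}e add1n line_diag_right.
by rewrite -{1}e add0n line_diag_left.
Qed.

Lemma sl_bound i : (i < nsides)%N -> - 4^-1 <= edge_slope i <= 4^-1.
Proof.
move=> /natr_kn h; have i0 : 0 <= i%:R :> R by rewrite ler0n.
by have := cc_kr; have := cc_gt0; rewrite /edge_slope => c0 ck; apply/andP; split; nra.
Qed.

Lemma mu_bound j : (j <= nsides)%N -> - 4^-1 <= diag_slope j <= 4^-1.
Proof.
move=> h; have i0 : 0 <= j%:R :> R by rewrite ler0n.
have {}h : j%:R <= nsidesR by rewrite ler_nat.
by have := cc_kr; have := cc_gt0; rewrite /diag_slope => c0 ck; apply/andP; split; nra.
Qed.

(** The inner product of the directions [(1, diag_slope)] and [(1, edge_slope)] of the chord and the
    edge. It is positive since both slopes are small. *)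
Definition edge_den i := 1 + diag_slope (midv i) * edge_slope i.

Lemma den_gt i : (i < nsides)%N -> 2^-1 < edge_den i.
Proof.
move=> ik; have /andP[a1 a2] := sl_bound ik; have /andP[b1 b2] := mu_bound (midv_le ik).
by rewrite /edge_den; nra.
Qed.

Lemma line_midv i x : line i x = vertex_y (midv i) + edge_slope i * (x - (midv i)%:R).
Proof.
rewrite /line /vertex_y /edge_slope natr_bump; rewrite (natr_half i); case: (odd i) => /=; ring.
Qed.

(** The ear at the vertex 2b + 1, whether or not it is cut off. *)
Definition cap b x y := inB x y /\ diag b.*2.+1 x <= y.

Lemma cap_x b x y : (b < g)%N -> cap b x y -> 2 * b%:R <= x <= 2 * b%:R + 2.
Proof.
move=> bg [[y0 yl] dy]; have c0 := cc_gt0.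
have h1 := yl b.*2 ltac:(rewrite /nsides; lia); have h2 := yl b.*2.+1 ltac:(rewrite /nsides; lia).
have d1 := line_diag_left b x; have d2 := line_diag_right b x.
have e1 : 0 <= curv * (x - 2 * b%:R) by lra.
have e2 : 0 <= curv * (2 * b%:R + 2 - x) by lra.
by rewrite !(pmulr_rge0 _ c0) in e1 e2; lra.
Qed.

(** The ears lie over the intervals from 2b to 2b + 2. At a common end of two of these, the chord
    and the edge line take the same value and thus determine [y]. *)
Lemma cap_inter b b' x y : (b < b')%N -> (b' < g)%N -> cap b x y -> cap b' x y ->
  [/\ b' = b.+1, x = (b.*2.+2)%:R & y = vertex_y b.*2.+2].
Proof.
move=> bb' b'g cb cb'; have bg := ltn_trans bb' b'g.
have /andP[_ h1] := cap_x bg cb; have /andP[h2 _] := cap_x b'g cb'.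
have h3 := natr_lt bb'.
have xE : x = (b.*2.+2)%:R by rewrite natr_bumpS; lra.
split=> //.
  by apply/eqP; rewrite eqn_leq bb' andbT -(ler_nat R) -natr1; lra.
case: cb => [[y0 yl] dy]; have := yl b.*2.+1 ltac:(rewrite /nsides; lia).
have := line_diag_right b x; have := line_vertex b.*2.+1 b.*2.+2.
rewrite -xE (_ : 2 * b%:R + 2 - x = 0) ?mulr0; last by rewrite xE natr_bumpS; ring.
have -> : (x - b.*2.+1%:R) * (x - b.*2.+1%:R - 1) = 0.
  by rewrite xE natr_bumpS natr_bump; ring.
rewrite mulr0; lra.
Qed.

Lemma edge_side i x y : inB x y -> (i < nsides)%N -> line i x <= y ->
  [/\ y = line i x, cap i./2 x y & side i x y].
Proof.
move=> Bxy ik ly; have xi := line_range Bxy ik ly.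
have yE : y = line i x by apply/le_anti; rewrite ly andbT; apply: Bxy.2.
have nE : nrm (midv i) x y = (x - (midv i)%:R) * edge_den i.
  by rewrite /nrm yE line_midv /edge_den; ring.
have d0 := den_gt ik; have := line_diag i x; have c0 := cc_gt0.
rewrite (natr_half i) in xi.
split=> //; rewrite /side ?nE.
  split=> //; move: H xi; rewrite -/(midv i) yE; case: (odd i) => /= E xi.
    have : 0 <= curv * (2 * i./2%:R + 2 - x) by rewrite mulr_ge0 ?cc_ge0 //; lra.
    lra.
  have : 0 <= curv * (x - 2 * i./2%:R) by rewrite mulr_ge0 ?cc_ge0 //; lra.
  lra.
move: xi; rewrite natr_bump; case: (odd i) => /= xi; nra.
Qed.

Lemma cut_cap i x y : inB x y -> (i < nsides)%N -> cut i x <= y -> cap i./2 x y.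
Proof.
move=> Bxy ik; rewrite /cut; case: ifP => _ h; first by split.
by have [] := edge_side Bxy ik h.
Qed.

Lemma piece_cover x y : inB x y -> exists2 i, (i <= nsides)%N & piece i x y.
Proof.
move=> Bxy; have [below|] := boolp.pselect (forall l, (l < nsides)%N -> y <= cut l x).
  by exists nsides; rewrite ?leqnn // /piece ltnn.
move=> /boolp.existsNP[l /boolp.not_implyP[lk /negP]]; rewrite -ltNge => ly.
have bl : bet l./2.
  by move: ly; rewrite /cut; case: ifP => // _; rewrite ltNge Bxy.2.
move: ly; rewrite /cut bl => /ltW ly; have lg := half_lt lk.
have [n0|/ltW n0] := leP 0 (nrm (midv l) x y).
  exists (l./2.*2.+1); first by rewrite /nsides; lia.
  rewrite /piece /cut /side /midv /= uphalf_double odd_double /= bl ifT //.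
  by rewrite /nsides; lia.
exists (l./2.*2); first by rewrite /nsides; lia.
rewrite /piece /cut /side /midv /= doubleK odd_double /= bl ifT //.
by rewrite /nsides; lia.
Qed.

Lemma stem_piece b x y : stem b x y -> piece b.*2 x y /\ piece b.*2.+1 x y.
Proof.
move=> [Bxy [bg [bb [n0 dy]]]]; rewrite /piece /cut /side /midv /=.
rewrite doubleK uphalf_double odd_double /= bb n0 !ifT //; rewrite /nsides; lia.
Qed.

Lemma arc_piece i x y : cutarc i x y -> piece i x y.
Proof. by move=> [Bxy [ik [ye s]]]; split=> //; rewrite ik -ye. Qed.

(** An inequality of [piece] that is not strict puts the point on the cut itself: equality with
    [cut] on an arc, equality with the altitude on a stem. *)
Lemma piece_cases i x y : (i <= nsides)%N -> piece i x y ->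
  [\/ spiece i x y, exists2 l, (l < nsides)%N & cutarc l x y | exists2 b, (b < g)%N & stem b x y].
Proof.
move=> ik [Bxy]; case: ifPn => [{}ik [cy s]|nik below].
  have [cy'|cy'] := ltP (cut i x) y; last first.
    constructor 2; exists i => //; split=> //; split=> //; split=> //.
    by apply/le_anti/andP.
  have bi : bet i./2.
    by move: cy'; rewrite /cut; case: ifP => // _; rewrite ltNge Bxy.2.
  have [n0|n0] := eqVneq (nrm (midv i) x y) 0.
    constructor 3; exists i./2; first exact: half_lt.
    by split=> //; split; [exact: half_lt | split=> //; split=> //; move: cy; rewrite /cut bi].
  constructor 1; split=> //; rewrite ik; split=> //.
  by move: s; rewrite /side /sside; case: ifP => _ h; rewrite lt_neqAle h andbT // eq_sym.
have [sbelow|] := boolp.pselect (forall l, (l < nsides)%N -> y < cut l x).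
  by constructor 1; split=> //; rewrite (negbTE nik).
move=> /boolp.existsNP[l /boolp.not_implyP[lk /negP]]; rewrite -leNgt => ly.
have ye : y = cut l x by apply/le_anti; rewrite ly below.
constructor 2; case bl: (bet l./2); last first.
  exists l => //; split=> //; split=> //; split=> //.
  by move: ly; rewrite /cut bl => /(edge_side Bxy lk)[].
have lg := half_lt lk.
have [n0|/ltW n0] := leP 0 (nrm (midv l) x y).
  exists (l./2.*2.+1); first by rewrite /nsides; lia.
  split=> //; split; first by rewrite /nsides; lia.
  by move: ye; rewrite /cut /side /midv /= uphalf_double odd_double /= bl => ye; split.
exists (l./2.*2); first by rewrite /nsides; lia.
split=> //; split; first by rewrite /nsides; lia.
by move: ye; rewrite /cut /side /midv /= doubleK odd_double /= bl => ye; split.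
Qed.

(** Below all cuts only the piece of the chord is possible; within an ear the altitude decides
    between its two edges; distinct ears share at most a vertex. *)
Lemma spiece_uniq i i' x y : (i <= nsides)%N -> (i' <= nsides)%N ->
  spiece i x y -> piece i' x y -> i = i'.
Proof.
rewrite leq_eqVlt => /orP[/eqP -> i'k|ik].
  rewrite /spiece ltnn => -[Bxy below] [_]; case: ifPn => [lt_i' [h _]|]; last by lia.
  by exfalso; have := below _ lt_i'; lra.
move=> i'k [Bxy]; rewrite ik => -[cy ss] [_]; case: ifPn => [lt_i' [h s]|_ below].
  have c1 := cut_cap Bxy ik (ltW cy); have c2 := cut_cap Bxy lt_i' h.
  have [e|ne] := eqVneq i./2 i'./2.
    have eb : midv i = midv i' by rewrite /midv e.
    move: ss s; rewrite /sside /side -eb.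
    case oi: (odd i); case oi': (odd i') => h1 h2;
      by [rewrite -(odd_double_half i) -(odd_double_half i') e oi oi' | exfalso; lra].
  have bi : bet i./2.
    by move: cy; rewrite /cut; case: ifP => // _; rewrite ltNge Bxy.2.
  (* The common vertex of two ears lies on the chords of both, so it is not strictly above
     either. *)
  have ex b : x = (b.*2.+2)%:R -> y = vertex_y b.*2.+2 -> (b = i./2) \/ (b.+1 = i./2) ->
      y <= diag (i./2.*2.+1) x.
    move=> -> -> [->|<-].
      have := line_diag_right i./2 (i./2.*2.+2)%:R.
      have := line_vertex (i./2.*2.+1) (i./2.*2.+2).
      by rewrite natr_bumpS natr_bump => h1 h2; nra.
    have := line_diag_left b.+1 (b.*2.+2)%:R.
    have := line_vertex (b.+1.*2) (b.*2.+2).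
    rewrite doubleS subrr mul0r mulr0 natr_bumpS -natr1 => h1 h2; nra.
  exfalso; move: cy; rewrite /cut bi ltNge => /negP; apply.
  have [hi hi'] := (half_lt ik, half_lt lt_i').
  case: (ltngtP i./2 i'./2) ne => // lt_b _.
    by have [_ x1 y1] := cap_inter lt_b hi' c1 c2; apply: ex x1 y1 _; left.
  by have [e x1 y1] := cap_inter lt_b hi c2 c1; apply: ex x1 y1 _; right.
exfalso; have := below _ ik; lra.
Qed.

Lemma ty_ge0 l : (l <= nsides)%N -> 0 <= vertex_y l.
Proof. by move=> /inB_vertex[]. Qed.

(** Over the ear the chord interpolates the heights of two vertices, which are nonnegative, and all
    other edge lines lie above one of the two edges of the ear. *)
Lemma cap_inB b x y : (b < g)%N -> diag b.*2.+1 x <= y ->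
  y <= line b.*2 x -> y <= line b.*2.+1 x -> inB x y.
Proof.
move=> bg dy y1 y2; have c0 := cc_gt0.
have d1 := line_diag_left b x; have d2 := line_diag_right b x.
have x1 : 0 <= curv * (x - 2 * b%:R) by lra.
have x2 : 0 <= curv * (2 * b%:R + 2 - x) by lra.
rewrite !(pmulr_rge0 _ c0) in x1 x2; split.
  have t1 := @ty_ge0 b.*2 ltac:(rewrite /nsides; lia).
  have t2 := @ty_ge0 b.*2.+2 ltac:(rewrite /nsides; lia).
  have : 2 * diag b.*2.+1 x = (2 * b%:R + 2 - x) * vertex_y b.*2 + (x - 2 * b%:R) * vertex_y b.*2.+2.
    by rewrite /diag /vertex_y natr_bump natr_bumpS natr_dbl; ring.
  by nra.
move=> l lk; have [h|] := leqP l b.*2.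
  apply: le_trans y1 _; rewrite -subr_ge0 lineB natr_dbl mulr_ge0 ?cc_ge0 //.
  move: h; rewrite leq_eqVlt => /orP[/eqP ->|/natr_lt]; first by rewrite natr_dbl; lra.
  by rewrite natr_dbl; nra.
move=> h; apply: le_trans y2 _; rewrite -subr_ge0 lineB natr_bump mulr_ge0 ?cc_ge0 //.
move: h; rewrite leq_eqVlt => /orP[/eqP <-|/natr_lt]; first by rewrite natr_bump; lra.
by rewrite natr_bump; nra.
Qed.

(** Both edge lines pass through the corner, with slopes [diag_slope + curv] and
    [diag_slope - curv], and line [i] is the lower one on its own side of the vertical through the
    corner. The altitude is only nearly vertical; the small slopes settle the wedge between it and
    that vertical. *)
Lemma partner_edge i x y : (i < nsides)%N -> side i x y -> y <= line i x ->
  y <= line (i./2.*2) x /\ y <= line (i./2.*2.+1) x.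
Proof.
move=> ik; have /andP[m1 m2] := mu_bound (midv_le ik); have c0 := cc_gt0; have c1 := cc_le.
rewrite /side /nrm.
have l0 : line i./2.*2 x = vertex_y (midv i) + (diag_slope (midv i) + curv) * (x - (midv i)%:R).
  rewrite line_midv /midv doubleK; congr (_ + _ * _).
  by rewrite /edge_slope /diag_slope natr_bump natr_dbl; ring.
have l1 : line i./2.*2.+1 x = vertex_y (midv i) + (diag_slope (midv i) - curv) * (x - (midv i)%:R).
  rewrite line_midv /midv /= uphalf_double; congr (_ + _ * _).
  by rewrite /edge_slope /diag_slope natr_bump; ring.
have e := odd_double_half i; have iE : line i x = if odd i then line i./2.*2.+1 x else line i./2.*2 x.
  by rewrite -{1}e; case: (odd i).
rewrite iE l0 l1; set u := x - _; set v := y - vertex_y _; set t := vertex_y _; set M := diag_slope _.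
have -> : y = v + t by rewrite /v subrK.
clearbody u v t M.
case: (odd i) => n0 h; split=> //.
  have [u0|u0] := leP 0 u; first by nra.
  have [M0|M0] := leP 0 M.
    have [v0|v0] := leP v 0; last by nra.
    by nra.
  have [v0|v0] := leP v 0; last by nra.
  by nra.
have [u0|u0] := leP u 0; first by nra.
have [M0|M0] := leP 0 M.
  have [v0|v0] := leP v 0; last by nra.
  by nra.
have [v0|v0] := leP v 0; last by nra.
by nra.
Qed.

(** Over its own interval [cut l] is the lowest of all cuts, so a single inequality decides. *)
Lemma spiece_chord l x y : (l < nsides)%N -> l%:R <= x <= l%:R + 1 -> 0 <= y -> y < cut l x ->
  spiece nsides x y.
Proof.
move=> lk /andP[x1 x2] y0 ycut.
have c0 := cc_gt0; have lg := half_lt lk.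
have lineT i : line l x <= line i x.
  rewrite -subr_ge0 lineB mulr_ge0 ?cc_ge0 //.
  case: (ltngtP i l) => [/natr_lt h|/natr_lt h|->]; last by rewrite subrr mul0r.
    by rewrite -mulrNN; nra.
  by nra.
have lh := natr_half l.
have o1 : (odd l)%:R <= 1 :> R by case: (odd l); rewrite ?lexx ?ler01.
have o0 : 0 <= (odd l)%:R :> R by rewrite ler0n.
have cut_line : cut l x <= line l x.
  rewrite /cut; case: ifP => // _; rewrite -subr_ge0 line_diag mulr_ge0 ?cc_ge0 //.
  by move: lh o0 o1; case: (odd l) => /=; lra.
have cutT i : (i < nsides)%N -> cut l x <= cut i x.
  move=> ik; have [e|ne] := eqVneq i./2 l./2.
    rewrite {2}/cut e; case: ifP => bl; first by rewrite /cut bl /midv e.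
    exact: le_trans cut_line _.
  rewrite {2}/cut; case: ifP => bi; last exact: le_trans cut_line _.
  apply: le_trans cut_line _.
  case: (ltngtP i./2 l./2) ne => // [/natr_lt h|/natr_lt h] _.
    apply: le_trans (lineT i./2.*2.+1) _; rewrite -subr_le0 line_diag_right.
    by nra.
  apply: le_trans (lineT i./2.*2) _; rewrite -subr_le0 line_diag_left.
  by nra.
split; last by rewrite ltnn => i ik; apply: lt_le_trans ycut (cutT i ik).
split=> // i ik; apply: le_trans (ltW ycut) _.
exact: le_trans cut_line _.
Qed.

End Parabola.

(** * Coordinates along the edges and the outline of the unfolding *)

Section Charts.
Variables (R : realType) (g : nat).
Hypothesis g_gt1 : (1 < g)%N.
Implicit Types (x y S L : R) (i j l : nat).
Notation kn := (nsides g).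
Notation kr := (nsidesR R g).
Notation cc := (curv R g).
Notation ty := (vertex_y R g).
Notation sl := (edge_slope R g).
Notation mu := (diag_slope R g).
Notation den := (edge_den R g).

Definition hyp i : R := Num.sqrt (1 + sl i ^+ 2).
(** [(ua, ub)] is the unit direction of edge [i]. The last edge, the chord, runs from right to left,
    so that the boundary is traversed clockwise and [(ub, - ua)] points inward along all edges. *)
Definition ua i : R := if (i < kn)%N then (hyp i)^-1 else -1.
Definition ub i : R := if (i < kn)%N then sl i / hyp i else 0.
Definition edge_len i : R := if (i < kn)%N then hyp i else kr.

Lemma hyp_sqr i : hyp i ^+ 2 = 1 + sl i ^+ 2.
Proof. by rewrite sqr_sqrtr // addr_ge0 ?ler01 ?sqr_ge0. Qed.

Lemma hyp_ge1 i : 1 <= hyp i.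
Proof.
have := hyp_sqr i; have := sqr_ge0 (sl i); have : 0 <= hyp i by apply: sqrtr_ge0.
by nra.
Qed.

Lemma hyp_gt0 i : 0 < hyp i.
Proof. by have h := hyp_ge1 i; lra. Qed.

Lemma hyp_neq0 i : hyp i != 0.
Proof. by have h := hyp_ge1 i; rewrite gt_eqF //; lra. Qed.

Lemma frame_unit i : ua i ^+ 2 + ub i ^+ 2 = 1.
Proof.
rewrite /ua /ub; case: ifP => _; last by ring.
have h0 := hyp_neq0 i.
have -> : (hyp i)^-1 ^+ 2 + (sl i / hyp i) ^+ 2 = (1 + sl i ^+ 2) / hyp i ^+ 2 by field.
by rewrite -hyp_sqr divff // sqrf_eq0.
Qed.

Lemma len_ge1 i : 1 <= edge_len i.
Proof. by rewrite /edge_len; case: ifP => _; [exact: hyp_ge1 | have := kr_ge4 R g_gt1; lra]. Qed.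

Definition along i x y := ua i * (x - i%:R) + ub i * (y - ty i).
Definition inward i x y := ub i * (x - i%:R) - ua i * (y - ty i).
Definition chartx i S L : R := i%:R + S * ua i + L * ub i.
Definition charty i S L : R := ty i + S * ub i - L * ua i.

Lemma along_chart i S L : along i (chartx i S L) (charty i S L) = S.
Proof.
rewrite /along /chartx /charty -[RHS]mulr1 -(frame_unit i); ring.
Qed.

Lemma inward_chart i S L : inward i (chartx i S L) (charty i S L) = L.
Proof.
rewrite /inward /chartx /charty -[RHS]mulr1 -(frame_unit i); ring.
Qed.

Lemma chart_isometry i x y x' y' :
  (along i x y - along i x' y') ^+ 2 + (inward i x y - inward i x' y') ^+ 2
  = (x - x') ^+ 2 + (y - y') ^+ 2.
Proof.
transitivity ((ua i ^+ 2 + ub i ^+ 2) * ((x - x') ^+ 2 + (y - y') ^+ 2)).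
  by rewrite /along /inward; ring.
by rewrite frame_unit mul1r.
Qed.

Lemma chartxK i x y : chartx i (along i x y) (inward i x y) = x.
Proof.
transitivity ((ua i ^+ 2 + ub i ^+ 2) * (x - i%:R) + i%:R).
  by rewrite /chartx /along /inward; ring.
by rewrite frame_unit mul1r subrK.
Qed.

Lemma chartyK i x y : charty i (along i x y) (inward i x y) = y.
Proof.
transitivity ((ua i ^+ 2 + ub i ^+ 2) * (y - ty i) + ty i).
  by rewrite /charty /along /inward; ring.
by rewrite frame_unit mul1r subrK.
Qed.

Lemma ty_kn : ty kn = 0.
Proof. by rewrite /vertex_y subrr !mulr0. Qed.

Lemma ty0 : ty 0 = 0.
Proof. by rewrite /vertex_y mul0r mulr0. Qed.

Lemma lineE i x : line g i x = ty i + sl i * (x - i%:R).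
Proof. by rewrite /line /vertex_y /edge_slope; ring. Qed.

Lemma inward_edge i x y : (i < kn)%N -> inward i x y * hyp i = line g i x - y.
Proof.
move=> ik; rewrite /inward /ua /ub ik lineE; have := hyp_neq0 i => h0; by field.
Qed.

Lemma along_edge i x y : (i < kn)%N ->
  along i x y * hyp i = (x - i%:R) + sl i * (y - ty i).
Proof. by move=> ik; rewrite /along /ua /ub ik; have := hyp_neq0 i => h0; field. Qed.

Lemma inward_chord x y : inward kn x y = y.
Proof. by rewrite /inward /ua /ub ltnn ty_kn; ring. Qed.

Lemma along_chord x y : along kn x y = kr - x.
Proof. by rewrite /along /ua /ub ltnn ty_kn /nsidesR; ring. Qed.

Lemma inB_inward i x y : (i <= kn)%N -> inB g x y -> 0 <= inward i x y.
Proof.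
rewrite leq_eqVlt => /orP[/eqP ->|ik] [y0 yl]; first by rewrite inward_chord.
rewrite -(pmulr_lge0 (inward i x y) (hyp_gt0 i)) inward_edge // subr_ge0.
exact: yl.
Qed.

Lemma inBP x y : (forall i, (i <= kn)%N -> 0 <= inward i x y) <-> inB g x y.
Proof.
split=> [h|B i ik]; last exact: inB_inward.
split=> [|i ik]; first by have := h kn (leqnn _); rewrite inward_chord.
rewrite -subr_ge0 -inward_edge // mulr_ge0 ?h ?(ltnW ik) //.
by have := hyp_ge1 i; lra.
Qed.

Lemma sl_mu i : sl i = if odd i then mu (midv i) - cc else mu (midv i) + cc.
Proof.
rewrite /edge_slope /diag_slope natr_bump {1}(natr_half R i); case: (odd i) => /=; ring.
Qed.

Lemma bump_hyp i : (i < kn)%N ->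
  (midv i)%:R = i%:R + (if odd i then 0 else 1) :> R /\
  ty (midv i) = ty i + (if odd i then 0 else sl i).
Proof.
move=> ik; rewrite /midv; have e := odd_double_half i; move: e; case: (odd i) => /= e.
  by rewrite -{2 4}e !add1n !addr0.
rewrite -{2 4 5}e !add0n natr_bump natr_dbl; split; first by ring.
by rewrite /vertex_y /edge_slope natr_bump natr_dbl; ring.
Qed.

(** The distance along the edge from its end away from the corner, which makes even and odd edges
    mirror images. *)
Definition toward i S := if odd i then edge_len i - S else S.

(** In the coordinates [(toward, inward)] of edge [i], the chord is the line through the origin with
    direction [(den, cc)]; by [nrm_slab] the altitude passes through the corner with the
    perpendicular direction [(- cc, den)]. *)
Lemma diag_slab i x y : (i < kn)%N ->
  (y - diag g (midv i) x) * hyp i = cc * toward i (along i x y) - den i * inward i x y.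
Proof.
move=> ik; have h0 := hyp_neq0 i; apply: (mulIf h0).
have dE : diag g (midv i) x = ty (midv i) - cc + mu (midv i) * (x - (midv i)%:R).
  by rewrite /diag /vertex_y /diag_slope; ring.
have [b1 b2] := bump_hyp ik.
have h2 := hyp_sqr i; have smu := sl_mu i; rewrite expr2 in h2.
have -> : (cc * toward i (along i x y) - den i * inward i x y) * hyp i =
    cc * (if odd i then hyp i * hyp i - along i x y * hyp i else along i x y * hyp i)
    - den i * (inward i x y * hyp i).
  by rewrite /toward /edge_len ik; case: (odd i); ring.
rewrite -[LHS]mulrA inward_edge // along_edge // dE b1 b2 h2 lineE /edge_den smu.
by case: (odd i); ring.
Qed.

Lemma nrm_slab i x y : (i < kn)%N ->
  nrm g (midv i) x y * hyp i =
  (if odd i then 1 else -1) * (den i * (edge_len i - toward i (along i x y)) - cc * inward i x y).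
Proof.
move=> ik; have h0 := hyp_neq0 i; apply: (mulIf h0).
have [b1 b2] := bump_hyp ik.
have h2 := hyp_sqr i; have smu := sl_mu i; rewrite expr2 in h2.
have -> : (if odd i then 1 else -1) *
      (den i * (edge_len i - toward i (along i x y)) - cc * inward i x y) * hyp i =
    (if odd i then 1 else -1) *
      (den i * (if odd i then along i x y * hyp i else hyp i * hyp i - along i x y * hyp i)
       - cc * (inward i x y * hyp i)).
  by rewrite /toward /edge_len ik; case: (odd i); ring.
rewrite -[LHS]mulrA inward_edge // along_edge // /nrm b1 b2 h2 lineE /edge_den smu.
by case: (odd i); ring.
Qed.

Variable bet : nat -> bool.

(** The piece projects into its hinge. The chord gives [den * inward <= cc * toward] and the
    altitude gives [cc * inward <= den * (edge_len - toward)], where [inward], [den] and [cc] are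
    nonnegative. *)
Lemma piece_slab i x y : (i <= kn)%N -> piece g bet i x y ->
  0 <= along i x y <= edge_len i /\ 0 <= inward i x y.
Proof.
move=> ik [Bxy]; have L0 := inB_inward ik Bxy; case: ifPn => [{}ik [cy s]|nik _].
  split=> //; have [_ dy] := cut_cap g_gt1 Bxy ik cy.
  have h0 := hyp_gt0 i; have c0 := cc_gt0 R g_gt1; have D0 := den_gt R g_gt1 ik.
  have : 0 <= (y - diag g (midv i) x) * hyp i by rewrite mulr_ge0 ?subr_ge0 // ltW.
  rewrite diag_slab // => h1.
  have : 0 <= den i * (edge_len i - toward i (along i x y)) - cc * inward i x y.
    have := nrm_slab x y ik; move: s; rewrite /side; case: (odd i) => s e.
      by rewrite mul1r in e; rewrite -e mulr_ge0 // ltW.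
    by rewrite mulN1r in e; rewrite -oppr_le0 -e mulr_le0_ge0 // ltW.
  move=> h2; have T0 : 0 <= toward i (along i x y).
    by rewrite -(pmulr_rge0 _ c0); nra.
  have T1 : 0 <= edge_len i - toward i (along i x y).
    have D0' : 0 < den i by lra.
    by rewrite -(pmulr_rge0 _ D0'); nra.
  by move: T0 T1; rewrite /toward; case: (odd i) => T0 T1; apply/andP; split; lra.
have {nik ik}iE : i = kn by apply/eqP; rewrite eqn_leq ik leqNgt.
split=> //; have /andP[x0 xk] := inB_x g_gt1 Bxy.
by rewrite iE along_chord /edge_len ltnn; apply/andP; split; lra.
Qed.

(** From right to left, [partner_edge] and [cap_inB] show that the point lies in the base at all. *)
Lemma spiece_slab i S L : (i < kn)%N -> 0 <= L ->
  spiece g bet i (chartx i S L) (charty i S L) <->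
  [/\ bet i./2, den i * L < cc * toward i S & cc * L < den i * (edge_len i - toward i S)].
Proof.
move=> ik L0; have h0 := hyp_gt0 i.
set x := chartx i S L; set y := charty i S L.
have SE : along i x y = S := along_chart i S L.
have LE : inward i x y = L := inward_chart i S L.
have dE := diag_slab x y ik; have nE := nrm_slab x y ik; rewrite SE LE in dE nE.
have yline : y <= line g i x.
  by rewrite -subr_ge0 -inward_edge // LE mulr_ge0 // ltW.
have dP : (diag g (midv i) x < y) = (den i * L < cc * toward i S).
  by rewrite -subr_gt0 -(pmulr_lgt0 _ h0) dE subr_gt0.
have nP : (if odd i then 0 < nrm g (midv i) x y else nrm g (midv i) x y < 0) =
    (cc * L < den i * (edge_len i - toward i S)).
  move: nE; case: (odd i) => nE.
    by rewrite -(pmulr_lgt0 _ h0) nE mul1r subr_gt0.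
  by rewrite -(pmulr_llt0 _ h0) nE mulN1r oppr_lt0 subr_gt0.
split=> [[Bxy]|[bi dL nL]].
  rewrite ik /cut /sside => -[cy ss].
  have bi : bet i./2.
    by move: cy; case: ifP => // _; rewrite ltNge yline.
  rewrite bi dP in cy; split=> //.
  by rewrite -nP; move: ss; case: (odd i).
have ss : sside g i x y by rewrite /sside; move: nP; rewrite nL; case: (odd i).
have sd : side g i x y by move: ss; rewrite /side /sside; case: (odd i) => /ltW.
have dy : diag g (midv i) x < y by rewrite dP.
have [y1 y2] := partner_edge g_gt1 ik sd yline.
split; first exact: (cap_inB g_gt1 (half_lt g_gt1 ik) (ltW dy) y1 y2).
by rewrite ik /cut bi.
Qed.

(* The common point of the two lines bounding the piece in spiece_slab. *)
Definition apex i : R := edge_len i * den i ^+ 2 / (cc ^+ 2 + den i ^+ 2).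
Definition apexh i : R := edge_len i * cc * den i / (cc ^+ 2 + den i ^+ 2).
Definition foot i : R := if odd i then edge_len i - apex i else apex i.

Lemma apex_eq i : (i < kn)%N ->
  [/\ 0 < apex i < edge_len i, apexh i * den i = cc * apex i
    & apexh i * cc = den i * (edge_len i - apex i)].
Proof.
move=> ik; have c0 := cc_gt0 R g_gt1; have D0 := den_gt R g_gt1 ik; have l0 := len_ge1 i.
have s0 : 0 < cc ^+ 2 + den i ^+ 2 by have := sqr_ge0 cc; nra.
have s1 : cc ^+ 2 + den i ^+ 2 != 0 by rewrite gt_eqF.
split; [|by rewrite /apexh /apex; field|by rewrite /apexh /apex; field].
rewrite /apex ltr_pdivrMr // divr_gt0 //; last by nra.
by rewrite mulrDr ltrDr mulr_gt0 //; nra.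
Qed.

(** The bound by [cc] keeps the unfolding low over the edges of the arc; the other one keeps the
    first triangle below the slanted side of the hexagon. *)
Lemma apexh_bound i : (i < kn)%N -> 0 < apexh i <= cc /\ apexh i <= 4^-1 * apex i.
Proof.
move=> ik; have [/andP[a0 a1] e1 e2] := apex_eq ik.
have c0 := cc_gt0 R g_gt1; have c1 := cc_le R g_gt1; have D0 := den_gt R g_gt1 ik.
have h0 : 0 < apexh i by have : 0 < apexh i * den i by [rewrite e1 mulr_gt0]; nra.
split; last by nra.
rewrite h0 /=; have h2 := hyp_sqr i; have lE : edge_len i = hyp i by rewrite /edge_len ik.
(* Lagrange's identity for the directions of the chord and the edge, whose cross product is [cc] up
   to sign. *)
have E : cc ^+ 2 + den i ^+ 2 = (1 + mu (midv i) ^+ 2) * edge_len i ^+ 2.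
  by rewrite lE h2 /edge_den sl_mu; case: (odd i); ring.
have E0 : 0 < cc ^+ 2 + den i ^+ 2 by have := sqr_ge0 cc; nra.
rewrite /apexh ler_pdivrMr // E.
suff h : den i <= (1 + mu (midv i) ^+ 2) * edge_len i.
  have -> : edge_len i * cc * den i = (cc * edge_len i) * den i by ring.
  have -> : cc * ((1 + mu (midv i) ^+ 2) * edge_len i ^+ 2) =
     (cc * edge_len i) * ((1 + mu (midv i) ^+ 2) * edge_len i) by ring.
  by rewrite ler_pM2l // mulr_gt0 //; lra.
have m0 := sqr_ge0 (mu (midv i)).
rewrite -ler_sqr ?nnegrE; [|by lra|by rewrite mulr_ge0; lra].
have : den i ^+ 2 <= (1 + mu (midv i) ^+ 2) * edge_len i ^+ 2 by rewrite -E lerDr sqr_ge0.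
have : 0 <= (1 + mu (midv i) ^+ 2) * (mu (midv i) ^+ 2 * edge_len i ^+ 2).
  by apply: mulr_ge0; [lra | rewrite mulr_ge0 ?sqr_ge0].
set a := mu _; set b := edge_len _; nra.
Qed.

Definition strip_offset i : R := \sum_(j < i) edge_len j.

Lemma offsetS i : strip_offset i.+1 = strip_offset i + edge_len i.
Proof. by rewrite /strip_offset big_ord_recr. Qed.

Definition strip_width : R := strip_offset kn.+1.

Lemma widthE : strip_width = strip_offset kn + kr.
Proof. by rewrite /strip_width offsetS /edge_len ltnn. Qed.

Definition nbreak := (kn.*2 + kn)%N.
(* Break points 2i and 2i + 1 are the start and the apex over edge i; the remaining ones are
   the projections of the vertices to the chord. *)
Definition breakx a : R :=
  if (a < kn.*2)%N then strip_offset a./2 + (if odd a then foot a./2 else 0)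
  else strip_offset kn + (a - kn.*2)%:R.
(** The height over vertex [r] of the part of the base that stays at the chord: the diagonal passes
    [cc] below its corner. *)
Definition notch r : R := ty r - (if odd r && bet r./2 then cc else 0).
Definition breakh a : R :=
  if (a < kn.*2)%N then 1 + (if odd a && bet a./2./2 then apexh a./2 else 0)
  else 1 + notch (kn - (a - kn.*2)).

Lemma break_chord r :
  breakx (kn.*2 + r) = strip_offset kn + r%:R /\ breakh (kn.*2 + r) = 1 + notch (kn - r).
Proof. by rewrite /breakx /breakh ltnNge leq_addr /= addKn. Qed.

Lemma notch_kn : notch kn = 0.
Proof. by rewrite /notch ty_kn /nsides odd_double /= subrr. Qed.

Lemma break_even i : (i <= kn)%N -> breakx i.*2 = strip_offset i /\ breakh i.*2 = 1.
Proof.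
rewrite leq_eqVlt => /orP[/eqP ->|ik].
  by have := break_chord 0; rewrite addn0 subn0 notch_kn !addr0.
by rewrite /breakx /breakh ltn_double ik odd_double doubleK /= !addr0.
Qed.

Lemma break_odd i : (i < kn)%N -> breakx i.*2.+1 = strip_offset i + foot i /\
  breakh i.*2.+1 = 1 + (if bet i./2 then apexh i else 0).
Proof.
move=> ik; have lt : (i.*2.+1 < kn.*2)%N by lia.
by rewrite /breakx /breakh lt /= odd_double /= uphalf_double.
Qed.

Lemma break_cases (P : nat -> Prop) :
  (forall i, (i < kn)%N -> P i.*2) -> (forall i, (i < kn)%N -> P i.*2.+1) ->
  (forall r, (r < kn)%N -> P (kn.*2 + r)%N) ->
  forall a, (a < nbreak)%N -> P a.
Proof.
move=> Peven Podd Pchord a; rewrite /nbreak => aM.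
have [lt_a|le_a] := ltnP a kn.*2; last first.
  by rewrite -(subnKC le_a); apply: Pchord; lia.
rewrite -(odd_double_half a); case: (odd a); rewrite ?add0n ?add1n.
  by apply: Podd; lia.
by apply: Peven; lia.
Qed.

Lemma foot_bound i : (i < kn)%N -> 0 < foot i < edge_len i.
Proof.
move=> /apex_eq[/andP[a0 a1] _ _]; rewrite /foot.
by case: (odd i); apply/andP; split; lra.
Qed.

Lemma breakx_mono a : (a < nbreak)%N -> breakx a < breakx a.+1.
Proof.
move: a; apply: break_cases => [i ik|i ik|r rk].
- have [-> _] := break_even (ltnW ik); have [-> _] := break_odd ik.
  by have := foot_bound ik; lra.
- have [-> _] := break_odd ik; have [] := break_even ik; rewrite doubleS => -> _.
  by have := foot_bound ik; rewrite offsetS; lra.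
- have [-> _] := break_chord r; have [] := break_chord r.+1; rewrite addnS => -> _.
  by rewrite -natr1; lra.
Qed.

Lemma nbreak_gt0 : (0 < nbreak)%N.
Proof. by rewrite /nbreak /nsides; lia. Qed.

Lemma breakx0 : breakx 0 = 0.
Proof. by have [h _] := @break_even 0 isT; rewrite h /strip_offset big_ord0. Qed.

Lemma breakx_last : breakx nbreak = strip_width.
Proof. by have [-> _] := break_chord kn; rewrite widthE. Qed.

Definition strip_height : R -> R := pl breakx breakh nbreak.

Lemma toward_bound i S : 0 <= S <= edge_len i -> 0 <= toward i S <= edge_len i.
Proof. by move=> h; rewrite /toward; case: (odd i); lra. Qed.

(** Over the hinge of a cut corner the graph is a tent whose two sides are the lines of
    [spiece_slab]. Before [apex], in terms of [toward], the chord is the lower line, and after it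
    the altitude, so to be below the tent is to be below both. *)
Lemma height_edge i S : (i < kn)%N -> 0 <= S <= edge_len i ->
  if bet i./2 then
    forall L, 0 <= L -> (1 + L < strip_height (strip_offset i + S)) =
      (den i * L < cc * toward i S) && (cc * L < den i * (edge_len i - toward i S))
  else strip_height (strip_offset i + S) = 1.
Proof.
move=> ik S01; have fb := foot_bound ik.
have [bx0 bh0] := break_even (ltnW ik); have [bx1 bh1] := break_odd ik.
have [bx2 bh2] := break_even ik; rewrite doubleS offsetS in bx2 bh2.
have lt0 : (i.*2 < nbreak)%N by rewrite /nbreak; lia.
have lt1 : (i.*2.+1 < nbreak)%N by rewrite /nbreak; lia.
have left : S <= foot i -> strip_height (strip_offset i + S) * foot i =
    (foot i - S) + (1 + (if bet i./2 then apexh i else 0)) * S.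
  move=> Sf; have := @pl_interp _ breakx breakh _ breakx_mono _ (strip_offset i + S) lt0.
  by rewrite bx0 bx1 bh0 bh1 => /(_ ltac:(lra)) h; rewrite -/strip_height in h; lra.
have right : foot i <= S -> strip_height (strip_offset i + S) * (edge_len i - foot i) =
    (1 + (if bet i./2 then apexh i else 0)) * (edge_len i - S) + (S - foot i).
  move=> Sf; have := @pl_interp _ breakx breakh _ breakx_mono _ (strip_offset i + S) lt1.
  by rewrite bx2 bx1 bh2 bh1 => /(_ ltac:(lra)) h; rewrite -/strip_height in h; lra.
move: left right; case: (bet i./2) => left right; last first.
  have [Sf|/ltW Sf] := leP S (foot i).
    apply: (@mulIf _ (foot i)); first by rewrite gt_eqF //; lra.
    by rewrite left //; ring.
  apply: (@mulIf _ (edge_len i - foot i)); first by rewrite gt_eqF //; lra.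
  by rewrite right //; ring.
move=> L L0; have [ab e1 e2] := apex_eq ik.
have c0 := cc_gt0 R g_gt1; have D0 := den_gt R g_gt1 ik.
set T := toward i S; set Ht := strip_height _ in left right *.
have low : T <= apex i -> (Ht - 1) * apex i = apexh i * T.
  rewrite /T /toward; move: left right; rewrite /foot; case: (odd i) => left right h.
    by have := right ltac:(lra); lra.
  by have := left ltac:(lra); lra.
have high : apex i <= T -> (Ht - 1) * (edge_len i - apex i) = apexh i * (edge_len i - T).
  rewrite /T /toward; move: left right; rewrite /foot; case: (odd i) => left right h.
    by have := left ltac:(lra); lra.
  by have := right ltac:(lra); lra.
have T01 : 0 <= T <= edge_len i by apply: toward_bound.
have h0 : 0 < apexh i by have [/andP[]] := apexh_bound ik.
have D1 : 0 < den i by lra.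
clearbody T Ht; case/andP: T01 => T0 T1.
have [Ta|/ltW aT] := leP T (apex i).
  have E : (Ht - 1) * den i = cc * T.
    apply: (@mulIf _ (apexh i)); first by rewrite gt_eqF.
    transitivity ((Ht - 1) * (apexh i * den i)); first by ring.
    by rewrite e1; transitivity (cc * ((Ht - 1) * apex i)); [ring | rewrite low //; ring].
  apply/idP/andP => [lt|[lt _]]; last first.
    by have : 0 < (Ht - 1 - L) * den i by [rewrite mulrBl E; lra]; rewrite pmulr_lgt0 //; lra.
  have d : L < Ht - 1 by lra.
  split; first by rewrite -E [den i * L]mulrC ltr_pM2r.
  have : cc * (Ht - 1) <= den i * (edge_len i - T).
    rewrite -(ler_pM2r D1); have -> : cc * (Ht - 1) * den i = cc * (cc * T) by rewrite -E; ring.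
    have : cc * (cc * apex i) = den i * (edge_len i - apex i) * den i.
      by rewrite -e1 -e2; ring.
    have : cc * (cc * T) <= cc * (cc * apex i) by rewrite !ler_pM2l.
    have : den i * (edge_len i - apex i) * den i <= den i * (edge_len i - T) * den i.
      by rewrite ler_pM2r // ler_pM2l //; lra.
    lra.
  by apply: lt_le_trans; rewrite ltr_pM2l.
have E : (Ht - 1) * cc = den i * (edge_len i - T).
  apply: (@mulIf _ (apexh i)); first by rewrite gt_eqF.
  transitivity ((Ht - 1) * (apexh i * cc)); first by ring.
  by rewrite e2; transitivity (den i * ((Ht - 1) * (edge_len i - apex i))); [ring | rewrite high //; ring].
apply/idP/andP => [lt|[_ lt]]; last first.
  by have : 0 < (Ht - 1 - L) * cc by [rewrite mulrBl E; lra]; rewrite pmulr_lgt0 //; lra.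
have d : L < Ht - 1 by lra.
split; last by rewrite -E [cc * L]mulrC ltr_pM2r.
have : den i * (Ht - 1) <= cc * T.
  rewrite -(ler_pM2r c0); have -> : den i * (Ht - 1) * cc = den i * (den i * (edge_len i - T)) by rewrite -E; ring.
  have : den i * (den i * (edge_len i - apex i)) = cc * apex i * cc.
    by rewrite -e1 -e2; ring.
  have : cc * apex i * cc <= cc * T * cc by rewrite ler_pM2r // ler_pM2l.
  have : den i * (den i * (edge_len i - T)) <= den i * (den i * (edge_len i - apex i)).
    by rewrite !ler_pM2l //; lra.
  lra.
by apply: lt_le_trans; rewrite ltr_pM2l.
Qed.

(** The chord is unrolled backwards, hence the argument [kr - x]. Between [l] and [l + 1] both sides
    are affine, and [cut] takes the values [notch] at the ends. *)
Lemma height_chord l x : (l < kn)%N -> l%:R <= x <= l%:R + 1 ->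
  strip_height (strip_offset kn + (kr - x)) = 1 + cut g bet l x.
Proof.
move=> lk xl; pose r := (kn - l.+1)%N.
have lt_r : (kn.*2 + r < nbreak)%N by rewrite /nbreak /r; lia.
have rE : r%:R = kr - l%:R - 1 :> R by rewrite /r natrB // -natr1 /nsidesR; lra.
have [bx0 bh0] := break_chord r; have [bx1 bh1] := break_chord r.+1.
rewrite addnS in bx1 bh1.
have := @pl_interp _ breakx breakh _ breakx_mono _ (strip_offset kn + (kr - x)) lt_r.
rewrite bx0 bh0 bx1 bh1 -natr1 rE => /(_ ltac:(lra)); rewrite -/strip_height.
have -> : (kn - r = l.+1)%N by rewrite /r; lia.
have -> : (kn - r.+1 = l)%N by rewrite /r; lia.
suff : notch l * (l%:R + 1 - x) + notch l.+1 * (x - l%:R) = cut g bet l x by lra.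
rewrite /notch /cut; have e := odd_double_half l.
have lE := natr_half R l; have l1E : l.+1%:R = l%:R + 1 :> R by rewrite natr1.
rewrite /= uphalf_half /midv /vertex_y /diag /line l1E natr_bump; move: e lE.
case: (odd l) => /= e lE; rewrite ?add0n; case: (bet l./2); rewrite lE; ring.
Qed.

End Charts.

Section Height.
Variables (R : realType) (g : nat).
Hypothesis g_gt1 : (1 < g)%N.
Variable bet : nat -> bool.
Implicit Types (x y S L : R) (i j l : nat).
Notation kn := (nsides g).
Notation kr := (nsidesR R g).
Notation cc := (curv R g).
Notation offset := (strip_offset R g).
Notation len := (edge_len R g).
Notation width := (strip_width R g).
Notation height := (@strip_height R g bet).

(** The link between the plane region and the surface; that the unfolding maps into the region and
    onto it both rest on this equivalence. *)
Lemma height_piece i S L : (i <= kn)%N -> 0 <= S <= len i -> 0 <= L ->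
  (1 + L < height (offset i + S)) <->
  spiece g bet i (chartx g i S L) (charty g i S L).
Proof.
rewrite leq_eqVlt => /orP[/eqP ->|ik] S01 L0; last first.
  have := height_edge g_gt1 bet ik S01; rewrite spiece_slab //.
  case: (bet i./2) => [/(_ L L0) ->|->]; last by split=> [h|[//]]; exfalso; lra.
  by split=> [/andP[]|[_ -> ->]].
have xE : chartx g kn S L = kr - S by rewrite /chartx /ua /ub ltnn /nsidesR; ring.
have yE : charty g kn S L = L by rewrite /charty /ua /ub ltnn ty_kn; ring.
rewrite xE yE; move: S01; rewrite /edge_len ltnn => S01.
have k0 : (0 < kn)%N by rewrite /nsides; lia.
have := @breakpoint_piece R kn (fun l => l%:R) (kr - S) k0.
rewrite -/kr => /(_ ltac:(rewrite mulr0n; lra))[l lk]; rewrite -natr1 => xl.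
have := height_chord g_gt1 bet lk xl; rewrite (_ : kr - (kr - S) = S); last by ring.
move=> ->; rewrite ltrD2l; split=> [lt|[_]].
  exact: spiece_chord lt.
by rewrite ltnn; apply.
Qed.

Lemma offset_ge i : i%:R <= offset i.
Proof.
elim: i => [|i IH]; first by rewrite /strip_offset big_ord0.
by have := len_ge1 R g_gt1 i; rewrite offsetS -natr1; lra.
Qed.

Lemma width_ge4 : 4 <= width.
Proof. by have := offset_ge kn; have := kr_ge4 R g_gt1; rewrite widthE -/kr; lra. Qed.

Lemma notch_bound r : (r <= kn)%N -> 0 <= notch R g bet r <= cc * (r%:R * (kr - r%:R)).
Proof.
move=> rk; have c0 := cc_gt0 R g_gt1.
rewrite /notch; have t0 := @ty_ge0 R g g_gt1 r rk.
case: ifP => [/andP[odd_r _]|_]; last by rewrite subr0 lexx t0.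
have r1 : 1 <= r%:R :> R by rewrite (ler_nat R 1); case: (r) odd_r.
have r2 : (r < kn)%N.
  by rewrite ltn_neqAle rk andbT; apply: contraTneq odd_r => ->; rewrite odd_double.
have r3 := natr_kn R r2; rewrite /vertex_y; apply/andP; split; last by lra.
suff : cc * 1 <= cc * (r%:R * (kr - r%:R)) by lra.
by rewrite ler_pM2l //; nra.
Qed.

(** The bounds are the slanted sides of the hexagon. Over the chord they hold since
    [curv * nsidesR = 1/4]. Over the other edges the height exceeds 1 by at most [curv], which is
    little compared with a quarter of the distance from the ends of the strip, except over the first
    edge, where [apexh <= apex / 4] is used. *)
Lemma break_bound a : (a <= nbreak g)%N ->
  [/\ 1 <= breakh R g bet a :> R, breakh R g bet a <= 4^-1 * breakx R g a + 1
    & breakh R g bet a <= - 4^-1 * breakx R g a + (4^-1 * width + 1)].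
Proof.
have c0 := cc_gt0 R g_gt1; have c1 := cc_le R g_gt1; have ck := cc_kr R g_gt1.
have k4 := kr_ge4 R g_gt1; have ok := offset_ge kn; rewrite -/kr in ok.
have chord r : (r <= kn)%N -> [/\ 1 <= breakh R g bet (kn.*2 + r) :> R,
     breakh R g bet (kn.*2 + r) <= 4^-1 * breakx R g (kn.*2 + r) + 1
    & breakh R g bet (kn.*2 + r) <= - 4^-1 * breakx R g (kn.*2 + r) + (4^-1 * width + 1)].
  move=> rk; have [-> ->] := break_chord R g bet r; rewrite widthE.
  have := @notch_bound (kn - r) (leq_subr _ _); rewrite natrB // -/kr => /andP[n0 n1].
  have e : cc * ((kr - r%:R) * (kr - (kr - r%:R))) <= 4^-1 * r%:R.
    by rewrite -ck; have := sqr_ge0 r%:R; nra.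
  have e' : cc * ((kr - r%:R) * (kr - (kr - r%:R))) <= 4^-1 * (kr - r%:R).
    by rewrite -ck; have := sqr_ge0 (kr - r%:R); nra.
  by split; lra.
have mono i : (i <= kn)%N -> offset i <= offset kn.
  move=> ik; rewrite -(subnKC ik); elim: (_ - _)%N => [|m IH]; first by rewrite addn0.
  by have := len_ge1 R g_gt1 (i + m); rewrite addnS offsetS; lra.
rewrite leq_eqVlt => /orP[/eqP -> | ]; first exact: chord.
move: a; apply: (break_cases g_gt1) => [i ik|i ik|r rk]; last by apply: chord; apply: ltnW.
  have [-> ->] := break_even R bet (ltnW ik).
  have := offset_ge i; have := mono i (ltnW ik); have : 0 <= i%:R :> R by rewrite ler0n.
  by rewrite widthE; split; lra.
have [-> ->] := break_odd R g_gt1 bet ik.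
have := offset_ge i; have := mono _ ik; have : 0 <= i%:R :> R by rewrite ler0n.
have fb := foot_bound R g_gt1 ik; have [/andP[h0 h1] h2] := apexh_bound R g_gt1 ik.
have b0 : 0 <= (if bet i./2 then apexh R g i else 0) <= apexh R g i.
  by case: (bet i./2); lra.
rewrite offsetS widthE => i0 le1 le2; split; try lra.
case: i ik fb h0 h1 h2 b0 i0 le1 le2 => [|i] ik fb h0 h1 h2 b0 i0 le1 le2.
  by move: fb b0; rewrite /foot /= => fb b0; lra.
have : 1 <= i.+1%:R :> R by rewrite (ler_nat R 1).
lra.
Qed.

Let mono a := @breakx_mono R g g_gt1 bet a.

Lemma height_ge1 x : 0 <= x <= width -> 1 <= height x.
Proof.
move=> xW; apply: (pl_lb mono (nbreak_gt0 g_gt1)).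
  by move=> a /break_bound[].
by rewrite (breakx0 R g bet) (breakx_last R g bet).
Qed.

Lemma height_le_left x : 0 <= x <= width -> height x <= 4^-1 * x + 1.
Proof.
move=> xW; apply: (pl_ub mono (nbreak_gt0 g_gt1)).
  by move=> a /break_bound[].
by rewrite (breakx0 R g bet) (breakx_last R g bet).
Qed.

Lemma height_le_right x : 0 <= x <= width -> height x <= 4^-1 * (width - x) + 1.
Proof.
move=> xW; have : height x <= - 4^-1 * x + (4^-1 * width + 1).
  apply: (pl_ub mono (nbreak_gt0 g_gt1)).
    by move=> a /break_bound[].
  by rewrite (breakx0 R g bet) (breakx_last R g bet).
lra.
Qed.

Lemma height_strip x : 0 <= x <= offset kn -> height x <= 1 + cc.
Proof.
move=> xs; have c0 := cc_gt0 R g_gt1.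
have k0 : (0 < kn.*2)%N by rewrite /nsides; lia.
have := @breakpoint_piece R kn.*2 (breakx R g) x k0.
have [-> _] := break_even R bet (leqnn kn); rewrite (breakx0 R g bet) => /(_ xs)[a ak xa].
have aM : (a < nbreak g)%N by rewrite /nbreak; lia.
have low b : (b <= kn.*2)%N -> breakh R g bet b <= 1 + cc.
  rewrite leq_eqVlt => /orP[/eqP ->|bk].
    by have [_ ->] := break_even R bet (leqnn kn); lra.
  rewrite -(odd_double_half b); case: (odd b); rewrite ?add0n ?add1n.
    have bk' : (b./2 < kn)%N by lia.
    have [_ ->] := break_odd R g_gt1 bet bk'; have [/andP[h0 h1] _] := apexh_bound R g_gt1 bk'.
    by case: ifP => _; lra.
  have bk' : (b./2 <= kn)%N by lia.
  by have [_ ->] := break_even R bet bk'; lra.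
have := pl_interp (breakh R g bet) mono aM xa; rewrite -/(height x).
have := mono aM; have := low a (ltnW ak); have := low a.+1 ak.
case/andP: xa => xa1 xa2 h1 h2 lt E.
rewrite -(ler_pM2r (_ : 0 < breakx R g a.+1 - breakx R g a)); last by lra.
by rewrite E; nra.
Qed.

Lemma height_affine a x : (a < nbreak g)%N -> breakx R g a <= x <= breakx R g a.+1 ->
  (height x - height (breakx R g a)) * (breakx R g a.+1 - breakx R g a) =
  (height (breakx R g a.+1) - height (breakx R g a)) * (x - breakx R g a).
Proof.
move=> aM xa; have := pl_interp (breakh R g bet) mono aM xa.
rewrite -/(height x) /strip_height.
rewrite !(pl_vertex (breakh R g bet) mono) ?(ltnW aM) //; lra.
Qed.

Definition unfolded := under_graph height width.

Lemma unfolded_polygon :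
  exists r (p : 'I_r -> 'rV[R]_2), simple_polygon p /\ unfolded = poly_interior p.
Proof.
have h0 x : 0 <= x <= width -> 0 < height x by move=> /height_ge1; lra.
exists _, (@graph_polygon R (nbreak g) (breakx R g) height).
split; first exact: (graph_polygon_simple (nbreak_gt0 g_gt1) mono (breakx0 R g bet) (breakx_last R g bet) h0 height_affine).
symmetry; exact: (graph_polygon_interior (nbreak_gt0 g_gt1) mono (breakx0 R g bet) (breakx_last R g bet) (pl_lip _ _ _) h0 height_affine).
Qed.

End Height.

(** * Congruent unfoldings *)

Section Congruence.
Variable R : realType.
Implicit Types (W : R) (z : 'rV[R]_2) (U : set 'rV[R]_2).

(** The regions are open, and the corners of the strip belong only to their closures. *)
Definition adherent U z := forall e, 0 < e -> exists2 u, U u & edist z u < e.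

Lemma adherent_congruent U U' (h : 'rV[R]_2 -> 'rV[R]_2) z :
  (forall z1 z2, edist (h z1) (h z2) = edist z1 z2) -> h @` U = U' ->
  adherent U z -> adherent U' (h z).
Proof.
move=> iso hU adh e e0; have [u Uu zu] := adh e e0.
by exists (h u); [rewrite -hU; exists u | rewrite iso].
Qed.

Lemma edist_coord z1 z2 (e : R) : edist z1 z2 < e ->
  `|xc z1 - xc z2| < e /\ `|yc z1 - yc z2| < e.
Proof.
move=> lt; have := edist_ge0 z1 z2; have E := edist2_sqrE z1 z2; move: lt E.
set D := edist _ _; set a := xc z1 - _; set b := yc z1 - _ => lt E D0.
have := sqr_ge0 a; have := sqr_ge0 b => b2 a2.
by split; rewrite ltr_norml; apply/andP; split; nra.
Qed.

(* The region lies in a hexagon whose only pairs of points at distance at least that of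
   opposite corners of [0, W] x [-1, 1] are these pairs of corners. *)
Definition hexagon W z :=
  [/\ 0 <= xc z <= W, `|yc z| <= 4^-1 * xc z + 1 & `|yc z| <= 4^-1 * (W - xc z) + 1].

Lemma adherent_hexagon W U z : (forall u, U u -> hexagon W u) -> adherent U z -> hexagon W z.
Proof.
move=> UW adh.
have near e : 0 < e -> exists2 u, hexagon W u &
    [/\ `|xc z - xc u| < e, `|yc z| < `|yc u| + e & `|yc z - yc u| < e].
  move=> e0; have [u Uu zu] := adh e e0; exists u; first exact: UW.
  have [h1 h2] := edist_coord zu; split=> //.
  by have := ler_distD (yc u) (yc z) 0; rewrite !subr0; lra.
split; [apply/andP; split| |]; apply/ler_addgt0Pr => e e0.
- have [u [/andP[u0 u1] _ _] [h _ _]] := near e e0.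
  by move: h; rewrite ltr_norml; lra.
- have [u [/andP[u0 u1] _ _] [h _ _]] := near e e0.
  by move: h; rewrite ltr_norml; lra.
- have [|u [_ u1 _] [h1 h2 _]] := near (e / 2); first by rewrite divr_gt0.
  by move: h1; rewrite ltr_norml; lra.
- have [|u [_ _ u1] [h1 h2 _]] := near (e / 2); first by rewrite divr_gt0.
  by move: h1; rewrite ltr_norml; lra.
Qed.

Lemma hexagon_diameter W z1 z2 : 4 <= W -> hexagon W z1 -> hexagon W z2 ->
  W ^+ 2 + 4 <= edist z1 z2 ^+ 2 ->
  [/\ xc z1 = 0 \/ xc z1 = W, xc z2 = W - xc z1, yc z1 = 1 \/ yc z1 = -1 & yc z2 = - yc z1].
Proof.
move=> W4; rewrite edist2_sqrE => -[/andP[a1 b1] c1 d1] [/andP[a2 b2] c2 d2] far.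
wlog le12 : z1 z2 a1 b1 c1 d1 a2 b2 c2 d2 far / xc z1 <= xc z2.
  move=> wl; have [le|/ltW le] := leP (xc z1) (xc z2); first exact: wl.
  have [|e1 e2 e3 e4] := wl z2 z1 a2 b2 c2 d2 a1 b1 c1 d1 _ le.
  - by rewrite -[(xc z2 - _) ^+ 2]sqrrN -[(yc z2 - _) ^+ 2]sqrrN !opprB.
  - split; rewrite ?e2 ?e4.
    + by case: e1 => ->; [right; lra|left; lra].
    + by lra.
    + by case: e3 => ->; [right; lra|left; lra].
    + by lra.
(* [t] is the total horizontal distance of the points from the two ends. Their heights gain at most
   [t / 4] from it, their horizontal distance loses [t], and for [0 < t <= W] the squared distance
   falls below [W ^+ 2 + 4]. *)
pose t := xc z1 + (W - xc z2).
have dy : `|yc z1 - yc z2| <= 2 + 4^-1 * t.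
  by apply: le_trans (ler_normB _ _) _; rewrite /t; lra.
have dy2 : (yc z1 - yc z2) ^+ 2 <= (2 + 4^-1 * t) ^+ 2.
  by rewrite -real_normK ?num_real // ler_sqr ?nnegrE ?normr_ge0 //; rewrite /t; lra.
have dx : xc z1 - xc z2 = t - W by rewrite /t; ring.
rewrite dx in far.
have tE : t = 0 by nra.
have x1 : xc z1 = 0 by move: tE; rewrite /t; lra.
have x2 : xc z2 = W by move: tE; rewrite /t; lra.
rewrite x1 x2 in c1 d1 c2 d2 *.
have y1 : `|yc z1| <= 1 by lra.
have y2 : `|yc z2| <= 1 by lra.
move: y1 y2; rewrite !ler_norml => /andP[l1 l2] /andP[l3 l4].
split; [by left | by ring | |].
  have [y0|y0] := leP 0 (yc z1); [left | right]; nra.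
by have [y0|y0] := leP 0 (yc z1); nra.
Qed.

Lemma under_graph_corner (H : R -> R) W z : 4 <= W ->
  (forall x, 0 <= x <= W -> 1 <= H x) -> xc z = 0 \/ xc z = W -> yc z = 1 \/ yc z = -1 ->
  adherent (under_graph H W) z.
Proof.
move=> W4 H1 ex ey e e0.
pose d := Num.min (e / 2) 1; have d0 : 0 < d by rewrite lt_min divr_gt0 //= ltr01.
have d1 : d <= 1 by rewrite ge_min lexx orbT.
have de : d <= e / 2 by rewrite ge_min lexx.
exists (pt2 (if xc z == 0 then d else W - d) (yc z * (1 - d))).
  rewrite /under_graph /= !pt2E; have xW : 0 < (if xc z == 0 then d else W - d) < W.
    by case: ifP => _; lra.
  split=> //; move: xW; set x := (if _ then _ else _) => xW.
  have h1 : 1 <= H x by apply: H1; lra.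
  apply: lt_le_trans h1.
  have -> : `|yc z * (1 - d)| = 1 - d.
    by rewrite normrM [`|1 - d|]ger0_norm ?subr_ge0 //; case: ey => ->; rewrite ?normrN normr1 mul1r.
  lra.
rewrite -ltr_sqr ?nnegrE ?edist_ge0 ?ltW // edist2_sqrE !pt2E.
have -> : (xc z - (if xc z == 0 then d else W - d)) ^+ 2 = d ^+ 2.
  case: eqP => [->|nx]; first by ring.
  by case: ex => // ->; ring.
have -> : (yc z - yc z * (1 - d)) ^+ 2 = d ^+ 2 by case: ey => ->; ring.
nra.
Qed.

(** The corners stay adherent to the region, so diagonals of the strip go to diagonals. The
    difference of the squared distances to two adjacent corners is affine in one coordinate, which
    recovers the coordinates of the image of any point. *)
Lemma hexagon_isometry (H H' : R -> R) W (h : 'rV[R]_2 -> 'rV[R]_2) : 4 <= W ->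
  (forall x, 0 <= x <= W -> 1 <= H x) ->
  (forall z, under_graph H' W z -> hexagon W z) ->
  (forall z1 z2, edist (h z1) (h z2) = edist z1 z2) ->
  h @` under_graph H W = under_graph H' W ->
  ((forall z, xc (h z) = xc z) \/ (forall z, xc (h z) = W - xc z)) /\
  (forall z, `|yc (h z)| = `|yc z|).
Proof.
move=> W4 H1 hex iso hU.
have iso2 z1 z2 : (xc (h z1) - xc (h z2)) ^+ 2 + (yc (h z1) - yc (h z2)) ^+ 2 =
    (xc z1 - xc z2) ^+ 2 + (yc z1 - yc z2) ^+ 2.
  by rewrite -!edist2_sqrE iso.
have corner x y : x = 0 \/ x = W -> y = 1 \/ y = -1 -> hexagon W (h (pt2 x y)).
  move=> ex ey; apply: (adherent_hexagon hex); apply: adherent_congruent iso hU _.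
  by apply: under_graph_corner; rewrite ?pt2E.
have diagonal y : y = 1 \/ y = -1 -> [/\ xc (h (pt2 0 y)) = 0 \/ xc (h (pt2 0 y)) = W,
    xc (h (pt2 W (- y))) = W - xc (h (pt2 0 y)),
    yc (h (pt2 0 y)) = 1 \/ yc (h (pt2 0 y)) = -1 &
    yc (h (pt2 W (- y))) = - yc (h (pt2 0 y))].
  move=> ey; apply: hexagon_diameter => //.
  - by apply: corner => //; left.
  - by apply: corner; [right | case: ey => ->; [right | left; ring]].
  - by rewrite iso edist2_sqrE !pt2E; case: ey => ->; nra.
have [xa xb ya yb] := diagonal 1 (or_introl erefl).
have [xa' _ ya' _] := diagonal (-1) (or_intror erefl).
have := iso2 (pt2 0 1) (pt2 0 (-1)); rewrite !pt2E => e.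
have far z := iso2 z (pt2 0 1); have far' z := iso2 z (pt2 0 (-1)).
have farb z := iso2 z (pt2 W (- 1)).
move: e far far' farb xa xb ya yb xa' ya'.
set pa := h (pt2 0 1); set pb := h (pt2 W (-1)); set pa' := h (pt2 0 (-1)).
move=> e far far' farb xa xb ya yb xa' ya'.
(* The two left corners are 2 apart, which is less than [W], so their images lie on the same
   vertical side. *)
have x_eq : xc pa' = xc pa.
  have s0 := sqr_ge0 (yc pa - yc pa'); have W2 : 16 <= W ^+ 2 by nra.
  by case: xa xa' e => -> [] -> e //; exfalso; lra.
have y_eq : yc pa' = - yc pa.
  by rewrite x_eq in e; case: ya ya' e => -> [] -> e; nra.
have yh z : yc (h z) * yc pa = yc z.
  by have := far z; have := far' z; rewrite !pt2E x_eq y_eq; case: ya => ->; lra.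
split; last first.
  move=> z; rewrite -[in RHS]yh normrM; case: ya => ->; rewrite ?normrN normr1 mulr1 //.
have W0 : W != 0 by rewrite gt_eqF //; lra.
have farx z : (xc (h z) - xc pa') ^+ 2 - (xc (h z) - xc pb) ^+ 2 = xc z ^+ 2 - (xc z - W) ^+ 2.
  by have := far' z; have := farb z; rewrite !pt2E yb y_eq; lra.
by case: xa => xa; [left | right] => z; have := farx z; rewrite x_eq xb xa => E;
   apply: (mulfI W0); lra.
Qed.

End Congruence.

Section Rigidity.
Variables (R : realType) (g : nat).
Hypothesis g_gt1 : (1 < g)%N.
Notation kn := (nsides g).
Notation kr := (nsidesR R g).
Notation cc := (curv R g).
Notation offset := (strip_offset R g).
Notation width := (strip_width R g).

Lemma unfolded_hexagon bet z : @unfolded R g bet z -> hexagon width z.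
Proof.
move=> [/andP[x0 xW] /ltW yH]; have x0W : 0 <= xc z <= width by rewrite !ltW.
split=> //; apply: le_trans yH _; first exact: height_le_left.
exact: height_le_right.
Qed.

Lemma height_bump bet b : (b < g)%N ->
  @strip_height R g bet (offset kn + (kr - (b.*2.+1)%:R)) =
  1 + vertex_y R g b.*2.+1 - (if bet b then cc else 0).
Proof.
move=> bg; have lk : (b.*2.+1 < kn)%N by rewrite /nsides; lia.
rewrite (height_chord g_gt1 bet lk); last by lra.
rewrite /cut /= uphalf_double /midv /= uphalf_double.
rewrite /diag /line /vertex_y natr_bump; case: (bet b); ring.
Qed.

Lemma unfolded_congruent bet bet' :
  congruent (@unfolded R g bet) (@unfolded R g bet') ->
  forall b, (b < g)%N -> bet b = bet' b.
Proof.
move=> [h [iso hU]].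
have W4 := width_ge4 R g_gt1; have c0 := cc_gt0 R g_gt1; have k4 := kr_ge4 R g_gt1.
have ok := @offset_ge R g g_gt1 kn; rewrite -/kr in ok.
have [xh yh] := hexagon_isometry W4 (@height_ge1 R g g_gt1 bet)
   (@unfolded_hexagon bet') iso hU.
case: xh => xh; last first.
  have g0 : (0 < g)%N by lia.
  have := height_bump bet g0; rewrite /vertex_y mulr1n => h1.
  (* The point over vertex 1, which is below the graph even if that corner is cut off. Its mirror
     image lies over abscissa 1, where [height_strip] bounds the graph by [1 + cc]. *)
  pose z : 'rV[R]_2 := pt2 (offset kn + (kr - 1)) (1 + cc).
  have Uz : @unfolded R g bet z.
    rewrite /unfolded /under_graph /= !pt2E widthE h1 ger0_norm; last by lra.
    split; first by apply/andP; split; lra.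
    have : cc * 2 < cc * (1 * (kr - 1)) by rewrite ltr_pM2l //; lra.
    by case: (bet 0%N); lra.
  have : @unfolded R g bet' (h z) by rewrite -hU; exists z.
  rewrite /unfolded /under_graph /= => -[_]; rewrite xh yh !pt2E widthE.
  rewrite (_ : offset kn + kr - (offset kn + (kr - 1)) = 1); last by ring.
  rewrite ger0_norm; last by lra.
  by have := @height_strip R g g_gt1 bet' 1 ltac:(lra); lra.
have same z : @unfolded R g bet z <-> @unfolded R g bet' z.
  have flip bt z1 z2 : xc z1 = xc z2 -> `|yc z1| = `|yc z2| ->
      @unfolded R g bt z1 -> @unfolded R g bt z2.
    by rewrite /unfolded /under_graph /= => -> ->.
  split=> [Uz|U'z].
    by apply: (flip _ (h z)) => //; rewrite -hU; exists z.
  have : (h @` @unfolded R g bet) z by rewrite hU.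
  by move=> [z0 Uz0 <-]; apply: flip Uz0; rewrite ?xh ?yh.
move=> b bg; have bk : (b.*2.+1 <= kn)%N by rewrite /nsides; lia.
have bk' : (b.*2.+1)%:R <= kr by rewrite ler_nat.
have b0 : 1 <= (b.*2.+1)%:R :> R by rewrite (ler_nat R 1).
(* The graph drops exactly to this point if the corner is cut off; the region being open, it
   contains the point only if the corner is left alone. *)
have key bt : @unfolded R g bt (pt2 (offset kn + (kr - (b.*2.+1)%:R)) (1 + vertex_y R g b.*2.+1 - cc))
   <-> ~~ bt b.
  rewrite /unfolded /under_graph /= !pt2E height_bump //.
  have tc : cc <= vertex_y R g b.*2.+1.
    have := @notch_bound R g g_gt1 xpredT _ bk; rewrite /notch /= odd_double /=; lra.
  rewrite ger0_norm; last by lra.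
  rewrite widthE; case: (bt b) => /=; split=> //; first by case=> _; lra.
  by move=> _; split; [apply/andP; split|]; lra.
have := same (pt2 (offset kn + (kr - (b.*2.+1)%:R)) (1 + vertex_y R g b.*2.+1 - cc)).
rewrite !key => -[h1 h2]; apply: negb_inj; apply/idP/idP => //.
Qed.

End Rigidity.

(** * The prism and its cut trees *)

Section Space.
Variable R : realType.
Implicit Types (x y z t : R) (v : 'rV[R]_3).

Definition ord31 : 'I_3 := @Ordinal 3 1 isT.
Definition pt3 x y z : 'rV[R]_3 :=
  \row_(i < 3) (if i == ord0 then x else if i == ord31 then y else z).
Definition px v := v 0 ord0.
Definition py v := v 0 ord31.
Definition pz v := v 0 ord_max.

Lemma px_pt3 x y z : px (pt3 x y z) = x. Proof. by rewrite /px mxE. Qed.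
Lemma py_pt3 x y z : py (pt3 x y z) = y. Proof. by rewrite /py mxE. Qed.
Lemma pz_pt3 x y z : pz (pt3 x y z) = z. Proof. by rewrite /pz mxE. Qed.
Definition pt3E := (px_pt3, py_pt3, pz_pt3).

Lemma sum3 (f : 'I_3 -> R) : \sum_i f i = f ord0 + f ord31 + f ord_max.
Proof.
by rewrite !big_ord_recl big_ord0 addr0 addrA; congr (_ + f _ + f _); apply: val_inj.
Qed.

Lemma eq_pt3 v v' : px v = px v' -> py v = py v' -> pz v = pz v' -> v = v'.
Proof.
move=> ex ey ez; apply/rowP => -[[|[|[|//]]] lt3].
- by move: ex; rewrite /px; congr (v _ _ = v' _ _); apply: val_inj.
- by move: ey; rewrite /py; congr (v _ _ = v' _ _); apply: val_inj.
- by move: ez; rewrite /pz; congr (v _ _ = v' _ _); apply: val_inj.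
Qed.

Lemma edist3_sqrE v v' :
  edist v v' ^+ 2 = (px v - px v') ^+ 2 + (py v - py v') ^+ 2 + (pz v - pz v') ^+ 2.
Proof. by rewrite edist_sqrE sum3. Qed.

Lemma seg3P v1 v2 v :
  seg v1 v2 v <-> exists t, 0 <= t <= 1 /\
    [/\ px v = (1 - t) * px v1 + t * px v2, py v = (1 - t) * py v1 + t * py v2
      & pz v = (1 - t) * pz v1 + t * pz v2].
Proof.
split=> [[t [t01 ->]]|[t [t01 [ex ey ez]]]]; exists t; split=> //.
  by rewrite /px /py /pz !mxE.
by apply: eq_pt3; rewrite ?ex ?ey ?ez /px /py /pz !mxE.
Qed.

Lemma affine3 x y z o v : affine (pt3 x y z) o v = x * px v + y * py v + z * pz v + o.
Proof. by rewrite /affine sum3 !mxE. Qed.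

End Space.

Section Prism.
Variables (R : realType) (g : nat).
Hypothesis g_gt1 : (1 < g)%N.
Notation kn := (nsides g).
Notation kr := (nsidesR R g).
Notation cc := (curv R g).
Notation ty := (vertex_y R g).

Definition zs (s : bool) : R := if s then 1 else -1.
Definition vindex : finType := (bool * 'I_kn.+1)%type.
Definition nvert := #|vindex|.
Definition vpos (u : vindex) : 'rV[R]_3 := pt3 (u.2)%:R (ty u.2) (zs u.1).
Definition prism (i : 'I_nvert) := vpos (enum_val i).

Lemma nvertE : nvert = (kn.+1).*2.
Proof. by rewrite /nvert card_prod card_bool card_ord mul2n. Qed.

Lemma zs_sqr s : zs s * zs s = 1. Proof. by case: s; rewrite /zs; ring. Qed.

Lemma vpos_inj : injective vpos.
Proof.
move=> [s l] [s' l'] e; have := congr1 (@px R) e; have := congr1 (@pz R) e.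
rewrite !pt3E /= => ez /eqP; rewrite eqr_nat => /eqP /val_inj ->.
by move: ez; rewrite /zs; case: s {e}; case: s' => // ez; exfalso; lra.
Qed.

Definition facet : finType := ('I_kn.+1 + bool)%type.
Definition fnormal (a : facet) : 'rV[R]_3 :=
  match a with
  | inl i => pt3 (ub R g i) (- ua R g i) 0
  | inr s => pt3 0 0 (- zs s)
  end.
Definition foffset (a : facet) : R :=
  match a with
  | inl i => ua R g i * ty i - ub R g i * i%:R
  | inr s => 1
  end.
Definition facet_fun a := affine (fnormal a) (foffset a).

Lemma facet_fun_side (i : 'I_kn.+1) v :
  facet_fun (inl i) v = inward g i (px v) (py v).
Proof. by rewrite /facet_fun /= affine3 /inward; ring. Qed.

Lemma facet_fun_base s v : facet_fun (inr s) v = 1 - zs s * pz v.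
Proof. by rewrite /facet_fun /= affine3; ring. Qed.

Lemma fnormal_unit a : \sum_i fnormal a 0 i ^+ 2 = 1.
Proof.
rewrite sum3 -!/(px _) -!/(py _) -!/(pz _); case: a => [i|s] /=; rewrite !pt3E.
  by have := frame_unit R g i; lra.
by have := zs_sqr s; lra.
Qed.

Lemma inQ_vpos u : inQ prism (vpos u).
Proof. by have := inQ_vertex prism (enum_rank u); rewrite /prism enum_rankK. Qed.

(** The point lies on a vertical segment from the chord to the edge above it, and both ends of that
    segment lie between two vertices. *)
Lemma inQ_base s x y : inB g x y -> inQ prism (pt3 x y (zs s)).
Proof.
move=> Bxy; have [y0 yl] := Bxy; have /andP[x0 xk] := inB_x g_gt1 Bxy.
have k4 := kr_ge4 R g_gt1.
have vert l : (l <= kn)%N -> inQ prism (pt3 l%:R (ty l) (zs s)).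
  by move=> lk; apply: (inQ_vpos (s, @Ordinal kn.+1 l lk)).
have foot : inQ prism (pt3 x 0 (zs s)).
  apply: inQ_seg (vert 0%N isT) (vert kn (leqnn _)) _.
  apply/seg3P; exists (x / kr); rewrite !pt3E ty0 ty_kn -/kr; split.
    by rewrite ler_pdivlMr ?ler_pdivrMr; lra.
  by split; [rewrite mulr0n; field; lra | ring | ring].
have k0 : (0 < kn)%N by rewrite /nsides; lia.
have := @breakpoint_piece R kn (fun l => l%:R) x k0; rewrite -/kr mulr0n x0 xk.
move=> /(_ isT)[l lk]; rewrite -natr1 => xl.
have top : inQ prism (pt3 x (line g l x) (zs s)).
  apply: inQ_seg (vert l (ltnW lk)) (vert l.+1 lk) _.
  apply/seg3P; exists (x - l%:R); rewrite !pt3E; split; first by lra.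
  by split; [rewrite -natr1; ring | rewrite /line /vertex_y -natr1; ring | ring].
apply: inQ_seg foot top _; have yl' := yl l lk.
have [e|ne] := eqVneq (line g l x) 0.
  apply/seg3P; exists 0; rewrite !pt3E; split; first by lra.
  by split; [ring | lra | ring].
apply/seg3P; exists (y / line g l x); rewrite !pt3E; split.
  by rewrite ler_pdivlMr ?ler_pdivrMr //; lra.
by split; [ring | field | ring].
Qed.

Lemma inQ_prism v : inQ prism v <-> inB g (px v) (py v) /\ -1 <= pz v <= 1.
Proof.
split=> [Qv|[Bv zv]].
  have pos a : 0 <= facet_fun a v.
    apply: inQ_affine_ge0 Qv => i; rewrite -/(facet_fun a _) /prism; case: a => [j|s].
      rewrite facet_fun_side /vpos !pt3E; apply: inB_inward; first by rewrite -ltnS.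
      by apply: inB_vertex => //; rewrite -ltnS.
    by rewrite facet_fun_base /vpos !pt3E /zs; case: s; case: (_.1); lra.
  split.
    apply/inBP => i ik; have := pos (inl (@Ordinal kn.+1 i ik)).
    by rewrite facet_fun_side.
  have := pos (inr true); have := pos (inr false); rewrite !facet_fun_base /zs => h1 h2.
  by apply/andP; split; lra.
apply: inQ_seg (inQ_base false Bv) (inQ_base true Bv) _.
apply/seg3P; exists ((1 + pz v) / 2); rewrite !pt3E /zs; split; first by lra.
by split; [ring | ring | field].
Qed.

Lemma inQP v : inQ prism v <-> forall a, 0 <= facet_fun a v.
Proof.
rewrite inQ_prism; split=> [[Bv /andP[z0 z1]] [i|s]|pos].
- by rewrite facet_fun_side; apply: inB_inward; rewrite // -ltnS.
- by rewrite facet_fun_base /zs; case: s; lra.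
split.
  apply/inBP => i ik; have := pos (inl (@Ordinal kn.+1 i ik)).
  by rewrite facet_fun_side.
have := pos (inr true); have := pos (inr false); rewrite !facet_fun_base /zs => h1 h2.
by apply/andP; split; lra.
Qed.

Lemma prism_polytope : is_polytope prism.
Proof.
have c0 := cc_gt0 R g_gt1.
split; first by move=> i j /vpos_inj /enum_val_inj.
split.
  move=> i; set u := enum_val i.
  (* [diag_slope] is also the slope of the tangent to the parabola at the vertex. All other vertices
     of the base are strictly below the tangent, and the third coordinate separates the two
     bases. *)
  pose nv := pt3 (diag_slope R g u.2) (-1) (- zs u.1).
  apply: (@extreme_vertex _ _ _ nv (ty u.2 - diag_slope R g u.2 * (u.2)%:R + 1)).
    by rewrite affine3 /prism /vpos -/u !pt3E; have := zs_sqr u.1; lra.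
  move=> j ji; have {ji}wu : enum_val j != u by rewrite (inj_eq enum_val_inj).
  move: wu; rewrite affine3 /prism /vpos; set w := enum_val j => wu; rewrite !pt3E.
  have -> : diag_slope R g u.2 * (w.2)%:R + -1 * ty w.2 + - zs u.1 * zs w.1 +
     (ty u.2 - diag_slope R g u.2 * (u.2)%:R + 1) =
     cc * ((w.2)%:R - (u.2)%:R) ^+ 2 + (1 - zs u.1 * zs w.1).
    by rewrite /diag_slope /vertex_y; ring.
  have z0 : 0 <= 1 - zs u.1 * zs w.1 by rewrite /zs; case: (u.1); case: (w.1); lra.
  have q0 : 0 <= cc * ((w.2)%:R - (u.2)%:R) ^+ 2 by rewrite mulr_ge0 ?sqr_ge0 ?ltW.
  have [e2|n2] := eqVneq w.2 u.2; last first.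
    suff : 0 < cc * ((w.2)%:R - (u.2)%:R) ^+ 2 by lra.
    by rewrite mulr_gt0 // exprn_even_gt0 //= subr_eq0 eqr_nat.
  suff : 0 < 1 - zs u.1 * zs w.1 by lra.
  have : w.1 != u.1 by apply: contraNneq wu => e1; rewrite [w]surjective_pairing e1 e2 -surjective_pairing.
  by rewrite /zs; case: (u.1); case: (w.1) => // _; lra.
have k4 := kr_ge4 R g_gt1.
have t1 : ty 1 = cc * (kr - 1) by rewrite /vertex_y; ring.
have t0 : 0 < ty 1 by rewrite t1 mulr_gt0 //; lra.
exists (pt3 1 (ty 1 / 2) 0).
apply: (interior_ball fnormal_unit inQP) => -[[i ik]|s]; last first.
  by rewrite -/(facet_fun _ _) facet_fun_base pt3E mulr0; lra.
rewrite -/(facet_fun _ _) facet_fun_side !pt3E /=.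
move: ik; rewrite ltnS leq_eqVlt => /orP[/eqP ->|ik].
  by rewrite inward_chord; lra.
have h0 := hyp_gt0 R g i; rewrite -(pmulr_lgt0 _ h0) inward_edge //.
have k1 : (1 <= kn)%N by rewrite /nsides; lia.
by have [_ /(_ i ik)] := inB_vertex R g_gt1 k1; rewrite mulr1n; lra.
Qed.

Lemma surf_prism v : surf prism v <->
  [/\ inB g (px v) (py v), -1 <= pz v <= 1
    & pz v * pz v = 1 \/ exists2 i, (i <= kn)%N & inward g i (px v) (py v) = 0].
Proof.
rewrite (surfP fnormal_unit inQP) -inQP inQ_prism; split=> [[[Bv zv] [a aE]]|[Bv zv h]].
  split=> //; move: aE; rewrite -/(facet_fun a v); case: a => [i|s].
    by rewrite facet_fun_side => h; right; exists i; rewrite // -ltnS.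
  by rewrite facet_fun_base => h; left; have := zs_sqr s; nra.
split=> //; case: h => [zz|[i ik h]]; last first.
  by exists (inl (@Ordinal kn.+1 i ik)); rewrite -/(facet_fun _ _) facet_fun_side.
have [z0|z0] := leP 0 (pz v).
  by exists (inr true); rewrite -/(facet_fun _ _) facet_fun_base /zs; nra.
by exists (inr false); rewrite -/(facet_fun _ _) facet_fun_base /zs; nra.
Qed.

End Prism.

(** * The cuts on a base as segments *)

Section PlanarTree.
Variables (R : realType) (g : nat).
Hypothesis g_gt1 : (1 < g)%N.
Implicit Types (x y t : R) (i j l b : nat).
Notation kn := (nsides g).
Notation cc := (curv R g).
Notation ty := (vertex_y R g).
Notation mu := (diag_slope R g).

(** The factor that takes the normal [(mu, -1)] of the chord to the altitude: the vertical gap [cc]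
    divided by the squared length of the normal. *)
Definition tau b : R := cc / (1 + mu b.*2.+1 ^+ 2).
(* The foot of the perpendicular from the vertex 2b + 1 to the chord of its neighbors. *)
Definition sx b : R := (b.*2.+1)%:R + tau b * mu b.*2.+1.
Definition sy b : R := ty b.*2.+1 - tau b.

Lemma tau_eq b : tau b * (1 + mu b.*2.+1 ^+ 2) = cc.
Proof. by rewrite mulfVK // gt_eqF //; have := sqr_ge0 (mu b.*2.+1); lra. Qed.

Lemma tau_bound b : 0 < tau b <= cc.
Proof. by have := tau_eq b; have := sqr_ge0 (mu b.*2.+1); have := cc_gt0 R g_gt1; nra. Qed.

Lemma sx_bound b : (b < g)%N -> - 4^-1 <= sx b - (b.*2.+1)%:R <= 4^-1.
Proof.
move=> bg; rewrite /sx addrAC subrr add0r.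
have h : (b.*2.+1 <= kn)%N by rewrite /nsides; lia.
have /andP[m1 m2] := mu_bound R g_gt1 h; have /andP[t0 t1] := tau_bound b.
have := cc_le R g_gt1; nra.
Qed.

Lemma nrm_stem b x y : nrm g b.*2.+1 x y = (x - sx b) + mu b.*2.+1 * (y - sy b).
Proof. by rewrite /nrm /sx /sy; ring. Qed.

Lemma diag_stem b x : diag g b.*2.+1 x - sy b = mu b.*2.+1 * (x - sx b).
Proof.
rewrite /sy /sx; have -> : diag g b.*2.+1 x = ty b.*2.+1 - cc + mu b.*2.+1 * (x - b.*2.+1%:R).
  by rewrite /diag /vertex_y /diag_slope; ring.
rewrite -{1}(tau_eq b); ring.
Qed.

Lemma stem_point b x y : nrm g b.*2.+1 x y = 0 -> y = diag g b.*2.+1 x ->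
  x = sx b /\ y = sy b.
Proof.
rewrite nrm_stem => n0 yd; have := diag_stem b x; rewrite -yd => e.
have m2 := sqr_ge0 (mu b.*2.+1); have x0 : x - sx b = 0.
  have : (x - sx b) * (1 + mu b.*2.+1 ^+ 2) = 0.
    by rewrite -n0 e; ring.
  by move/eqP; rewrite mulf_eq0 => /orP[/eqP //|/eqP]; lra.
by rewrite x0 mulr0 in e; split; lra.
Qed.

Lemma inB_convex x y x' y' t : 0 <= t <= 1 -> inB g x y -> inB g x' y' ->
  inB g ((1 - t) * x + t * x') ((1 - t) * y + t * y').
Proof.
move=> /andP[t0 t1] [y0 yl] [y0' yl']; split=> [|i ik].
  by rewrite addr_ge0 ?mulr_ge0 ?subr_ge0.
have -> : line g i ((1 - t) * x + t * x') = (1 - t) * line g i x + t * line g i x'.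
  by rewrite /line; ring.
by rewrite lerD ?ler_wpM2l ?subr_ge0 ?yl ?yl'.
Qed.

Lemma diag_ends b :
  diag g b.*2.+1 (b.*2)%:R = ty b.*2 /\ diag g b.*2.+1 (b.*2.+2)%:R = ty b.*2.+2.
Proof. by rewrite /diag /vertex_y natr_bump natr_dbl natr_bumpS; split; ring. Qed.

Lemma inB_stem b : (b < g)%N -> inB g (sx b) (sy b).
Proof.
move=> bg; have := sx_bound bg; rewrite natr_bump => sb; have c0 := cc_gt0 R g_gt1.
have e : sy b = diag g b.*2.+1 (sx b).
  by have := diag_stem b (sx b); rewrite subrr mulr0; lra.
apply: (cap_inB g_gt1 bg); first by rewrite e.
  by rewrite e -subr_ge0 line_diag_left mulr_ge0 ?(ltW c0) //; lra.
by rewrite e -subr_ge0 line_diag_right mulr_ge0 ?(ltW c0) //; lra.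
Qed.

Lemma nrm_vertex i l : (i < kn)%N -> line g i l%:R = ty l ->
  nrm g (midv i) l%:R (ty l) = (l%:R - (midv i)%:R) * edge_den R g i.
Proof. by move=> ik e; rewrite /nrm -e line_midv /edge_den; ring. Qed.

Lemma nrm_even b : (b < g)%N -> nrm g b.*2.+1 (b.*2)%:R (ty b.*2) < 0.
Proof.
move=> bg; have ik : (b.*2 < kn)%N by rewrite /nsides; lia.
have := @nrm_vertex b.*2 b.*2 ik; have := line_vertex R g b.*2 b.*2.
rewrite subrr mul0r mulr0 /midv doubleK => e h; rewrite h; last by lra.
by have := den_gt R g_gt1 ik; rewrite natr_bump natr_dbl; nra.
Qed.

Lemma nrm_odd b : (b < g)%N -> 0 < nrm g b.*2.+1 (b.*2.+2)%:R (ty b.*2.+2).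
Proof.
move=> bg; have ik : (b.*2.+1 < kn)%N by rewrite /nsides; lia.
have := @nrm_vertex b.*2.+1 b.*2.+2 ik; have := line_vertex R g b.*2.+1 b.*2.+2.
rewrite /midv /= uphalf_double natr_bump natr_bumpS.
rewrite (_ : _ * (_ - 1) = 0 :> R) ?mulr0; last by ring.
move=> e h; rewrite h; last by lra.
by have := den_gt R g_gt1 ik; nra.
Qed.

Variable bet : nat -> bool.

(** Arc [i] runs from the even end of its edge to the corner, or to the foot of the altitude if the
    corner is cut off. *)
Definition outer i := if odd i then i.+1 else i.
Definition innerx i : R := if bet i./2 then sx i./2 else (midv i)%:R.
Definition innery i : R := if bet i./2 then sy i./2 else ty (midv i).

(** [cutarc] describes the arc by inequalities, as the pieces need it; the cut tree consists of
    segments. *)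
Lemma arc_param i x y : (i < kn)%N ->
  cutarc g bet i x y <-> exists t, 0 <= t <= 1 /\
    (x = (1 - t) * (outer i)%:R + t * innerx i /\ y = (1 - t) * ty (outer i) + t * innery i).
Proof.
move=> ik; have bg := half_lt g_gt1 ik; have c0 := cc_gt0 R g_gt1.
have oB : inB g (outer i)%:R (ty (outer i)).
  by apply: inB_vertex => //; rewrite /outer; case: ifP => _; lia.
have iB : inB g (innerx i) (innery i).
  rewrite /innerx /innery; case: ifP => _; first exact: inB_stem.
  by apply: inB_vertex => //; apply: midv_le.
have e := odd_double_half i; have sE : sy i./2 = diag g (midv i) (sx i./2).
  by have := diag_stem i./2 (sx i./2); rewrite subrr mulr0 /midv; lra.
have oE : ty (outer i) = diag g (midv i) (outer i)%:R.
  have [d1 d2] := diag_ends i./2; rewrite /outer /midv; move: e; case: (odd i) => /= e.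
    by have -> : i.+1 = (i./2).*2.+2 by lia.
  have iE : i = (i./2).*2 by lia.
  by rewrite {1 3}iE.
split=> [[Bxy [_ [yc s]]]|[t [t01 [xE yE]]]].
  have dy : cap g i./2 x y by apply: (@cut_cap _ _ g_gt1 bet i x y Bxy ik); rewrite -yc.
  have /andP[x1 x2] := cap_x g_gt1 bg dy.
  move: yc s; rewrite /cut /side /innerx /innery; case bi: (bet i./2); last first.
    move=> yl _; have := line_range g_gt1 Bxy ik; rewrite -yl lexx => /(_ isT) xi.
    rewrite /outer /midv; move: e; case: (odd i) => /= e.
      exists (i%:R + 1 - x); split; first by lra.
      rewrite yl /line /vertex_y (_ : (i./2).*2.+1 = i); last by lia.
      by rewrite -natr1; split; ring.
    exists (x - i%:R); split; first by lra.
    rewrite yl /line /vertex_y (_ : (i./2).*2.+1 = i.+1); last by lia.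
    by rewrite -natr1; split; ring.
  move=> yd s; have sb := sx_bound bg; rewrite natr_bump in sb.
  have m2 := sqr_ge0 (mu (midv i)).
  have nE : nrm g (midv i) x y = (x - sx i./2) * (1 + mu (midv i) ^+ 2).
    by rewrite nrm_stem; have := diag_stem i./2 x; rewrite -/(midv i) -yd => ->; ring.
  have ox : ((outer i)%:R < sx i./2 /\ (outer i)%:R <= x <= sx i./2) \/
            (sx i./2 < (outer i)%:R /\ sx i./2 <= x <= (outer i)%:R).
    rewrite nE in s; rewrite /outer; move: e s; case: (odd i) => /= e s.
      by right; rewrite (_ : i.+1 = (i./2).*2.+2) ?natr_bumpS; [split; nra | lia].
    by left; rewrite -e add0n natr_dbl doubleK; split; nra.
  have [q qE] : exists q, q = sx i./2 - (outer i)%:R by exists (sx i./2 - (outer i)%:R).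
  have sxE : sx i./2 = (outer i)%:R + q by rewrite qE; ring.
  rewrite sxE in ox; have q0 : q != 0 by apply/eqP => q0; lra.
  exists ((x - (outer i)%:R) / q); split.
    by case: ox => -[h1 h2]; [rewrite ler_pdivlMr ?ler_pdivrMr | rewrite ler_ndivlMr ?ler_ndivrMr]; lra.
  by rewrite yd oE sE sxE /diag; split; field.
have /andP[t0 t1] := t01.
have Bxy : inB g x y by rewrite xE yE; apply: inB_convex.
split=> //; split=> //.
move: xE yE; rewrite /cut /innerx /innery => xE yE.
case bi: (bet i./2) in xE yE *; last first.
  have yl : y = line g i x.
    rewrite xE yE /outer; move: e; rewrite /midv; case: (odd i) => /= e.
      by rewrite (_ : (i./2).*2.+1 = i); [rewrite /line /vertex_y -natr1; ring | lia].
    by rewrite (_ : (i./2).*2.+1 = i.+1); [rewrite /line /vertex_y -natr1; ring | lia].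
  have ly : line g i x <= y by rewrite yl.
  by have [_ _ s] := edge_side g_gt1 Bxy ik ly.
split; first by rewrite yE oE sE xE /diag; ring.
have nE : nrm g (midv i) x y = (1 - t) * nrm g (midv i) (outer i)%:R (ty (outer i)).
  have n0 : nrm g (midv i) (sx i./2) (sy i./2) = 0 by rewrite nrm_stem !subrr mulr0 addr0.
  rewrite -[RHS]addr0 -[X in _ + X](mulr0 t) -n0 xE yE /nrm; ring.
rewrite /side nE; have h1 := nrm_even bg; have h2 := nrm_odd bg.
rewrite /outer /midv; move: e; case: (odd i) => /= e.
  rewrite mulr_ge0 ?subr_ge0 // (_ : i.+1 = (i./2).*2.+2); last by lia.
  exact: ltW.
have iE : i = (i./2).*2 by lia.
by rewrite mulr_ge0_le0 ?subr_ge0 // {2 3}iE ltW.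
Qed.

Lemma stem_param b x y : (b < g)%N -> bet b ->
  stem g bet b x y <-> exists t, 0 <= t <= 1 /\
    (x = (1 - t) * (b.*2.+1)%:R + t * sx b /\ y = (1 - t) * ty b.*2.+1 + t * sy b).
Proof.
move=> bg bb; have /andP[t0 t1] := tau_bound b; have tE := tau_eq b.
have m2 := sqr_ge0 (mu b.*2.+1); have jk : (b.*2.+1 < kn)%N by rewrite /nsides; lia.
have /andP[m0 m1] := mu_bound R g_gt1 (ltnW jk).
have dE x' : diag g b.*2.+1 x' = ty b.*2.+1 - cc + mu b.*2.+1 * (x' - b.*2.+1%:R).
  by rewrite /diag /vertex_y /diag_slope; ring.
split=> [[Bxy [_ [_ [n0 dy]]]]|[t [/andP[t2 t3] [xE yE]]]].
  pose r := ty b.*2.+1 - y.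
  have xE : x = b.*2.+1%:R + mu b.*2.+1 * r by move: n0; rewrite /nrm /r; lra.
  have r1 : r * (1 + mu b.*2.+1 ^+ 2) <= cc.
    by move: dy; rewrite dE {1}xE /r; lra.
  have r0 : 0 <= r.
    have [_ /(_ b.*2.+1 jk)] := Bxy; rewrite line_midv /midv /= uphalf_double {1}xE => h.
    have h' : 0 <= r * (1 + edge_slope R g b.*2.+1 * mu b.*2.+1) by rewrite /r in h *; lra.
    have := den_gt R g_gt1 jk; rewrite /edge_den /midv /= uphalf_double => d0.
    have d1 : 0 < 1 + edge_slope R g b.*2.+1 * mu b.*2.+1 by lra.
    by rewrite pmulr_lge0 in h'.
  exists (r / tau b); split.
    by rewrite divr_ge0 ?(ltW t0) //= ler_pdivrMr // mul1r; nra.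
  have tn : tau b != 0 by rewrite gt_eqF.
  by rewrite /sx /sy; split; [rewrite xE; field | rewrite /r; field].
have x' : x = b.*2.+1%:R + t * tau b * mu b.*2.+1 by rewrite xE /sx; ring.
have y' : y = ty b.*2.+1 - t * tau b by rewrite yE /sy; ring.
split.
  rewrite xE yE; apply: inB_convex; [by rewrite t2 | | exact: inB_stem].
  by apply: inB_vertex => //; apply: ltnW.
do 2!split=> //; split; first by rewrite /nrm x' y'; ring.
have : t * cc <= cc by nra.
by rewrite dE x' y' -{1 3}tE; nra.
Qed.

Lemma cutarc_cap i x y : cutarc g bet i x y -> cap g i./2 x y.
Proof. by move=> [Bxy [ik [yc _]]]; apply: (@cut_cap _ _ g_gt1 bet i x y); rewrite -?yc. Qed.

Lemma stem_cap b x y : stem g bet b x y -> cap g b x y.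
Proof. by move=> [Bxy [_ [_ [_ dy]]]]; split. Qed.

Lemma cap_vertex b l : (b < g)%N -> cap g b l%:R (ty l) ->
  [\/ l = b.*2, l = b.*2.+1 | l = b.*2.+2].
Proof.
move=> bg /(cap_x g_gt1 bg); have -> : 2 * b%:R + 2 = (b.*2.+2)%:R :> R by rewrite natr_bumpS.
rewrite -natr_dbl !ler_nat => lb.
have : (l == b.*2) || (l == b.*2.+1) || (l == b.*2.+2) by lia.
by case/orP => [/orP[]|] /eqP ->; [constructor 1|constructor 2|constructor 3].
Qed.

(** Distinct ears meet only over an even integer, while the foot of an altitude is within 1/4 of an
    odd one. *)
Lemma cap_stem_point b b' : (b < g)%N -> (b' < g)%N -> cap g b (sx b') (sy b') -> b = b'.
Proof.
move=> bg b'g cb; have cb' : cap g b' (sx b') (sy b').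
  split; first exact: inB_stem.
  by have := diag_stem b' (sx b'); rewrite subrr mulr0; lra.
have := sx_bound b'g; rewrite natr_bump => sb.
case: (ltngtP b b') => // lt.
  have [e x1 _] := cap_inter g_gt1 lt b'g cb cb'.
  have {e}bE : b'%:R = b%:R + 1 :> R by rewrite e natr1.
  by exfalso; rewrite natr_bumpS in x1; lra.
have [e x1 _] := cap_inter g_gt1 lt bg cb' cb.
have {e}bE : b%:R = b'%:R + 1 :> R by rewrite e natr1.
by exfalso; rewrite natr_bumpS in x1; lra.
Qed.

Lemma cutarc_vertex i l : (i < kn)%N -> cutarc g bet i l%:R (ty l) ->
  l = outer i \/ ~~ bet i./2 /\ l = midv i.
Proof.
move=> ik ar; have bg := half_lt g_gt1 ik; have cl := cutarc_cap ar.
case: ar => Bl [_ [yc s]]; have e := odd_double_half i.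
have c0 := cc_gt0 R g_gt1.
move: yc s; rewrite /cut /side /outer /midv; case bi: (bet i./2) => yc s.
  left; case: (cap_vertex bg cl) => lE.
  - move: s; rewrite lE; case: (odd i) e => /= e; last by lia.
    by have := nrm_even bg => h1 h2; exfalso; clear e lE; lra.
  - move: yc; rewrite lE; have := diag_stem i./2 (i./2.*2.+1)%:R.
    have /andP[t0 t1] := tau_bound i./2; have := tau_eq i./2; rewrite /sx /sy.
    by move=> {e lE s} h1 h2 h3; exfalso; nra.
  - move: s; rewrite lE; case: (odd i) e => /= e; first by lia.
    by have := nrm_odd bg => h1 h2; exfalso; clear e lE; lra.
have : (l%:R - i%:R) * (l%:R - i%:R - 1) = 0 :> R.
  have := line_vertex R g i l; rewrite -yc subrr => /esym/eqP; rewrite mulf_eq0.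
  by rewrite gt_eqF //= => /eqP.
move/eqP; rewrite mulf_eq0 subr_eq0 eqr_nat -addrA -opprD subr_eq0 natr1 eqr_nat.
by case/orP => /eqP ->; move: e; case: (odd i) => /= e; [right; split=> //; lia | left | left | right; split=> //; lia].
Qed.

Lemma stem_vertex b l : stem g bet b l%:R (ty l) -> l = b.*2.+1.
Proof.
move=> st; have := stem_cap st; case: st => _ [bg [_ [n0 _]]] /(cap_vertex bg)[] lE //.
  by have := nrm_even bg; move: n0; rewrite lE => ->; rewrite ltxx.
by have := nrm_odd bg; move: n0; rewrite lE => ->; rewrite ltxx.
Qed.

Lemma sx_neq_vertex b l : (b < g)%N -> sx b = l%:R -> sy b <> ty l.
Proof.
move=> bg xl yl; have cb : cap g b l%:R (ty l).
  rewrite -xl -yl; split; first exact: inB_stem.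
  by have := diag_stem b (sx b); rewrite subrr mulr0; lra.
have := sx_bound bg; have /andP[t0 _] := tau_bound b.
case: (cap_vertex bg cb) => lE; rewrite xl lE natr_bump ?natr_dbl ?natr_bumpS; try (clear lE; lra).
by move=> _; move: yl; rewrite lE /sy; clear lE; lra.
Qed.

Lemma cutarc_inter i i' x y : (i < i')%N -> cutarc g bet i x y -> cutarc g bet i' x y ->
  (exists2 l, (l <= kn)%N & x = l%:R /\ y = ty l) \/
  (exists2 b, (b < g)%N & bet b /\ (x = sx b /\ y = sy b)).
Proof.
move=> lt ar ar'; have cb := cutarc_cap ar; have cb' := cutarc_cap ar'.
case: ar ar' => Bxy [ik [yc s]] [_ [ik' [yc' s']]].
have bg := half_lt g_gt1 ik; have bg' := half_lt g_gt1 ik'.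
have [e|ne] := eqVneq i./2 i'./2; last first.
  have lt_b : (i./2 < i'./2)%N by rewrite ltn_neqAle ne half_leq // ltnW.
  have [_ -> ->] := cap_inter g_gt1 lt_b bg' cb cb'.
  by left; exists (i./2.*2.+2) => //; rewrite /nsides; lia.
have oi : odd i = false by lia.
have oi' : odd i' = true by lia.
move: yc s yc' s'; rewrite /cut /side oi oi' /midv -e.
case bi: (bet i./2) => yc s yc' s'.
  right; exists i./2 => //; split=> //; apply: stem_point => //.
  by apply/le_anti; rewrite s.
left; exists (midv i); first exact: midv_le.
have : line g i x - line g i' x = 0 by rewrite -yc -yc' subrr.
have -> : i' = i.+1 by lia.
rewrite lineB => /eqP; rewrite mulf_eq0 (gt_eqF (cc_gt0 R g_gt1)) /= -natr1.
rewrite mulf_eq0 => /orP[/eqP|/eqP] h; first by exfalso; clear e oi oi'; lra.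
have xE : x = (midv i)%:R.
  by rewrite /midv natr_bump; have := natr_half R i; rewrite oi /=; lra.
by split=> //; rewrite yc line_midv xE subrr mulr0 addr0.
Qed.

Lemma cutarc_stem_inter i b x y : cutarc g bet i x y -> stem g bet b x y ->
  (exists2 l, (l <= kn)%N & x = l%:R /\ y = ty l) \/
  (exists2 b, (b < g)%N & bet b /\ (x = sx b /\ y = sy b)).
Proof.
move=> ar st; have cb := cutarc_cap ar; have cb' := stem_cap st.
case: ar st => Bxy [ik [yc s]] [_ [bg' [bb [n0 dy]]]].
have bg := half_lt g_gt1 ik.
have vert b1 : (b1 < g)%N -> x = (b1.*2.+2)%:R -> y = ty b1.*2.+2 ->
    exists2 l, (l <= kn)%N & x = l%:R /\ y = ty l.
  by move=> b1g -> ->; exists b1.*2.+2 => //; rewrite /nsides; lia.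
case: (ltngtP i./2 b) => lt.
- by have [_ x1 y1] := cap_inter g_gt1 lt bg' cb cb'; left; apply: vert x1 y1.
- by have [_ x1 y1] := cap_inter g_gt1 lt bg cb' cb; left; apply: vert x1 y1.
right; exists b => //; split=> //; apply: stem_point => //.
by rewrite yc /cut lt bb /midv lt.
Qed.

Lemma stem_inter b b' x y : (b < b')%N -> stem g bet b x y -> stem g bet b' x y ->
  exists2 l, (l <= kn)%N & x = l%:R /\ y = ty l.
Proof.
move=> lt st st'; have [_ [bg' _]] := st'.
have [_ -> ->] := cap_inter g_gt1 lt bg' (stem_cap st) (stem_cap st').
by exists b.*2.+2 => //; rewrite /nsides; lia.
Qed.

End PlanarTree.

(** * Cut trees with straight arcs *)

Section StraightTree.
Variables (R : realType) (Nd Ar : finType) (pos : Nd -> 'rV[R]_3) (ends : Ar -> Nd * Nd).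

Definition straight_tree : cut_tree R :=
  @CutTree R #|Nd| #|Ar| (fun i => pos (enum_val i))
    (fun e => (enum_rank (ends (enum_val e)).1, enum_rank (ends (enum_val e)).2))
    (fun _ => [::]).

Definition straight_arc (a : Ar) := seg (pos (ends a).1) (pos (ends a).2).

Lemma arcset_straight (e : 'I_#|Ar|) z :
  arcset (T := straight_tree) e z <-> straight_arc (enum_val e) z.
Proof.
rewrite /arcset /arc_poly /straight_arc /=; split=> [[j [lt_j]]|h].
  by case: j lt_j => [|[|j]] //= _; rewrite !enum_rankK.
by exists 0%N; rewrite /= !enum_rankK.
Qed.

Lemma treeset_straight z : treeset straight_tree z <-> exists a, straight_arc a z.
Proof.
split=> [[e /arcset_straight h]|[a h]]; first by exists (enum_val e).
by exists (enum_rank a); apply/arcset_straight; rewrite enum_rankK.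
Qed.

Variables (n : nat) (V : 'I_n -> 'rV[R]_3).

(** For a node that is not at a vertex of the polytope, the degree is estimated at second end points
    only; in the trees below the arcs are directed such that this suffices. *)
Lemma straight_cut_tree :
  (#|Ar|.+1 = #|Nd|)%N ->
  (forall P : pred Nd, (exists u, P u) -> (forall a, P (ends a).1 = P (ends a).2) ->
     forall u, P u) ->
  injective pos ->
  (forall a, (ends a).1 != (ends a).2) ->
  (forall a, straight_arc a `<=` surf V) ->
  (forall a a' z, a != a' -> straight_arc a z -> straight_arc a' z -> exists u, z = pos u) ->
  (forall a u, straight_arc a (pos u) -> u = (ends a).1 \/ u = (ends a).2) ->
  (forall u, (exists v, pos u = V v) \/ (2 < #|[set a | (ends a).2 == u]|)%N) ->
  (forall v, exists u, pos u = V v) ->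
  is_cut_tree V straight_tree.
Proof.
move=> card conn pos_inj loop on_surf inter node deg vert.
split=> //; split.
  move=> S [i iS] closed i'; rewrite -(enum_valK i').
  apply: (conn (fun u => enum_rank u \in S)); first by exists (enum_val i); rewrite enum_valK.
  by move=> a; have := closed (enum_rank a); rewrite /= enum_rankK.
split; first by move=> i i' /pos_inj /enum_val_inj.
split.
  move=> e; split=> [[|j] lt_j|j1 [|j2] z //].
    rewrite /arc_poly /= !enum_rankK; apply/eqP => /pos_inj/eqP.
    by rewrite (negbTE (loop _)).
  by move: lt_j; rewrite /arc_poly.
split; first by move=> z /treeset_straight[a]; apply: on_surf.
split.
  move=> e e' z ne /arcset_straight h /arcset_straight h'.
  have [|u ->] := inter _ _ z _ h h'; first by rewrite (inj_eq enum_val_inj).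
  by exists (enum_rank u); rewrite /= enum_rankK.
split.
  move=> e i /arcset_straight /node h.
  by case: h => h; [left|right]; rewrite /= -h enum_valK.
split.
  move=> i; case: (deg (enum_val i)) => [|big]; first by left.
  right; rewrite /ct_deg; apply/eqP => deg2.
  have : (#|[set a | (ends a).2 == enum_val i]| <= 2)%N.
    rewrite -deg2 -(card_imset _ enum_rank_inj); apply: leq_trans (leq_addl _ _).
    apply: subset_leq_card; apply/fintype.subsetP => x /imsetP[a]; rewrite inE => /eqP h ->.
    by rewrite inE /= enum_rankK h enum_valK.
  by rewrite leqNgt big.
by move=> v _; have [u h] := vert v; exists (enum_rank u); rewrite /= enum_rankK.
Qed.

End StraightTree.

(** * The cut tree of a set of corners *)

Section PrismTree.
Variables (R : realType) (g : nat).
Hypothesis g_gt1 : (1 < g)%N.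
Notation kn := (nsides g).
Notation ty := (vertex_y R g).
Variable S : {set 'I_g}.

(** The planar part is indexed by natural numbers; this is the characteristic function of [S], false
    from [g] on. *)
Definition bits (b : nat) : bool := [exists c : 'I_g, (c \in S) && (c == b :> nat)].

Lemma bitsE (b : 'I_g) : bits b = (b \in S).
Proof.
apply/existsP/idP => [[c /andP[cS /eqP e]]|bS]; last by exists b; rewrite bS /=.
by rewrite -(val_inj e : c = b).
Qed.

Definition bumps : finType := {b : 'I_g | b \in S}.
Definition node : finType := (bool * ('I_kn.+1 + bumps))%type.
(** [None] is the vertical edge that joins the bases, the others are the arcs and altitudes on each
    base. Each altitude adds one link and one node. *)
Definition link : finType := option (bool * ('I_kn + bumps)).

Definition node_pos (u : node) : 'rV[R]_3 :=
  match u.2 with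
  | inl l => vpos R (u.1, l)
  | inr b => pt3 (sx R g (val b)) (sy R g (val b)) (zs R u.1)
  end.

Definition half_ord (i : 'I_kn) : 'I_g := Ordinal (half_lt g_gt1 (ltn_ord i)).

(** [insub] succeeds exactly if the corner of edge [i] is cut off. All three links at the foot of an
    altitude have it as second end. *)
Definition link_ends (a : link) : node * node :=
  match a with
  | None => ((false, inl ord0), (true, inl ord0))
  | Some (s, inl i) => ((s, inl (inord (outer i))),
      (s, if insub (half_ord i) is Some b then inr b else inl (inord (midv i))))
  | Some (s, inr b) => ((s, inl (inord (val b).*2.+1)), (s, inr b))
  end.

Definition prism_tree := straight_tree node_pos link_ends.

Lemma node_pz u : pz (node_pos u) = zs R u.1.
Proof. by case: u => s [l|b]; rewrite /node_pos /= ?/vpos pt3E. Qed.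

Lemma outer_le (i : 'I_kn) : (outer i < kn.+1)%N.
Proof. by rewrite /outer; have := ltn_ord i; case: ifP => _; lia. Qed.

Lemma midv_lt (i : 'I_kn) : (midv i < kn.+1)%N.
Proof. by rewrite ltnS; apply: midv_le. Qed.

Lemma bump_mid_lt (b : 'I_g) : (b.*2.+1 < kn.+1)%N.
Proof. by rewrite /nsides; have := ltn_ord b; lia. Qed.

Lemma inner_pos s (i : 'I_kn) :
  node_pos (link_ends (Some (s, inl i))).2 =
  pt3 (innerx R g bits i) (innery R g bits i) (zs R s).
Proof.
rewrite /= /node_pos /= /innerx /innery -[i./2]/(val (half_ord i)) bitsE.
case: insubP => [b bS bE|/negbTE ->]; first by rewrite bS -bE.
by rewrite /vpos /= inordK ?midv_lt.
Qed.

Lemma straight_edge s (i : 'I_kn) z :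
  straight_arc node_pos link_ends (Some (s, inl i)) z <->
  pz z = zs R s /\ cutarc g bits i (px z) (py z).
Proof.
rewrite /straight_arc inner_pos seg3P /= /node_pos /= /vpos /= inordK ?outer_le // !pt3E.
rewrite (arc_param g_gt1) //; split=> [[t [t01 [ex ey ez]]]|[ez [t [t01 [ex ey]]]]].
  by split; [rewrite ez; ring | exists t].
by exists t; split=> //; split=> //; rewrite ez; ring.
Qed.

Lemma straight_stem s (b : bumps) z :
  straight_arc node_pos link_ends (Some (s, inr b)) z <->
  pz z = zs R s /\ stem g bits (val b) (px z) (py z).
Proof.
rewrite /straight_arc seg3P /= /node_pos /= /vpos /= inordK ?bump_mid_lt // !pt3E.
have bb : bits (val b) by rewrite bitsE (valP b).
rewrite (stem_param g_gt1 _ _ (ltn_ord (val b)) bb); split=> [[t [t01 [ex ey ez]]]|[ez [t [t01 [ex ey]]]]].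
  by split; [rewrite ez; ring | exists t].
by exists t; split=> //; split=> //; rewrite ez; ring.
Qed.

Lemma straight_vertical z :
  straight_arc node_pos link_ends None z <-> [/\ px z = 0, py z = 0 & -1 <= pz z <= 1].
Proof.
rewrite /straight_arc seg3P /= /node_pos /= /vpos /= !pt3E ty0 mulr0n /zs.
split=> [[t [t01 [-> -> ->]]]|[ex ey ez]]; first by split; [ring | ring | lra].
exists ((1 + pz z) / 2); split; first by lra.
by rewrite ex ey; split; [ring | ring | field].
Qed.

Lemma treeset_prism z : treeset prism_tree z <->
  ([/\ px z = 0, py z = 0 & -1 <= pz z <= 1]) \/
  (pz z * pz z = 1 /\ ((exists2 i, (i < kn)%N & cutarc g bits i (px z) (py z)) \/
                       (exists2 b, (b < g)%N & stem g bits b (px z) (py z)))).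
Proof.
rewrite treeset_straight; split=> [[[[s [i|b]]|]]|[v|[zz h]]].
- by move=> /straight_edge[-> h]; right; rewrite zs_sqr; split=> //; left; exists i.
- move=> /straight_stem[-> h]; right; rewrite zs_sqr; split=> //; right.
  by exists (val b).
- by move=> /straight_vertical; left.
- by exists None; apply/straight_vertical.
have [s sE] : exists s, pz z = zs R s.
  by have [z0|z0] := leP 0 (pz z); [exists true | exists false]; rewrite /zs; nra.
case: h => [[i ik ar]|[b bg st]].
  by exists (Some (s, inl (Ordinal ik))); apply/straight_edge.
have bS : Ordinal bg \in S by have [_ [_ [h _]]] := st; rewrite -bitsE.
by exists (Some (s, inr (exist _ (Ordinal bg) bS))); apply/straight_stem.
Qed.

Lemma node_of_planar s z : pz z = zs R s ->
  (exists2 l, (l <= kn)%N & px z = l%:R /\ py z = ty l) \/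
  (exists2 b, (b < g)%N & bits b /\ (px z = sx R g b /\ py z = sy R g b)) ->
  exists u, z = node_pos u.
Proof.
move=> sE [[l lk [ex ey]]|[b bg [bb [ex ey]]]].
  exists (s, inl (@Ordinal kn.+1 l lk)).
  by apply: eq_pt3; rewrite /node_pos /= /vpos !pt3E.
have bS : Ordinal bg \in S by rewrite -bitsE.
exists (s, inr (exist _ (Ordinal bg) bS)).
by apply: eq_pt3; rewrite /node_pos /= !pt3E.
Qed.

Lemma zs_inj : injective (zs R).
Proof. by case=> [] [] //; rewrite /zs => h; exfalso; lra. Qed.

Lemma node_pos_inj : injective node_pos.
Proof.
move=> u u' e; have e1 : u.1 = u'.1 by apply: zs_inj; rewrite -!node_pz e.
move: e e1; case: u => s [l|b]; case: u' => s' [l'|b'] e /= <-.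
- by move: e; rewrite /node_pos /= => /vpos_inj[_ ->].
- have := congr1 (@px R) e; have := congr1 (@py R) e; rewrite /node_pos /= /vpos !pt3E /=.
  by move=> ey /esym ex; case: (@sx_neq_vertex R g g_gt1 (val b') l (ltn_ord _)).
- have := congr1 (@px R) e; have := congr1 (@py R) e; rewrite /node_pos /= /vpos !pt3E /=.
  by move=> ey ex; case: (@sx_neq_vertex R g g_gt1 (val b) l' (ltn_ord _)).
- have := congr1 (@px R) e; have := congr1 (@py R) e; rewrite /node_pos /= !pt3E /= => ey ex.
  suff -> : b = b' by [].
  apply: val_inj; apply: val_inj; apply: (@cap_stem_point R g g_gt1); rewrite ?ltn_ord //.
  rewrite -ex -ey; split; first exact: (inB_stem R g_gt1 (ltn_ord _)).
  by have := diag_stem g (val (val b)) (sx R g (val (val b))); rewrite subrr mulr0; lra.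
Qed.

Lemma card_nodes : (#|link|.+1 = #|node|)%N.
Proof. rewrite card_option !card_prod !card_sum !card_ord card_bool; lia. Qed.

(** Neighboring vertices of a base are joined either directly or by half of the diagonal followed by
    the altitude; so [P] is constant along each base, and the vertical edge joins the two. *)
Lemma links_connected (P : pred node) : (exists u, P u) ->
  (forall a, P (link_ends a).1 = P (link_ends a).2) -> forall u, P u.
Proof.
move=> [u0 Pu0] closed.
pose top s l := P (s, inl (inord l)) : bool.
have stemE s (b : bumps) : P (s, inr b) = top s (val b).*2.+1.
  by rewrite -(closed (Some (s, inr b))).
have edgeE s (i : 'I_kn) : top s (outer i) = top s (midv i).
  have := closed (Some (s, inl i)); rewrite /= -/(top s (outer i)) => ->.
  by case: insubP => [b _ bE|//]; rewrite stemE bE.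
have step s i : (i < kn)%N -> top s i.+1 = top s i.
  move=> ik; have := edgeE s (Ordinal ik); rewrite /= /outer /midv.
  have e := odd_double_half i; move: e; case: (odd i) => e.
    by rewrite (_ : (i./2).*2.+1 = i) //; lia.
  by rewrite (_ : (i./2).*2.+1 = i.+1) //; lia.
have all0 s l : (l <= kn)%N -> top s l = top s 0%N.
  by elim: l => [//|l IH] lk; rewrite step // IH // ltnW.
have vert : top false 0%N = top true 0%N.
  have := closed None; rewrite /= /top.
  by have -> : inord 0 = ord0 :> 'I_kn.+1 by apply: val_inj; rewrite /= inordK.
have nodeE u : P u = top true 0%N.
  have base s : top s 0%N = top true 0%N by case: s.
  case: u => s [l|b].
    have lk : (l <= kn)%N by have := ltn_ord l; rewrite ltnS.
    by rewrite -(base s) -(all0 s l lk) /top inord_val.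
  by rewrite stemE all0 ?base // -ltnS bump_mid_lt.
by move=> u; rewrite nodeE -(nodeE u0).
Qed.

Lemma node_planar (u : node) :
  (exists2 l : 'I_kn.+1, u.2 = inl l & px (node_pos u) = l%:R /\ py (node_pos u) = ty l) \/
  (exists2 b : bumps, u.2 = inr b &
     px (node_pos u) = sx R g (val b) /\ py (node_pos u) = sy R g (val b)).
Proof.
by case: u => s [l|b]; [left; exists l | right; exists b]; rewrite // /node_pos /= ?/vpos !pt3E.
Qed.

Lemma zs_range s : -1 <= zs R s <= 1.
Proof. by rewrite /zs; case: s; lra. Qed.

Lemma link_surf a : straight_arc node_pos link_ends a `<=` surf (@prism R g).
Proof.
move=> z; case: a => [[s [i|b]]|].
- move=> /straight_edge[ez [Bz _]]; apply/(surf_prism g_gt1).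
  by rewrite ez zs_range; split=> //; left; apply: zs_sqr.
- move=> /straight_stem[ez [Bz _]]; apply/(surf_prism g_gt1).
  by rewrite ez zs_range; split=> //; left; apply: zs_sqr.
move=> /straight_vertical[ex ey ez]; apply/(surf_prism g_gt1); split=> //.
  by have := inB_vertex R g_gt1 (leq0n kn); rewrite ex ey ty0.
right; exists 0%N => //; have := inward_edge (i := 0) (g := g) (px z) (py z).
rewrite ex ey => /(_ ltac:(rewrite /nsides; lia)).
rewrite lineE ty0 mulr0n !subr0 mulr0 addr0 => /eqP; rewrite mulf_eq0.
by rewrite (negbTE (hyp_neq0 R g 0)) orbF => /eqP.
Qed.

Lemma vertical_node s z : px z = 0 -> py z = 0 -> pz z = zs R s -> exists u, z = node_pos u.
Proof.
move=> ex ey ez; apply: (node_of_planar ez); left; exists 0%N => //.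
by rewrite ex ey ty0.
Qed.

Lemma link_inter a a' z : a != a' -> straight_arc node_pos link_ends a z ->
  straight_arc node_pos link_ends a' z -> exists u, z = node_pos u.
Proof.
have edge_stem s i b : straight_arc node_pos link_ends (Some (s, inl i)) z ->
    straight_arc node_pos link_ends (Some (s, inr b)) z -> exists u, z = node_pos u.
  move=> /straight_edge[ez h] /straight_stem[_ h'].
  exact: (node_of_planar ez (cutarc_stem_inter g_gt1 h h')).
case: a => [[s c]|]; case: a' => [[s' c']|] // ne.
- have sz s1 c1 : straight_arc node_pos link_ends (Some (s1, c1)) z -> pz z = zs R s1.
    by case: c1 => [i|b] => [/straight_edge[]|/straight_stem[]].
  move=> h h'; have ss : s = s' by apply: zs_inj; rewrite -(sz _ _ h) (sz _ _ h').
  move: h h' ne; rewrite -{}ss => {s'}; case: c => [i|b]; case: c' => [i'|b'].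
  + move=> /straight_edge[ez h] /straight_edge[_ h'] ne.
    apply: (node_of_planar ez); case: (ltngtP i i') => lt.
    * exact: cutarc_inter lt h h'.
    * exact: cutarc_inter lt h' h.
    * by move: ne; rewrite (val_inj lt) eqxx.
  + by move=> h h' _; apply: edge_stem h h'.
  + by move=> h h' _; apply: edge_stem h' h.
  + move=> /straight_stem[ez h] /straight_stem[_ h'] ne.
    apply: (node_of_planar ez); left; case: (ltngtP (val b) (val b')) => lt.
    * exact: stem_inter lt h h'.
    * exact: stem_inter lt h' h.
    * by move: ne; rewrite (_ : b = b') ?eqxx //; apply: val_inj; apply: val_inj.
- case: c ne => [i|b] _.
    by move=> /straight_edge[ez _] /straight_vertical[ex ey _]; apply: vertical_node ez.
  by move=> /straight_stem[ez _] /straight_vertical[ex ey _]; apply: vertical_node ez.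
- case: c' ne => [i|b] _ /straight_vertical[ex ey _].
    by move=> /straight_edge[ez _]; apply: vertical_node ez.
  by move=> /straight_stem[ez _]; apply: vertical_node ez.
Qed.

Lemma inner_inl s (i : 'I_kn) : ~~ bits i./2 ->
  (link_ends (Some (s, inl i))).2 = (s, inl (inord (midv i))).
Proof.
rewrite /= -[i./2]/(val (half_ord i)) bitsE => nb.
by case: insubP => // b; rewrite (negbTE nb).
Qed.

Lemma inner_inr s (i : 'I_kn) (b : bumps) : i./2 = val (val b) ->
  (link_ends (Some (s, inl i))).2 = (s, inr b).
Proof.
move=> e; have eb : half_ord i = val b by apply: val_inj.
by rewrite /= eb; have -> : insub (val b) = Some b by apply: valK.
Qed.

Lemma link_node a u : straight_arc node_pos link_ends a (node_pos u) ->
  u = (link_ends a).1 \/ u = (link_ends a).2.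
Proof.
have uE := surjective_pairing u; case: a => [[s [i|b]]|].
- move=> /straight_edge[]; rewrite node_pz => /zs_inj us.
  case: (node_planar u) => [[l ul [-> ->]]|[b ub [-> ->]]] ar.
    have := cutarc_vertex g_gt1 (ltn_ord i) ar => -[lo|[nb lm]].
      by left; rewrite uE us ul /= -lo inord_val.
    by right; rewrite inner_inl // uE us ul -lm inord_val.
  right; rewrite uE us ub; have cb := cutarc_cap g_gt1 ar.
  by rewrite (inner_inr s (cap_stem_point g_gt1 (half_lt g_gt1 (ltn_ord i)) (ltn_ord (val b)) cb)).
- move=> /straight_stem[]; rewrite node_pz => /zs_inj us.
  case: (node_planar u) => [[l ul [-> ->]]|[b' ub [-> ->]]] st.
    by left; rewrite uE us ul /= -(stem_vertex g_gt1 st) inord_val.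
  right; rewrite uE us ub /=; have cb := stem_cap st.
  have e := cap_stem_point g_gt1 (ltn_ord (val b)) (ltn_ord (val b')) cb.
  by rewrite (_ : b = b') //; apply: val_inj; apply: val_inj.
move=> /straight_vertical[].
case: (node_planar u) => [[l ul [-> _]]|[b ub [-> _]]].
  move=> /eqP; rewrite pnatr_eq0 => /eqP l0 _ _.
  have -> : u = (u.1, inl ord0) by rewrite {1}uE ul; congr (_, inl _); apply: val_inj.
  by case: (u.1); [right | left].
have := sx_bound R g_gt1 (ltn_ord (val b)); rewrite natr_bump.
have : 0 <= (val b : nat)%:R :> R by rewrite ler0n.
by clear uE ub; move=> h1 h2 h3; exfalso; lra.
Qed.

(** The foot of an altitude is the end of both halves of the diagonal and of the altitude itself. *)
Lemma stem_degree s (b : bumps) : (2 < #|[set a | (link_ends a).2 == (s, inr b)]|)%N.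
Proof.
have bg := ltn_ord (val b).
have k0 : ((val b).*2 < kn)%N by rewrite /nsides; lia.
have k1 : ((val b).*2.+1 < kn)%N by rewrite /nsides; lia.
pose three : seq link := [:: Some (s, inl (Ordinal k0)); Some (s, inl (Ordinal k1)); Some (s, inr b)].
have un : uniq three.
  rewrite /= !inE !andbT; apply/andP; split; last by apply/eqP.
  apply/norP; split; apply/eqP => -[] //; lia.
rewrite cardE; apply: (uniq_leq_size un) => a a3.
suff ends_a : (link_ends a).2 = (s, inr b) by rewrite mem_enum inE /= ends_a eqxx.
move: a3; rewrite !inE; case/or3P => /eqP -> //.
  by rewrite (@inner_inr s _ b) //= doubleK.
by rewrite (@inner_inr s _ b) //= uphalf_double.
Qed.

Lemma prism_is_cut_tree : is_cut_tree (@prism R g) prism_tree.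
Proof.
apply: straight_cut_tree.
- exact: card_nodes.
- exact: links_connected.
- exact: node_pos_inj.
- case=> [[s [i|b]]|]; apply/eqP => //= -[].
  have e := odd_double_half i; case: insubP => // _ [] /(congr1 (fun l => nat_of_ord l)).
  rewrite !inordK ?outer_le ?midv_lt // /outer /midv.
  by move: e; case: (odd i); lia.
- exact: link_surf.
- exact: link_inter.
- exact: link_node.
- case=> s [l|b]; last by right; apply: stem_degree.
  by left; exists (enum_rank (s, l)); rewrite /prism enum_rankK.
- by move=> v; exists ((enum_val v).1, inl (enum_val v).2); rewrite /node_pos /= -surjective_pairing.
Qed.

End PrismTree.

(** * Distinguishing the labeled trees *)

Section Combinatorial.
Variables (R : realType) (g : nat).
Hypothesis g_gt1 : (1 < g)%N.
Notation kn := (nsides g).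
Notation V := (@prism R g).

Definition labeled_edge (T : cut_tree R) (v w : 'I_(nvert g)) : Prop :=
  exists e : 'I_(ct_m T),
    (ct_label V (ct_ends e).1 = Some v /\ ct_label V (ct_ends e).2 = Some w) \/
    (ct_label V (ct_ends e).1 = Some w /\ ct_label V (ct_ends e).2 = Some v).

Lemma comb_iso_labeled_edge T1 T2 v w : comb_iso V T1 T2 ->
  labeled_edge T1 v w <-> labeled_edge T2 v w.
Proof.
move=> [phi [_ [psi [[psi' psiK psi'K] [ends lab]]]]]; split=> -[e h].
  by exists (psi e); case: (ends e) => -> /=; rewrite !lab; tauto.
exists (psi' e); rewrite -[e]psi'K in h.
by case: (ends (psi' e)) h => -> /=; rewrite !lab; tauto.
Qed.

Lemma label_vertex (S : {set 'I_g}) (i : 'I_(ct_k (prism_tree R g_gt1 S))) u :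
  ct_label V i = Some (enum_rank u) <-> enum_val i = (u.1, inl u.2).
Proof.
have posE : node_pos R (S := S) (u.1, inl u.2) = vpos R u.
  by rewrite /node_pos /= -surjective_pairing.
rewrite /ct_label; split=> [|iE].
  case: pickP => // v /eqP e [vE]; apply: (node_pos_inj (R := R) g_gt1).
  by rewrite posE; transitivity (V v); [exact: esym e | rewrite vE /prism enum_rankK].
case: pickP => [v /eqP|/(_ (enum_rank u))].
  rewrite /prism /= iE posE => /(vpos_inj (g := g)) e.
  by rewrite -e enum_valK.
by rewrite /prism /= iE posE enum_rankK eqxx.
Qed.

Lemma labeled_edge_bump (S : {set 'I_g}) (b : 'I_g)
    (u := (false, inord b.*2) : vindex g) (w := (false, inord b.*2.+1) : vindex g) :
  labeled_edge (prism_tree R g_gt1 S) (enum_rank u) (enum_rank w) <-> b \notin S.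
Proof.
have bg := ltn_ord b; have b0 : (b.*2 < kn.+1)%N by rewrite /nsides; lia.
have b1 : (b.*2.+1 < kn.+1)%N by rewrite /nsides; lia.
split=> [[e]|bS].
  rewrite !label_vertex /= !enum_rankK => h; apply/negP => bS.
  (* Second ends are enough: each is the foot of an altitude, an odd vertex whose corner is left
     alone, or the upper end of the vertical edge, and none of these is allowed here. *)
  have : (link_ends g_gt1 (enum_val e)).2 = (false, inl (inord b.*2.+1)) \/
         (link_ends g_gt1 (enum_val e)).2 = (false, inl (inord b.*2)) :> node S.
    by case: h => -[_ ->]; [left|right].
  case: (enum_val e) => [[s [i|c]]|]; last by case.
    have [ib|ni] := eqVneq i./2 b.
      by rewrite (@inner_inr _ g_gt1 S s i (exist (fun c : 'I_g => c \in S) b bS)) //; case.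
    have [iS|iS] := boolP (half_ord g_gt1 i \in S).
      by rewrite (@inner_inr _ g_gt1 S s i (exist (fun c : 'I_g => c \in S) (half_ord g_gt1 i) iS)) //; case.
    rewrite inner_inl; last by rewrite -[i./2]/(val (half_ord g_gt1 i)) bitsE.
    case=> -[_ /(congr1 (fun l => nat_of_ord l))].
      by rewrite !inordK ?midv_lt // /midv => e1; move/eqP: ni; apply; lia.
    by rewrite !inordK ?midv_lt // /midv => e1; lia.
  by case.
have ik : (b.*2 < kn)%N by rewrite /nsides; lia.
exists (enum_rank (Some (false, inl (Ordinal ik)) : link S)); left.
rewrite !label_vertex /= !enum_rankK; split=> //=.
  by rewrite /outer odd_double.
have := @inner_inl _ g_gt1 S false (Ordinal ik); rewrite /= doubleK bitsE => /(_ bS) ->.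
by rewrite /midv doubleK.
Qed.

Lemma prism_tree_distinct (S S' : {set 'I_g}) :
  comb_iso V (prism_tree R g_gt1 S) (prism_tree R g_gt1 S') -> S = S'.
Proof.
move=> iso; apply/setP => b; apply: negb_inj; apply/idP/idP => /labeled_edge_bump h;
  by apply/labeled_edge_bump; apply/(comb_iso_labeled_edge _ _ iso).
Qed.

End Combinatorial.

(** * The unfolding map *)

Section Unfolding.
Variables (R : realType) (g : nat).
Hypothesis g_gt1 : (1 < g)%N.
Variable S : {set 'I_g}.
Notation kn := (nsides g).
Notation kr := (nsidesR R g).
Notation ty := (vertex_y R g).
Notation len := (edge_len R g).
Notation offset := (strip_offset R g).
Notation width := (strip_width R g).
Notation bet := (bits S).
Notation V := (@prism R g).
Notation T := (prism_tree R g_gt1 S).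
Implicit Types (i j l : nat) (x y s : R) (v w q : 'rV[R]_3).

Definition chart_x i v : R := along g i (px v) (py v).
Definition chart_y i v : R := inward g i (px v) (py v).
(** Chart [i] consists of side facet [i] and the pieces of both bases that are hinged to it. *)
Definition in_chart i v := piece g bet i (px v) (py v) /\ (pz v * pz v = 1 \/ chart_y i v = 0).
(* chart_y vanishes on side facet i and |pz| = 1 on the bases, so that this one formula is the
   unfolding on both. *)
Definition chart_map i v : 'rV[R]_2 := pt2 (offset i + chart_x i v) (pz v * (1 + chart_y i v)).
Definition cutopen : set 'rV[R]_3 := [set v | surf V v /\ ~ treeset T v].
Notation D := cutopen.

Lemma edge_piece i x y : (i <= kn)%N -> inB g x y -> inward g i x y = 0 ->
  piece g bet i x y.
Proof.
rewrite leq_eqVlt => /orP[/eqP ->|ik] Bxy.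
  rewrite inward_chord => y0; split=> //; rewrite ltnn => l lk.
  rewrite /cut; case: ifP => _; last exact: Bxy.2.
  have /andP[x0 x1] := inB_x g_gt1 Bxy; have c0 := cc_gt0 R g_gt1; have k4 := kr_ge4 R g_gt1.
  rewrite y0 /diag pmulr_rge0 //.
  have j1 : 1 <= (midv l)%:R :> R by rewrite (ler_nat R 1).
  have j2 : (midv l)%:R + 1 <= kr.
    by apply: natr_kn; have := half_lt g_gt1 lk; rewrite /midv /nsides; lia.
  have k0 : 0 < kr by lra.
  rewrite -(pmulr_rge0 _ k0).
  (* An affine function of [x] is nonnegative between 0 and [kr] if it is so at both ends. *)
  have -> : kr * ((kr - 2 * (midv l)%:R) * x + (midv l)%:R ^+ 2 - 1) =
     (kr - x) * ((midv l)%:R ^+ 2 - 1) + x * ((kr - (midv l)%:R) ^+ 2 - 1) by ring.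
  by rewrite addr_ge0 // mulr_ge0 ?subr_ge0 //; nra.
move=> L0; have ly : line g i x <= y.
  by have := inward_edge x y ik; rewrite L0 mul0r; lra.
have [yE [_ dy] s] := edge_side g_gt1 Bxy ik ly.
by split=> //; rewrite ik /cut; split=> //; case: ifP.
Qed.

Lemma spiece_piece i x y : spiece g bet i x y -> piece g bet i x y.
Proof.
case=> Bxy; rewrite /piece; case: ifP => ik; last by move=> h; split=> // l /h/ltW.
move=> [/ltW cy s]; split=> //; split=> //; move: s; rewrite /side /sside.
by case: ifP => _ /ltW.
Qed.

(** An arc lies in its own piece without being strictly above [cut], and an altitude lies in two
    pieces; both contradict [spiece_uniq]. *)
Lemma spiece_off_tree i l x y : (i <= kn)%N -> spiece g bet i x y ->
  ~ cutarc g bet l x y /\ ~ stem g bet l x y.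
Proof.
move=> ik sp; split=> [ar|st].
  have [_ [lk [yc s]]] := ar.
  have il := spiece_uniq g_gt1 ik (ltnW lk) sp (arc_piece ar).
  by move: sp; rewrite il => -[_]; rewrite lk -yc ltxx => -[].
have [_ [lg _]] := st; have [p0 p1] := stem_piece g_gt1 st.
have k0 : (l.*2 <= kn)%N by rewrite /nsides; lia.
have k1 : (l.*2.+1 <= kn)%N by rewrite /nsides; lia.
by have e0 := spiece_uniq g_gt1 ik k0 sp p0; have e1 := spiece_uniq g_gt1 ik k1 sp p1; lia.
Qed.

Lemma cutopen_surf v : D v -> [/\ inB g (px v) (py v), -1 <= pz v <= 1
    & pz v * pz v = 1 \/ exists2 i, (i <= kn)%N & chart_y i v = 0].
Proof. by case=> /(surf_prism g_gt1). Qed.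

Lemma cutopen_off v : D v -> ~ (px v = 0 /\ py v = 0).
Proof.
move=> Dv [ex ey]; have [_ zr _] := cutopen_surf Dv; case: Dv => _; apply.
by apply/treeset_prism; left.
Qed.

Lemma cutopen_spiece i v : (i <= kn)%N -> D v -> piece g bet i (px v) (py v) ->
  pz v * pz v = 1 -> spiece g bet i (px v) (py v).
Proof.
move=> ik [_ nt] pc zz; case: (piece_cases g_gt1 ik pc) => // h; case: nt;
  apply/treeset_prism; right; split=> //; [left|right] => //.
Qed.

Lemma chart_cover v : surf V v -> exists2 i, (i <= kn)%N & in_chart i v.
Proof.
move=> /(surf_prism g_gt1)[Bv _ [zz|[i ik L0]]].
  by have [i ik pc] := piece_cover g_gt1 bet Bv; exists i => //; split=> //; left.
by exists i => //; split; [apply: edge_piece | right].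
Qed.

Lemma along_start i : along g i i%:R (ty i) = 0 /\ inward g i i%:R (ty i) = 0.
Proof. by rewrite /along /inward !subrr !mulr0 subrr addr0. Qed.

Lemma along_end i : (i < kn)%N ->
  along g i (i.+1)%:R (ty i.+1) = len i /\ inward g i (i.+1)%:R (ty i.+1) = 0.
Proof.
move=> ik; have h0 := hyp_neq0 R g i; have h2 := hyp_sqr R g i.
have tE : ty i.+1 = ty i + edge_slope R g i by rewrite /vertex_y /edge_slope -natr1; ring.
split; apply: (mulIf h0).
  rewrite along_edge // tE /edge_len ik -natr1 -expr2 h2; ring.
by rewrite inward_edge // tE lineE -natr1; ring.
Qed.

(** The origin, excluded here, is the common point of the first edge and the chord, where the strip
    is cut open. *)
Lemma edge_meet i j x y : (i < j)%N -> (j <= kn)%N -> inB g x y ->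
  inward g i x y = 0 -> inward g j x y = 0 -> ~ (x = 0 /\ y = 0) ->
  [/\ j = i.+1, x = j%:R & y = ty j].
Proof.
move=> ij jk Bxy Li Lj n0; have ik := leq_trans ij jk; have c0 := cc_gt0 R g_gt1.
have yi : y = line g i x by have := inward_edge x y ik; rewrite Li mul0r; lra.
have xi := line_range g_gt1 Bxy ik ltac:(rewrite -yi lexx).
move: jk; rewrite leq_eqVlt => /orP[/eqP jE|jk].
  move: Lj; rewrite jE inward_chord => y0.
  have ye : (i%:R + 1 - x) * ty i + (x - i%:R) * ty i.+1 = 0.
    by rewrite -[RHS]y0 yi /line /vertex_y -natr1; ring.
  have t_gt0 l : (0 < l)%N -> (l < kn)%N -> 0 < ty l.
    move=> l0 lk; rewrite /vertex_y mulr_gt0 // mulr_gt0 ?ltr0n //.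
    by have := natr_kn R lk; lra.
  have t0 l : (l <= kn)%N -> 0 <= ty l by apply: ty_ge0.
  have p1 : 0 <= (i%:R + 1 - x) * ty i by rewrite mulr_ge0 ?t0 ?(ltnW ik) //; lra.
  have p2 : 0 <= (x - i%:R) * ty i.+1 by rewrite mulr_ge0 ?t0 //; lra.
  have e1 : (i%:R + 1 - x) * ty i = 0 by lra.
  have e2 : (x - i%:R) * ty i.+1 = 0 by lra.
  have [i0|ipos] := posnP i.
    have t1 : 0 < ty i.+1 by rewrite i0 t_gt0 // /nsides; lia.
    by move/eqP: e2; rewrite mulf_eq0 (gt_eqF t1) orbF i0 subr0 => /eqP x0; case: n0.
  have ti : 0 < ty i by apply: t_gt0.
  move/eqP: e1; rewrite mulf_eq0 (gt_eqF ti) orbF subr_eq0 => /eqP xE.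
  have ik1 : i.+1 = kn.
    apply/eqP; rewrite eqn_leq ik /= leqNgt; apply/negP => lt.
    have t1 := t_gt0 i.+1 isT lt; move/eqP: e2.
    by rewrite mulf_eq0 (gt_eqF t1) orbF -xE; move/eqP; lra.
  by split; rewrite ?jE ?ty_kn // -ik1 -natr1.
have yj : y = line g j x by have := inward_edge x y jk; rewrite Lj mul0r; lra.
have xj := line_range g_gt1 Bxy jk ltac:(rewrite -yj lexx).
have ji : j = i.+1.
  apply/eqP; rewrite eqn_leq ij andbT -(ler_nat R) -natr1; lra.
have xE : x = j%:R by rewrite ji -natr1; rewrite ji -natr1 in xj; lra.
by split=> //; rewrite yj lineE xE subrr mulr0 addr0.
Qed.

(** On the bases the pieces are disjoint off the tree, so a common point lies on two side facets,
    strictly between the bases. *)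
Lemma chart_overlap i j v : (i < j)%N -> (j <= kn)%N -> D v -> in_chart i v -> in_chart j v ->
  [/\ j = i.+1, px v = j%:R, py v = ty j & pz v * pz v <> 1].
Proof.
move=> ij jk Dv [pi hi] [pj hj]; have ik := ltnW (leq_trans ij jk).
have nz : pz v * pz v <> 1.
  move=> zz; have sp := cutopen_spiece ik Dv pi zz.
  by have e := spiece_uniq g_gt1 ik jk sp pj; rewrite e ltnn in ij.
case: hi => // Li; case: hj => // Lj.
have [Bv _ _] := cutopen_surf Dv.
by have [e1 e2 e3] := edge_meet ij jk Bv Li Lj (cutopen_off Dv); split.
Qed.

Lemma flat_seam i v : (i < kn)%N -> px v = (i.+1)%:R -> py v = ty i.+1 ->
  chart_map i v = chart_map i.+1 v.
Proof.
move=> ik ex ey; rewrite /chart_map /chart_x /chart_y ex ey.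
have [-> ->] := along_end ik; have [-> ->] := along_start i.+1.
by rewrite offsetS !addr0.
Qed.

(** By [unfoldE] the choice of the chart does not matter on [D]; the default 0 occurs only outside
    the surface. *)
Definition unfold_map v : 'rV[R]_2 :=
  if [pick i : 'I_kn.+1 | boolp.asbool (in_chart i v)] is Some i then chart_map i v else 0.

Lemma unfoldE i v : (i <= kn)%N -> D v -> in_chart i v -> unfold_map v = chart_map i v.
Proof.
move=> ik Dv ci; rewrite /unfold_map; case: pickP => [j /boolp.asboolP cj|none].
  have jk : (j <= kn)%N by have := ltn_ord j; rewrite ltnS.
  case: (ltngtP i j) => lt; last by rewrite lt.
    have [e ex ey _] := chart_overlap lt jk Dv ci cj.
    by rewrite e in ex ey *; rewrite (flat_seam _ ex ey) // -e.
  have [e ex ey _] := chart_overlap lt ik Dv cj ci.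
  by rewrite e in ex ey *; rewrite (flat_seam _ ex ey) // -e.
by have := none (Ordinal (n:=kn.+1) (m:=i) ik); rewrite boolp.asboolT.
Qed.

Lemma offset_mono i j : (i <= j)%N -> offset i + (j - i)%:R <= offset j.
Proof.
move=> ij; rewrite -{2}(subnKC ij); elim: (j - i)%N => [|m IH]; first by rewrite addn0 addr0.
by have := len_ge1 R g_gt1 (i + m); rewrite addnS offsetS -natr1; lra.
Qed.

Lemma chart_slab i v : (i <= kn)%N -> in_chart i v -> 0 <= chart_x i v <= len i /\ 0 <= chart_y i v.
Proof. by move=> ik [pc _]; apply: (piece_slab g_gt1 ik pc). Qed.

Lemma inB_edge i s : (i <= kn)%N -> 0 <= s <= len i ->
  inB g (chartx g i s 0) (charty g i s 0).
Proof.
move=> ik /andP[s0 s1]; have l1 := len_ge1 R g_gt1 i; have h0 := hyp_neq0 R g i.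
have t01 : 0 <= s / len i <= 1 by rewrite divr_ge0 ?ler_pdivrMr; lra.
have B0 := inB_vertex R g_gt1 ik.
move: ik; rewrite leq_eqVlt => /orP[/eqP iE|ik].
  have B1 := inB_vertex R g_gt1 (leq0n kn); have := inB_convex t01 B0 B1.
  rewrite iE /chartx /charty /ua /ub ltnn ty_kn ty0 /edge_len ltnn mulr0n.
  have k4 := kr_ge4 R g_gt1; have kn0 : kr != 0 by rewrite gt_eqF //; lra.
  congr inB; last by ring.
  rewrite -/kr; by field.
have B1 := inB_vertex R g_gt1 ik; have := inB_convex t01 B0 B1.
have tE : ty i.+1 = ty i + edge_slope R g i by rewrite /vertex_y /edge_slope -natr1; ring.
rewrite /chartx /charty /ua /ub ik /edge_len ik tE -natr1.
by congr inB; field.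
Qed.

Lemma height_left0 : @strip_height R g bet 0 <= 1.
Proof. by have := @height_le_left R g g_gt1 bet 0; have := width_ge4 R g_gt1; lra. Qed.

Lemma height_width : @strip_height R g bet width <= 1.
Proof. by have := @height_le_right R g g_gt1 bet width; have := width_ge4 R g_gt1; lra. Qed.

Lemma chart_height i v : (i <= kn)%N -> D v -> in_chart i v ->
  (pz v * pz v = 1 /\ 1 + chart_y i v < @strip_height R g bet (offset i + chart_x i v)) \/
  (pz v * pz v <> 1 /\ chart_y i v = 0).
Proof.
move=> ik Dv cv; have [s01 L0] := chart_slab ik cv; case: cv => pc h.
have [zz|nz] := eqVneq (pz v * pz v) 1; last by right; split; [apply/eqP | case: h => // /eqP; rewrite (negbTE nz)].
left; split=> //; apply/(height_piece g_gt1 bet ik s01 L0).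
by rewrite chartxK chartyK; apply: cutopen_spiece.
Qed.

Lemma sq_lt1 (z : R) : -1 <= z <= 1 -> z * z <> 1 -> `|z| < 1.
Proof.
move=> /andP[z0 z1] nz; rewrite ltr_norml !lt_neqAle z0 z1 !andbT.
by apply/andP; split; apply: contra_notN nz => /eqP e; [rewrite -e | rewrite e]; ring.
Qed.

Lemma sq_eq1_norm (z : R) : z * z = 1 -> `|z| = 1.
Proof.
move=> zz; have : `|z| * `|z| = 1 by rewrite -normrM zz normr1.
by have := normr_ge0 z; nra.
Qed.

Lemma offset_width i s : (i <= kn)%N -> 0 <= s <= len i ->
  [/\ 0 <= offset i + s <= width, offset i + s = 0 -> i = 0%N /\ s = 0
    & offset i + s = width -> i = kn /\ s = kr].
Proof.
move=> ik /andP[s0 s1]; have oi := @offset_ge R g g_gt1 i; have i0 : 0 <= i%:R :> R by rewrite ler0n.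
have k4 := kr_ge4 R g_gt1; have := offset_mono ik; rewrite natrB // -/kr widthE => om.
have last : i = kn \/ offset i + s <= offset kn.
  move: ik; rewrite leq_eqVlt => /orP[/eqP ->|lt]; [by left | right].
  by have := offset_mono lt; rewrite offsetS natrB // -natr1 -/kr; have := natr_kn R lt; lra.
split.
- apply/andP; split; first by lra.
  case: last => [e|]; last by lra.
  by move: s1; rewrite e /edge_len ltnn; lra.
- move=> e; have s00 : s = 0 by lra.
  by split=> //; apply/eqP; rewrite -(pnatr_eq0 R); apply/eqP; lra.
- move=> e; case: last => [iE|]; last by lra.
  by split=> //; rewrite iE in e; lra.
Qed.

Lemma unfold_into v : D v -> @unfolded R g bet (unfold_map v).
Proof.
move=> Dv; have [i ik cv] := chart_cover Dv.1; rewrite (unfoldE ik Dv cv).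
have [s01 L0] := chart_slab ik cv; have [Bv zr _] := cutopen_surf Dv.
have [/andP[x0 xW] start stop] := offset_width ik s01.
rewrite /unfolded /under_graph /chart_map /= !pt2E.
have off := cutopen_off Dv.
have hch := chart_height ik Dv cv.
(* At both ends of the strip the graph has height at most 1, which leaves no room for points of the
   bases; and the points of the side facets there lie on the vertical cut. *)
have xn0 : offset i + chart_x i v != 0.
  apply/eqP => e; have [i0 s0] := start e; case: hch => [[_]|[_ Li]].
    by rewrite e; have := height_left0; lra.
  have ex := chartxK g i (px v) (py v); have ey := chartyK g i (px v) (py v).
  rewrite -/(chart_x i v) -/(chart_y i v) s0 Li i0 /chartx /charty ty0 mulr0n in ex ey.
  by apply: off; rewrite -ex -ey; split; ring.
have xnW : offset i + chart_x i v != width.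
  apply/eqP => e; have [iK sK] := stop e; case: hch => [[_]|[_ Li]].
    by rewrite e; have := height_width; lra.
  apply: off; move: sK Li; rewrite /chart_x /chart_y iK along_chord inward_chord => e1 e2.
  by split=> //; lra.
split; first by rewrite !lt_neqAle x0 xW xnW eq_sym xn0.
rewrite normrM [`|1 + _|]ger0_norm; last by lra.
case: hch => [[zz lt]|[nz ->]]; first by rewrite sq_eq1_norm // mul1r.
rewrite addr0 mulr1; apply: lt_le_trans (sq_lt1 zr nz) _.
by apply: height_ge1; rewrite ?x0.
Qed.

Lemma flat_chart i s (h z : R) :
  chart_map i (pt3 (chartx g i s h) (charty g i s h) z) = pt2 (offset i + s) (z * (1 + h)).
Proof. by rewrite /chart_map /chart_x /chart_y !pt3E along_chart inward_chart. Qed.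

Lemma off_tree v : -1 <= pz v <= 1 -> pz v * pz v <> 1 -> ~ (px v = 0 /\ py v = 0) ->
  ~ treeset T v.
Proof. by move=> zr nz off /treeset_prism[[ex ey _]|[zz _]]; [apply: off | apply: nz]. Qed.

Lemma cutarc0 : cutarc g bet 0 (0 : R) 0.
Proof.
have k0 : (0 < kn)%N by rewrite /nsides; lia.
apply/(arc_param g_gt1 bet _ _ k0); exists 0; rewrite lexx ler01; split=> //.
by rewrite /outer /= ty0 mulr0n; split; ring.
Qed.

Lemma spiece_off i v : (i <= kn)%N -> spiece g bet i (px v) (py v) -> ~ treeset T v.
Proof.
move=> ik sp /treeset_prism[[ex ey _]|[_ [[l lk ar]|[b bg st]]]].
- by case: (spiece_off_tree 0 ik sp); rewrite ex ey => /(_ cutarc0).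
- by case: (spiece_off_tree l ik sp).
- by case: (spiece_off_tree b ik sp).
Qed.

(** The abscissa selects the chart. Height less than 1 in absolute value is a point of the side
    facet; otherwise the excess over 1 is the distance from the hinge, and the sign selects the
    base. *)
Lemma unfold_onto z : @unfolded R g bet z -> exists2 v, D v & unfold_map v = z.
Proof.
move=> [/andP[x0 xW] yH].
have := @breakpoint_piece R kn.+1 offset (xc z) isT.
rewrite {1}/strip_offset big_ord0 (ltW x0) (ltW xW) => /(_ isT)[i ik].
rewrite offsetS => xi; pose s := xc z - offset i.
have s01 : 0 <= s <= len i by rewrite /s; lra.
have xE : offset i + s = xc z by rewrite /s; ring.
have {ik}ik : (i <= kn)%N by [].
have [y1|y1] := ltP `|yc z| 1.
  pose v := pt3 (chartx g i s 0) (charty g i s 0) (yc z).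
  have Bv := inB_edge ik s01.
  have Li : chart_y i v = 0 by rewrite /chart_y !pt3E inward_chart.
  have cv : in_chart i v by split; [rewrite !pt3E; apply: edge_piece; rewrite ?inward_chart | right].
  have zr : -1 <= yc z <= 1 by move: y1; rewrite ltr_norml => /andP[? ?]; rewrite !ltW.
  have nz : pz v * pz v <> 1.
    by rewrite pt3E => /sq_eq1_norm e; rewrite e ltxx in y1.
  have Dv : D v.
    split; first by apply/(surf_prism g_gt1); rewrite !pt3E; split=> //; right; exists i;
      rewrite // inward_chart.
    apply: off_tree => //; first by rewrite pt3E.
    rewrite /v !pt3E => -[ex ey].
    have Si := along_chart g i s 0; have Ii := inward_chart g i s 0.
    rewrite ex ey in Si Ii; have c0 := cc_gt0 R g_gt1.
    move: ik; rewrite leq_eqVlt => /orP[/eqP iE|ik].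
      by move: Si; rewrite iE along_chord => Si; rewrite widthE in xW; rewrite iE in xE; lra.
    have := @inward_edge R g i 0 0 ik; rewrite Ii mul0r subr0 /line mulr0 add0r => /esym/eqP.
    rewrite mulf_eq0 (gt_eqF c0) /= mulf_eq0 => /orP[|/eqP]; last first.
      by have : 0 <= i%:R :> R by [rewrite ler0n]; lra.
    rewrite pnatr_eq0 => /eqP i0; have [s0 _] := along_start 0.
    move: Si; rewrite i0; rewrite mulr0n ty0 in s0; rewrite s0 => Si.
    by move: xE; rewrite i0 -Si /strip_offset big_ord0; lra.
  exists v => //; rewrite (unfoldE ik Dv cv) flat_chart.
  by apply: eq_pt2; rewrite !pt2E ?xE // addr0 mulr1.
pose l := `|yc z| - 1; have l0 : 0 <= l by rewrite /l; lra.
have sp : spiece g bet i (chartx g i s l) (charty g i s l).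
  by apply/(height_piece g_gt1 bet ik s01 l0); rewrite xE /l; have -> : 1 + (`|yc z| - 1) = `|yc z| by ring.
have [e [eyE [e2 er]]] : exists e : R, e * `|yc z| = yc z /\ e * e = 1 /\ -1 <= e <= 1.
  have [y0|y0] := leP 0 (yc z).
    by exists 1; rewrite mul1r ger0_norm //; split=> //; split; [ring | lra].
  by exists (-1); rewrite mulN1r ltr0_norm ?opprK //; split=> //; split; [ring | lra].
pose v := pt3 (chartx g i s l) (charty g i s l) e.
have pc := spiece_piece sp.
have cv : in_chart i v by split; [rewrite !pt3E | left; rewrite pt3E].
have Dv : D v.
  split; first by apply/(surf_prism g_gt1); rewrite !pt3E; split=> //; [case: sp | left].
  by apply: (@spiece_off i) => //; rewrite !pt3E.
exists v => //; rewrite (unfoldE ik Dv cv) flat_chart.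
apply: eq_pt2; rewrite !pt2E ?xE //.
by rewrite /l -[in RHS]eyE; congr (_ * _); ring.
Qed.

(** The graph has height exactly 1 over a seam, so a point there lies on the vertical edge and thus
    on the next facet as well. *)
Lemma chart_next i v : (i < kn)%N -> D v -> in_chart i v -> chart_x i v = len i -> in_chart i.+1 v.
Proof.
move=> ik Dv cv sE; have := chart_height (ltnW ik) Dv cv.
have hS : @strip_height R g bet (offset i.+1) = 1.
  have [<- he] := break_even R bet ik; rewrite -{}he /strip_height.
  by apply: (pl_vertex (breakh R g bet) (@breakx_mono R g g_gt1 bet)); rewrite /nbreak; lia.
rewrite sE -offsetS hS => -[[_]|[nz Li]].
  by have [_ L0] := chart_slab (ltnW ik) cv; lra.
have ex := chartxK g i (px v) (py v); have ey := chartyK g i (px v) (py v).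
have [aE iE] := along_end ik.
have ex' := chartxK g i (i.+1)%:R (ty i.+1); have ey' := chartyK g i (i.+1)%:R (ty i.+1).
rewrite -/(chart_x i v) -/(chart_y i v) sE Li in ex ey; rewrite aE iE in ex' ey'.
have pxE : px v = (i.+1)%:R by rewrite -ex -ex'.
have pyE : py v = ty i.+1 by rewrite -ey -ey'.
have [_ I0] := along_start i.+1; have [Bv _ _] := cutopen_surf Dv.
have L1 : chart_y i.+1 v = 0 by rewrite /chart_y pxE pyE.
by split; [apply: edge_piece | right].
Qed.

Lemma flat_inj i v w : (i <= kn)%N -> D v -> D w -> in_chart i v -> in_chart i w ->
  chart_map i v = chart_map i w -> v = w.
Proof.
move=> ik Dv Dw cv cw e.
have := congr1 (@xc R) e; have := congr1 (@yc R) e; rewrite !pt2E => ey ex.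
have SE : chart_x i v = chart_x i w by lra.
have [_ Lv0] := chart_slab ik cv; have [_ Lw0] := chart_slab ik cw.
have [_ zv _] := cutopen_surf Dv; have [_ zw _] := cutopen_surf Dw.
have eN : `|pz v| * (1 + chart_y i v) = `|pz w| * (1 + chart_y i w).
  by have := congr1 Num.norm ey; rewrite !normrM [`|1 + chart_y i v|]ger0_norm ?[`|1 + chart_y i w|]ger0_norm //; lra.
have LE : chart_y i v = chart_y i w.
  case: (chart_height ik Dv cv) => [[/sq_eq1_norm zv1 _]|[/(sq_lt1 zv) zv1 Lv]];
  case: (chart_height ik Dw cw) => [[/sq_eq1_norm zw1 _]|[/(sq_lt1 zw) zw1 Lw]].
  - by rewrite zv1 zw1 in eN; lra.
  - by rewrite zv1 Lw in eN; lra.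
  - by rewrite zw1 Lv in eN; lra.
  - by rewrite Lv Lw.
have zE : pz v = pz w.
  rewrite LE in ey; apply: (mulIf _ ey); rewrite gt_eqF //; lra.
apply: eq_pt3 => //.
  by rewrite -(chartxK g i (px v) (py v)) -/(chart_x i v) -/(chart_y i v) SE LE /chart_x /chart_y chartxK.
by rewrite -[LHS](chartyK g i (px v)) -/(chart_x i v) -/(chart_y i v) SE LE /chart_x /chart_y chartyK.
Qed.

(** Equal abscissas in different charts are possible only at the seam of two consecutive ones;
    [chart_next] then moves both points to the same chart. *)
Lemma unfold_inj v w : D v -> D w -> unfold_map v = unfold_map w -> v = w.
Proof.
move=> Dv Dw e.
have [i ik cv] := chart_cover Dv.1; have [j jk cw] := chart_cover Dw.1.
wlog lt : v w i j Dv Dw e ik jk cv cw / (i <= j)%N.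
  move=> wl; have [le|/ltnW le] := leqP i j; first exact: (wl v w i j).
  by symmetry; apply: (wl w v j i).
move: lt; rewrite leq_eqVlt => /orP[/eqP ij|lt].
  by rewrite -ij in cw; apply: (flat_inj ik Dv Dw cv cw); rewrite -!unfoldE.
have ik' : (i < kn)%N := leq_trans lt jk.
have ev : unfold_map v = chart_map i v by apply: unfoldE.
have ew : unfold_map w = chart_map j w by apply: unfoldE.
have [/andP[sv0 sv1] _] := chart_slab ik cv; have [/andP[sw0 sw1] _] := chart_slab jk cw.
have := congr1 (@xc R) e; rewrite ev ew !pt2E => ex.
have := offset_mono lt; rewrite offsetS => om.
have m0 : 0 <= (j - i.+1)%:R :> R by rewrite ler0n.
have ji : j = i.+1.
  apply/eqP; rewrite eqn_leq lt andbT -subn_eq0 -(pnatr_eq0 R); apply/eqP; lra.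
have sE : chart_x i v = len i by lra.
have cv' := chart_next ik' Dv cv sE.
rewrite -ji in cv'; apply: (flat_inj jk Dv Dw cv' cw).
by rewrite -!unfoldE.
Qed.

End Unfolding.

(** * Closed conditions on points of space *)

Section ClosedPredicates.
Variable R : realType.
Implicit Types (P Q : 'rV[R]_3 -> Prop).

Variant closedp P : Prop :=
  Closedp of forall q, ~ P q -> exists2 e, 0 < e & forall v, edist q v < e -> ~ P v.

Lemma edist3_coord (q v : 'rV[R]_3) :
  [/\ `|px q - px v| <= edist q v, `|py q - py v| <= edist q v & `|pz q - pz v| <= edist q v].
Proof.
have E := edist3_sqrE q v; have d0 := edist_ge0 q v.
have sx2 := sqr_ge0 (px q - px v); have sy2 := sqr_ge0 (py q - py v).
have sz2 := sqr_ge0 (pz q - pz v).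
by split; rewrite -ler_sqr ?nnegrE ?normr_ge0 // real_normK ?num_real // E; lra.
Qed.

Lemma closedp_affine a b c d : closedp (fun v => 0 <= a * px v + b * py v + c * pz v + d).
Proof.
split=> q /negP; rewrite -ltNge => neg.
pose f v := a * px v + b * py v + c * pz v + d.
pose K := `|a| + `|b| + `|c| + 1.
have a0 := normr_ge0 a; have b0 := normr_ge0 b; have c0 := normr_ge0 c.
have K0 : 0 < K by rewrite /K; lra.
exists (- f q / K); first by rewrite divr_gt0 // oppr_gt0.
move=> v; rewrite ltr_pdivlMr // => qv; apply/negP; rewrite -ltNge -/(f v).
have [hx hy hz] := edist3_coord q v.
have : `|f q - f v| <= `|a| * `|px q - px v| + `|b| * `|py q - py v| + `|c| * `|pz q - pz v|.
  have -> : f q - f v = a * (px q - px v) + b * (py q - py v) + c * (pz q - pz v).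
    by rewrite /f; ring.
  apply: le_trans (ler_normD _ _) _; rewrite normrM lerD2r.
  by apply: le_trans (ler_normD _ _) _; rewrite !normrM.
have : `|a| * `|px q - px v| <= `|a| * edist q v by rewrite ler_wpM2l.
have : `|b| * `|py q - py v| <= `|b| * edist q v by rewrite ler_wpM2l.
have : `|c| * `|pz q - pz v| <= `|c| * edist q v by rewrite ler_wpM2l.
rewrite ler_norml => h1 h2 h3 /andP[h4 h5].
have := edist_ge0 q v; rewrite /K in qv; lra.
Qed.

Lemma closedp_iff P Q : (forall v, P v <-> Q v) -> closedp P -> closedp Q.
Proof.
move=> PQ [cP]; split=> q nQ; have [|e e0 h] := cP q; first by rewrite PQ.
by exists e => // v /h; rewrite PQ.
Qed.

Lemma closedp_and P Q : closedp P -> closedp Q -> closedp (fun v => P v /\ Q v).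
Proof.
move=> [cP] [cQ]; split=> q /boolp.not_andP[/cP|/cQ] [e e0 h]; exists e => // v /h; tauto.
Qed.

Lemma closedp_or P Q : closedp P -> closedp Q -> closedp (fun v => P v \/ Q v).
Proof.
move=> [cP] [cQ]; split=> q /boolp.not_orP[/cP[e e0 h] /cQ[e' e0' h']].
exists (Num.min e e'); first by rewrite lt_min e0.
by move=> v; rewrite lt_min => /andP[/h ? /h' ?]; tauto.
Qed.

Lemma closedp_forall m (P : nat -> 'rV[R]_3 -> Prop) : (forall l, (l < m)%N -> closedp (P l)) ->
  closedp (fun v => forall l, (l < m)%N -> P l v).
Proof.
move=> cP; split=> q /boolp.existsNP[l /boolp.not_implyP[lm]].
by case: (cP l lm) => c /c[e e0 h]; exists e => // v /h nP all; apply/nP/all.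
Qed.

Lemma closedp_uniform m (P : nat -> 'rV[R]_3 -> Prop) q : (forall l, (l < m)%N -> closedp (P l)) ->
  exists2 e, 0 < e & forall v, edist q v < e -> forall l, (l < m)%N -> P l v -> P l q.
Proof.
elim: m => [|m IH] cP; first by exists 1.
have [l lm|e e0 h] := IH; first by apply: cP; apply: ltnW.
have [c] := cP m (ltnSn m); have [Pq|/c[e' e0' h']] := boolp.pselect (P m q).
  exists e => // v /h hv l; rewrite ltnS leq_eqVlt => /orP[/eqP -> //|lm].
  exact: hv.
exists (Num.min e e'); first by rewrite lt_min e0.
move=> v; rewrite lt_min => /andP[/h hv /h' nP] l.
by rewrite ltnS leq_eqVlt => /orP[/eqP ->|lm /(hv l lm)].
Qed.

End ClosedPredicates.

(** * The unfolding is a local isometry *)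

Section LocalIsometry.
Variables (R : realType) (g : nat).
Hypothesis g_gt1 : (1 < g)%N.
Variable S : {set 'I_g}.
Notation kn := (nsides g).
Notation kr := (nsidesR R g).
Notation cc := (curv R g).
Notation ty := (vertex_y R g).
Notation len := (edge_len R g).
Notation offset := (strip_offset R g).
Notation bet := (bits S).
Notation V := (@prism R g).
Notation T := (prism_tree R g_gt1 S).
Notation D := (@cutopen R g g_gt1 S).
Notation chart := (@in_chart R g S).
Notation flat := (@chart_map R g).
Notation L_ := (@chart_y R g).
Notation S_ := (@chart_x R g).
Notation unfold := (@unfold_map R g S).
Implicit Types (i j l : nat) (v w q : 'rV[R]_3).

Lemma closedp_planar a b d :
  closedp (fun v => 0 <= a * px v + b * py v + d).
Proof.
apply: closedp_iff _ (closedp_affine a b 0 d) => v.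
by rewrite mul0r addr0.
Qed.

Lemma closedp_inB : closedp (fun v => inB g (px v) (py v)).
Proof.
refine (@closedp_and _ _ _ _ _).
  by apply: closedp_iff _ (closedp_planar 0 1 0) => v; rewrite mul0r add0r mul1r addr0.
refine (@closedp_forall _ _ (fun l v => _) _) => l _.
apply: closedp_iff _ (closedp_planar (cc * (kr - 1 - 2 * l%:R)) (-1) (cc * (l%:R * (l%:R + 1)))) => v.
by rewrite -[py v <= _]subr_ge0; have -> : line g l (px v) - py v =
  cc * (kr - 1 - 2 * l%:R) * px v + -1 * py v + cc * (l%:R * (l%:R + 1)) by rewrite /line; ring.
Qed.

Lemma cut_affine l : exists a d, forall x : R, cut g bet l x = a * x + d.
Proof.
rewrite /cut; case: (bet l./2).
  exists (cc * (kr - 2 * (midv l)%:R)), (cc * ((midv l)%:R ^+ 2 - 1)) => x.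
  by rewrite /diag; ring.
exists (cc * (kr - 1 - 2 * l%:R)), (cc * (l%:R * (l%:R + 1))) => x.
by rewrite /line; ring.
Qed.

Lemma closedp_piece i : closedp (fun v => piece g bet i (px v) (py v)).
Proof.
refine (@closedp_and _ _ _ closedp_inB _).
case: (i < kn)%N; last first.
  refine (@closedp_forall _ _ (fun l v => _) _) => l _; have [a [d cE]] := cut_affine l.
  apply: closedp_iff _ (closedp_planar a (-1) d) => v.
  by rewrite cE -[py v <= _]subr_ge0; have -> : a * px v + d - py v =
    a * px v + -1 * py v + d by ring.
refine (@closedp_and _ _ _ _ _).
  have [a [d cE]] := cut_affine i.
  apply: closedp_iff _ (closedp_planar (- a) 1 (- d)) => v.
  by rewrite cE -[_ <= py v]subr_ge0; have -> : py v - (a * px v + d) =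
    - a * px v + 1 * py v + - d by ring.
rewrite /side; case: (odd i).
  apply: closedp_iff _ (closedp_planar 1 (diag_slope R g (midv i))
    (- (midv i)%:R - diag_slope R g (midv i) * ty (midv i))) => v.
  by have -> : nrm g (midv i) (px v) (py v) = 1 * px v + diag_slope R g (midv i) * py v +
    (- (midv i)%:R - diag_slope R g (midv i) * ty (midv i)) by rewrite /nrm; ring.
apply: closedp_iff _ (closedp_planar (-1) (- diag_slope R g (midv i))
    ((midv i)%:R + diag_slope R g (midv i) * ty (midv i))) => v.
rewrite -[nrm _ _ _ _ <= 0]oppr_ge0.
by have -> : - nrm g (midv i) (px v) (py v) = -1 * px v + - diag_slope R g (midv i) * py v +
    ((midv i)%:R + diag_slope R g (midv i) * ty (midv i)) by rewrite /nrm; ring.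
Qed.

(** Charts are closed: on the surface [pz] stays between -1 and 1 and [inward] is nonnegative, so
    the equations of [in_chart] can be replaced by affine inequalities. *)
Lemma chart_near q : D q -> exists2 e, 0 < e & forall v, D v -> edist q v < e ->
  forall i, (i <= kn)%N -> chart i v -> chart i q.
Proof.
pose P i v := piece g bet i (px v) (py v) /\
  ((0 <= 0 * px v + 0 * py v + 1 * pz v + -1 \/ 0 <= 0 * px v + 0 * py v + -1 * pz v + -1)
   \/ 0 <= - ub R g i * px v + ua R g i * py v + (ub R g i * i%:R - ua R g i * ty i)).
have PE v i : (i <= kn)%N -> D v -> P i v <-> chart i v.
  move=> ik /cutopen_surf[Bv /andP[z0 z1] _]; rewrite /P /in_chart /chart_y.
  have L0 := inB_inward ik Bv.
  have LE : - ub R g i * px v + ua R g i * py v + (ub R g i * i%:R - ua R g i * ty i) =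
    - inward g i (px v) (py v) by rewrite /inward; ring.
  rewrite LE; split=> -[pc h]; split=> //; case: h => h.
  - by left; case: h => h; nra.
  - by right; lra.
  - by left; have [p0|p0] := leP 0 (pz v); [left|right]; nra.
  - by right; lra.
have cP i : (i < kn.+1)%N -> closedp (P i).
  move=> _; refine (@closedp_and _ _ _ (closedp_piece i) _).
  refine (@closedp_or _ _ _ _ (closedp_planar _ _ _)).
  exact: (@closedp_or _ _ _ (closedp_affine _ _ _ _) (closedp_affine _ _ _ _)).
move=> Dq; have [e e0 h] := closedp_uniform q cP.
by exists e => // v Dv qv i ik; rewrite -!PE // => /(h v qv i ik).
Qed.

Lemma flat_isometry i v w : (pz v = pz w /\ pz v * pz v = 1) \/ (L_ i v = 0 /\ L_ i w = 0) ->
  edist (flat i v) (flat i w) = edist v w.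
Proof.
move=> h; have iso := chart_isometry g i (px v) (py v) (px w) (py w).
apply/eqP; rewrite -(eqrXn2 (_ : 0 < 2)%N) ?edist_ge0 //; apply/eqP.
rewrite edist2_sqrE edist3_sqrE !pt2E -iso -/(S_ i v) -/(S_ i w) -/(L_ i v) -/(L_ i w).
case: h => [[<- zz]|[-> ->]]; last by ring.
transitivity ((S_ i v - S_ i w) ^+ 2 + (pz v * pz v) * (L_ i v - L_ i w) ^+ 2); first by ring.
by rewrite zz; ring.
Qed.

Lemma facet_seg v w : surf V v -> surf V w ->
  (exists s, pz v = zs R s /\ pz w = zs R s) \/
  (exists2 i, (i <= kn)%N & L_ i v = 0 /\ L_ i w = 0) -> seg v w `<=` surf V.
Proof.
move=> Sv Sw h.
have [a [av aw]] : exists a : facet g, facet_fun a v = 0 /\ facet_fun a w = 0.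
  case: h => [[s [vs ws]]|[i ik [vi wi]]].
    by exists (inr s); rewrite !facet_fun_base vs ws zs_sqr subrr.
  by exists (inl (@Ordinal kn.+1 i ik)); rewrite !facet_fun_side.
exact: (surf_seg (@fnormal_unit R g) (inQP g_gt1) Sv Sw av aw).
Qed.

Lemma surf_path2 v w : seg v w `<=` surf V ->
  surf_path V v w [:: v; w] /\ plen [:: v; w] = edist v w.
Proof.
move=> h; split; last by rewrite plen_cons plen1 addr0.
split=> //; split=> //; split=> // z /polyset_cons[/h //|[j [lt_j _]]].
by move: lt_j.
Qed.

Lemma surf_path3 v u w : seg v u `<=` surf V -> seg u w `<=` surf V ->
  exists p, surf_path V v w p /\ plen p = edist v u + edist u w.
Proof.
move=> h h'; exists [:: v; u; w]; split; last by rewrite !plen_cons plen1 addr0.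
split=> //; split=> //; split=> // z /polyset_cons[/h //|/polyset_cons[/h' //|[j [lt_j _]]]].
by move: lt_j.
Qed.

Lemma pz_sign v : pz v * pz v = 1 -> exists s, pz v = zs R s.
Proof.
by move=> zz; have [z0|z0] := leP 0 (pz v); [exists true | exists false]; rewrite /zs; nra.
Qed.

Lemma join_edge i s v w : (i <= kn)%N -> surf V v -> surf V w -> pz v = zs R s ->
  0 < L_ i v -> L_ i w = 0 -> 0 <= S_ i v <= len i -> 0 <= S_ i w <= len i ->
  exists u, [/\ seg v u `<=` surf V, seg u w `<=` surf V &
    edist v u + edist u w = edist (flat i v) (flat i w)].
Proof.
move=> ik Sv Sw vs Lv Lw sv sw.
have [Bw /andP[w0 w1] _] := (surf_prism g_gt1 w).1 Sw.
have zz := zs_sqr R s.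
have wz : zs R s * pz w <= 1 by rewrite /zs; case: (s); lra.
(* The segment between the unfolded points crosses the image of edge i at parameter t. *)
pose t := L_ i v / (L_ i v + 1 - zs R s * pz w).
have q0 : 0 < L_ i v + 1 - zs R s * pz w by lra.
have t01 : 0 <= t <= 1 by rewrite /t divr_ge0 ?ler_pdivrMr //; lra.
have tE : t * (L_ i v + 1 - zs R s * pz w) = L_ i v by rewrite /t mulfVK // gt_eqF.
pose m := (1 - t) * S_ i v + t * S_ i w.
have m01 : 0 <= m <= len i.
  by rewrite /m; case/andP: t01 => t0 t1; case/andP: sv => ? ?; case/andP: sw => ? ?; apply/andP; split; nra.
pose u := pt3 (chartx g i m 0) (charty g i m 0) (zs R s).
have Lu : L_ i u = 0 by rewrite /chart_y !pt3E inward_chart.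
have Su : surf V u.
  apply/(surf_prism g_gt1); rewrite !pt3E; split; [exact: inB_edge | exact: zs_range | by left].
have vu : seg v u `<=` surf V by apply: facet_seg => //; left; exists s; rewrite pt3E.
have uw : seg u w `<=` surf V by apply: facet_seg => //; right; exists i.
exists u; split=> //.
rewrite -(@flat_isometry i v u); last by left; rewrite vs pt3E.
rewrite -(@flat_isometry i u w); last by right.
apply: seg_edist; rewrite /u flat_chart; apply/seg2P; exists t; split=> //.
rewrite !pt2E Lw vs !addr0 !mulr1 /m; split; first by ring.
transitivity (zs R s + zs R s * (L_ i v - t * (L_ i v + 1 - zs R s * pz w))).
  by rewrite tE subrr mulr0 addr0.
transitivity ((1 - t) * (zs R s * (1 + L_ i v)) + t * ((zs R s * zs R s) * pz w)); first by ring.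
by rewrite zz; ring.
Qed.

(** Two consecutive side facets are unrolled side by side; the segment between the images crosses
    the seam at parameter [t] and folds back to a path bent at the vertical edge. *)
Lemma join_seam i v w : (i < kn)%N -> surf V v -> surf V w ->
  L_ i v = 0 -> L_ i.+1 w = 0 -> S_ i v <= len i -> 0 <= S_ i.+1 w ->
  exists u, [/\ seg v u `<=` surf V, seg u w `<=` surf V &
    edist v u + edist u w = edist (flat i v) (flat i.+1 w)].
Proof.
move=> ik Sv Sw Lv Lw sv sw.
have [[_ vz _] [_ wz _]] := ((surf_prism g_gt1 v).1 Sv, (surf_prism g_gt1 w).1 Sw).
pose q := len i - S_ i v + S_ i.+1 w; pose t := (len i - S_ i v) / q.
have [aE iE] := along_end R ik; have [aS iS] := along_start R g i.+1.
have [t01 tE] : 0 <= t <= 1 /\ t * q = len i - S_ i v.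
  (* If [q = 0], both points lie on the seam, and the inverse of 0 being 0 gives [t = 0]. *)
  have [q0|nq0] := eqVneq q 0.
    by rewrite /t q0 invr0 !mulr0; split; [lra | rewrite /q in q0; lra].
  have q0 : 0 < q by rewrite lt_neqAle eq_sym nq0 /q; lra.
  split; last by rewrite /t mulfVK.
  by rewrite /t divr_ge0 ?(ltW q0) ?subr_ge0 //= ler_pdivrMr // mul1r /q lerDl.
pose u := pt3 (i.+1)%:R (ty i.+1) ((1 - t) * pz v + t * pz w) : 'rV[R]_3.
have Lu : L_ i u = 0 by rewrite /chart_y !pt3E.
have Lu' : L_ i.+1 u = 0 by rewrite /chart_y !pt3E.
have Su : surf V u.
  apply/(surf_prism g_gt1); rewrite !pt3E; split; first exact: inB_vertex.
    by case/andP: t01 => t0 t1; case/andP: vz => ? ?; case/andP: wz => ? ?; apply/andP; split; nra.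
  by right; exists i; rewrite // ltnW.
have vu : seg v u `<=` surf V by apply: facet_seg => //; right; exists i; rewrite // ltnW.
have uw : seg u w `<=` surf V by apply: facet_seg => //; right; exists i.+1.
exists u; split=> //.
rewrite -(@flat_isometry i v u); last by right.
rewrite -(@flat_isometry i.+1 u w); last by right.
have uE : flat i u = flat i.+1 u by apply: flat_seam; rewrite ?pt3E.
rewrite uE; apply: seg_edist; apply/seg2P; exists t; split=> //.
rewrite !pt2E Lv Lw Lu' /chart_x !pt3E aS offsetS !addr0 !mulr1 -/(S_ i v) -/(S_ i.+1 w).
split=> //; have -> : (1 - t) * (offset i + S_ i v) + t * (offset i + len i + S_ i.+1 w) =
  offset i + S_ i v + t * q by rewrite /q; ring.
by rewrite tE; ring.
Qed.

(** [sdist_local] needs a map that is isometric on whole facets, across the cuts, since paths may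
    cross them. [unfold] is not such a map, so near [q] it is replaced by [phi]. *)
Lemma local_isometry_glue (D' : set 'rV[R]_3) q phi (e1 e0 : R) :
  0 < e1 -> 0 < e0 -> D q ->
  (forall v, D v -> edist q v < e1 -> D' v /\ unfold v = phi v) ->
  D' `<=` surf V ->
  (forall (a : facet g) v w, facet_fun a q = 0 -> surf V v -> surf V w ->
     facet_fun a v = 0 -> facet_fun a w = 0 -> edist (phi v) (phi w) = edist v w) ->
  (forall v w, D' v -> D' w -> edist q v < e0 -> edist q w < e0 ->
     exists s, surf_path V v w s /\ plen s = edist (phi v) (phi w)) ->
  exists e, 0 < e /\ forall v w, D v -> D w -> edist q v < e -> edist q w < e ->
    edist (unfold v) (unfold w) = sdist V v w.
Proof.
move=> e1_gt0 e0_gt0 Dq near sub iso join.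
have [e [e_gt0 h]] := sdist_local (@fnormal_unit R g) (inQP g_gt1) e0_gt0 sub Dq.1 iso join.
exists (Num.min e e1); split; first by rewrite lt_min e_gt0.
move=> v w Dv Dw; rewrite !lt_min => /andP[ve v1] /andP[we w1].
have [[Dv' ->] [Dw' ->]] := (near v Dv v1, near w Dw w1).
exact: h.
Qed.

Lemma facet_chart (a : facet g) q : D q -> facet_fun a q = 0 ->
  (exists s, pz q = zs R s /\ a = inr s) \/
  (exists i : 'I_kn.+1, chart i q /\ a = inl i).
Proof.
move=> Dq; have [Bq _ _] := cutopen_surf Dq; case: a => [i|s].
  rewrite facet_fun_side => Li; right; exists i; split=> //; split; last by right.
  by apply: edge_piece => //; rewrite -ltnS.
by rewrite facet_fun_base => h; left; exists s; split=> //; have := zs_sqr R s; rewrite /zs in h *; case: (s) h => /=; lra.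
Qed.

Lemma local_isometry_chart i q : (i <= kn)%N -> D q -> chart i q ->
  (forall j, (j <= kn)%N -> chart j q -> j = i) ->
  exists e, 0 < e /\ forall v w, D v -> D w -> edist q v < e -> edist q w < e ->
    edist (unfold v) (unfold w) = sdist V v w.
Proof.
move=> ik Dq ciq only.
have [e e_gt0 near] := chart_near Dq.
(* Two points within 1 of [q] cannot lie on opposite bases, which are 2 apart. *)
apply: (@local_isometry_glue [set v | D v /\ chart i v] q (flat i) e 1) => //.
- move=> v Dv qv; have [j jk cj] := chart_cover g_gt1 S Dv.1.
  have ji := only j jk (near v Dv qv j jk cj).
  by rewrite ji in cj; split=> //; apply: unfoldE.
- by move=> v [[]].
- move=> a v w aq Sv Sw av aw; apply: flat_isometry.
  case: (facet_chart Dq aq) => [[s [_ aE]]|[j [cj aE]]]; move: av aw; rewrite aE.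
    rewrite !facet_fun_base => h1 h2; left; have zz := zs_sqr R s.
    by rewrite /zs in h1 h2 *; case: (s) h1 h2 => h1 h2; split; nra.
  have jk : (j <= kn)%N by have := ltn_ord j; rewrite ltnS.
  by rewrite !facet_fun_side (only j jk cj); right.
move=> v w [Dv cv] [Dw cw] qv qw.
have [sv Lv] := chart_slab g_gt1 ik cv; have [sw Lw] := chart_slab g_gt1 ik cw.
have flat_path : (exists s, pz v = zs R s /\ pz w = zs R s) \/ (L_ i v = 0 /\ L_ i w = 0) ->
    exists p, surf_path V v w p /\ plen p = edist (flat i v) (flat i w).
  move=> h; have sub : seg v w `<=` surf V.
    by apply: facet_seg; [exact: Dv.1 | exact: Dw.1 | case: h => h; [left | right; exists i]].
  have [path len_path] := surf_path2 sub; exists [:: v; w]; split=> //.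
  rewrite len_path flat_isometry //; case: h => [[s [-> ->]]|h]; last by right.
  by left; rewrite zs_sqr.
have [Lv0|Lv0] := eqVneq (L_ i v) 0.
  have [Lw0|Lw0] := eqVneq (L_ i w) 0; first by apply: flat_path; right.
  have [s ws] : exists s, pz w = zs R s.
    by case: cw => _ [/pz_sign //|e0]; rewrite e0 eqxx in Lw0.
  have Lw1 : 0 < L_ i w by rewrite lt_neqAle eq_sym Lw0.
  have [u [wu uv len_u]] := join_edge ik Dw.1 Dv.1 ws Lw1 Lv0 sw sv.
  rewrite edistC -len_u addrC edistC [edist w u]edistC.
  by apply: surf_path3; rewrite segC.
have [s vs] : exists s, pz v = zs R s.
  by case: cv => _ [/pz_sign //|e0]; rewrite e0 eqxx in Lv0.
have Lv1 : 0 < L_ i v by rewrite lt_neqAle eq_sym Lv0.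
have [Lw0|Lw0] := eqVneq (L_ i w) 0.
  by have [u [vu uw <-]] := join_edge ik Dv.1 Dw.1 vs Lv1 Lw0 sv sw; apply: surf_path3.
have [s' ws] : exists s, pz w = zs R s.
  by case: cw => _ [/pz_sign //|e0]; rewrite e0 eqxx in Lw0.
apply: flat_path; left; exists s; split=> //.
have [_ _ hv] := edist3_coord q v; have [_ _ hw] := edist3_coord q w.
have {hv}hv := le_lt_trans hv qv; have {hw}hw := le_lt_trans hw qw.
rewrite !ltr_norml vs ws in hv hw *; rewrite /zs in hv hw *.
by case: (s) hv; case: (s') hw => // hw hv; exfalso; lra.
Qed.

(** By [chart_overlap] such a point lies on a vertical edge strictly between the bases, and nearby
    only the two side facets at this edge occur. *)
Lemma local_isometry_seam i q : (i < kn)%N -> D q -> chart i q -> chart i.+1 q ->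
  exists e, 0 < e /\ forall v w, D v -> D w -> edist q v < e -> edist q w < e ->
    edist (unfold v) (unfold w) = sdist V v w.
Proof.
move=> ik Dq ci ci1.
have [_ qx qy qz] := chart_overlap (ltnSn i) ik Dq ci ci1.
have [_ zr _] := cutopen_surf Dq; have z1 := sq_lt1 zr qz.
have only j : (j <= kn)%N -> chart j q -> j = i \/ j = i.+1.
  move=> jk cj; case: (ltngtP j i) => lt; [ | | by left].
    have [_ jx _ _] := chart_overlap (ltn_trans lt (ltnSn i)) ik Dq cj ci1.
    have [e1 _ _ _] := chart_overlap (ltn_trans lt (ltnSn i)) ik Dq cj ci1.
    by move: lt; rewrite -[j]succnK -e1 /= ltnn.
  case: (ltngtP j i.+1) => lt'; [by lia | | by right].
  have [e1 _ _ _] := chart_overlap lt jk Dq ci cj.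
  by rewrite e1 ltnn in lt'.
have [e e_gt0 near] := chart_near Dq.
(* On the common edge of the two facets both chart maps agree, so on either facet [phi] is the chart
   map of that facet. *)
pose phi v := if L_ i.+1 v == 0 then flat i.+1 v else flat i v.
pose D' := [set v | surf V v /\ ((L_ i v = 0 /\ S_ i v <= len i) \/
   (L_ i.+1 v = 0 /\ 0 <= S_ i.+1 v))].
have vertex v : surf V v -> L_ i v = 0 -> L_ i.+1 v = 0 -> flat i v = flat i.+1 v.
  move=> Sv Li Li1; have [Bv _ _] := (surf_prism g_gt1 v).1 Sv.
  suff off : ~ (px v = 0 /\ py v = 0).
    by have [_ ex ey] := edge_meet g_gt1 (ltnSn i) ik Bv Li Li1 off; apply: flat_seam.
  move=> [ex ey]; have c0 := cc_gt0 R g_gt1.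
  have line0 l : (l < kn)%N -> L_ l v = 0 -> l = 0%N.
    move=> lk Ll; have := inward_edge (px v) (py v) lk; rewrite -/(L_ l v) Ll mul0r ex ey.
    rewrite subr0 /line mulr0 add0r => /esym/eqP.
    rewrite mulf_eq0 (gt_eqF c0) /= mulf_eq0 => /orP[|/eqP].
      by rewrite pnatr_eq0 => /eqP.
    by move=> h; exfalso; have l0 : 0 <= l%:R :> R by [rewrite ler0n]; lra.
  have i0 := line0 i ik Li; have k4 : (4 <= kn)%N by rewrite /nsides; lia.
  by have := line0 i.+1 ltac:(rewrite i0; lia) Li1.
have phi1 v : L_ i.+1 v = 0 -> phi v = flat i.+1 v by move=> h; rewrite /phi h eqxx.
have phi0 v : surf V v -> L_ i v = 0 -> phi v = flat i v.
  by move=> Sv h; rewrite /phi; case: eqP => // h1; rewrite -vertex.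
have e0_gt0 : 0 < 1 - `|pz q| by lra.
apply: (@local_isometry_glue D' q phi (Num.min e (1 - `|pz q|)) 1) => //.
- by rewrite lt_min e_gt0.
- move=> v Dv; rewrite lt_min => /andP[qv qv'].
  have [j jk cj] := chart_cover g_gt1 S Dv.1.
  have vz : pz v * pz v <> 1.
    move=> /sq_eq1_norm v1; have [_ _ h] := edist3_coord q v.
    have := ler_distD (pz q) (pz v) 0; rewrite !subr0 v1 distrC; lra.
  have [sj _] := chart_slab g_gt1 jk cj.
  have Lj : L_ j v = 0 by case: cj => _ [].
  rewrite (unfoldE jk Dv cj).
  case: (only j jk (near v Dv qv j jk cj)) => jE; rewrite jE in Lj sj *.
    split; last by rewrite phi0 //; apply: Dv.1.
    by split; [exact: Dv.1 | left; split=> //; case/andP: sj].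
  split; last by rewrite phi1.
  by split; [exact: Dv.1 | right; split=> //; case/andP: sj].
- by move=> v [].
- move=> a v w aq Sv Sw av aw.
  case: (facet_chart Dq aq) => [[s [qs _]]|[j [cj aE]]].
    by case: qz; rewrite qs zs_sqr.
  have jk : (j <= kn)%N by have := ltn_ord j; rewrite ltnS.
  move: av aw; rewrite aE !facet_fun_side -/(L_ j v) -/(L_ j w).
  case: (only j jk cj) => -> Lv Lw.
    by rewrite !phi0 //; apply: flat_isometry; right.
  by rewrite !phi1 //; apply: flat_isometry; right.
move=> v w [Sv hv] [Sw hw] _ _.
have same j : (j <= kn)%N -> L_ j v = 0 -> L_ j w = 0 ->
    exists p, surf_path V v w p /\ plen p = edist (flat j v) (flat j w).
  move=> jk Lv Lw; have sub : seg v w `<=` surf V.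
    by apply: facet_seg => //; right; exists j.
  have [path len_path] := surf_path2 sub; exists [:: v; w]; split=> //.
  by rewrite len_path flat_isometry //; right.
case: hv => -[Lv sv]; case: hw => -[Lw sw].
- by rewrite !phi0 //; apply: same => //; apply: ltnW.
- rewrite phi0 // phi1 //.
  by have [u [vu uw <-]] := join_seam ik Sv Sw Lv Lw sv sw; apply: surf_path3.
- rewrite phi1 // phi0 // edistC.
  have [u [wu uv <-]] := join_seam ik Sw Sv Lw Lv sw sv.
  by rewrite addrC edistC [edist w u]edistC; apply: surf_path3; rewrite segC.
- by rewrite !phi1 //; apply: same.
Qed.

Lemma unfold_local q : D q -> exists e, 0 < e /\ forall v w, D v -> D w ->
  edist q v < e -> edist q w < e -> edist (unfold v) (unfold w) = sdist V v w.
Proof.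
move=> Dq; have [i ik ci] := chart_cover g_gt1 S Dq.1.
have [only|] := boolp.pselect (forall j, (j <= kn)%N -> chart j q -> j = i).
  exact: (local_isometry_chart ik Dq ci only).
move=> /boolp.existsNP[j /boolp.not_implyP[jk /boolp.not_implyP[cj ji]]].
case: (ltngtP i j) => lt; last by case: ji.
  have [e _ _ _] := chart_overlap lt jk Dq ci cj.
  by rewrite e in cj jk; apply: (local_isometry_seam jk Dq ci cj).
have [e _ _ _] := chart_overlap lt ik Dq cj ci.
by rewrite e in ci ik; apply: (local_isometry_seam ik Dq cj ci).
Qed.

Lemma prism_unfolding : is_unfolding V T unfold (@unfolded R g bet).
Proof.
split; first by move=> v w; apply: unfold_inj.
split; first exact: unfold_local.
split; last exact: unfolded_polygon g_gt1 bet.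
apply/seteqP; split=> [_ [v Dv <-]|z Uz]; first exact: (unfold_into (Dv : D v)).
by have [v Dv e] := unfold_onto g_gt1 Uz; exists v.
Qed.

End LocalIsometry.

Theorem theorem11 (R : realType) :
  exists d : nat, (0 < d)%N /\
  forall N : nat, exists n : nat, (N <= n)%N /\
  exists V : 'I_n -> 'rV[R]_3, is_polytope V /\
  exists (m : nat) (T : 'I_m -> cut_tree R) (U : 'I_m -> set 'rV[R]_2),
    (2 ^ (n %/ d) <= m)%N /\
    (forall i, is_cut_tree V (T i) /\ exists f, is_unfolding V (T i) f (U i)) /\
    (forall i j, i != j -> ~ comb_iso V (T i) (T j)) /\
    exists J : {set 'I_m}, (2 ^ (n %/ d) <= #|J|)%N /\
      (forall i j, i \in J -> j \in J -> i != j -> ~ congruent (U i) (U j)).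
Proof.
(* The prism has [n = 4g + 2] vertices, hence [n %/ 5 <= g]; the summand 2 provides [1 < g]. *)
exists 5; split=> // N; set g := (N + 2)%N.
have g_gt1 : (1 < g)%N by rewrite /g; lia.
exists (nvert g); split; first by rewrite nvertE /nsides /g; lia.
exists (@prism R g); split; first exact: prism_polytope.
have bound : (2 ^ (nvert g %/ 5) <= #|{set 'I_g}|)%N.
  by rewrite -[leqRHS]cardsT -powersetT card_powerset cardsT card_ord leq_exp2l // nvertE /nsides /g; lia.
exists #|{set 'I_g}|, (fun i => prism_tree R g_gt1 (enum_val i)),
  (fun i => @unfolded R g (bits (enum_val i))); split=> //; split.
  move=> i; split; first exact: prism_is_cut_tree.
  by exists (@unfold_map R g (enum_val i)); apply: prism_unfolding.
split; first by move=> i j; rewrite -(inj_eq enum_val_inj) => /eqP ne /prism_tree_distinct.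
(* No two of the unfoldings are congruent, so all indices are taken. *)
exists [set: 'I_#|{set 'I_g}|]%SET; rewrite cardsT card_ord; split=> // i j _ _.
rewrite -(inj_eq enum_val_inj) => /eqP ne /(unfolded_congruent g_gt1) same; apply: ne.
by apply/setP => b; have := same b (ltn_ord b); rewrite !bitsE.
Qed.
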